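(* Let $d\ge 1$, $N\ge 2$ an integer, and $\beta>0$. The following hold for $T_{>N,\beta}=(\mathrm{Id}-\beta\Delta)^{-1}(\mathrm{Id}-\Pi_N^{(d)})$, with kernel $K_{>N,\beta}$, and $T_{N,\beta}=(\mathrm{Id}-\beta\Delta)^{-1}\Pi_N^{(d)}$. (1) (Sharp $L^1$ bound) $$\frac{c_1}{1+\beta N^2}(\log(N+2))^d\le \|K_{>N,\beta}\|_{L^1(\mathbb T^d)}\le \frac{c_2}{1+\beta N^2}(\log(N+2))^d,$$ where $c_1>0$, $c_2>0$ depend only on the dimension $d$. (2) (Effective maximum principle) For all $N\ge 2$ and all $f\in L^\infty(\mathbb T^d)$, $$\|T_{N,\beta}f\|_{L^\infty(\mathbb T^d)}\le\Bigl(1+\frac{c_3}{1+\beta N^2}(\log(N+2))^d\Bigr)\|f\|_{L^\infty(\mathbb T^d)},$$ where $c_3>0$ depends only on $d$. (3) (Sharp maximum principle) Let $d=1$ or $d=2$, and denote the kernel of $T_{N,\beta}$ by $K_{N,\beta}$. There is $N_0=N_0(\beta,d)$, depending only on $\beta$ and $d$, such that for all $N\ge N_0$, $K_{N,\beta}$ is a strictly positive function on $\mathbb T^d$ with unit $L^1$ mass, and consequently $\|T_{N,\beta}f\|_{L^\infty(\mathbb T^d)}\le\|f\|_{L^\infty(\mathbb T^d)}$ for all $f\in L^\infty(\mathbb T^d)$.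
   Context: $\mathbb T^d=\mathbb R^d/\mathbb Z^d$ is identified with $[0,1)^d$. For $k\in\mathbb Z^d$, $|k|$ is the Euclidean norm and $|k|_\infty=\max_j|k_j|$. $\Pi_N^{(d)}$ is the Fourier truncation with multiplier $1_{|k|_\infty\le N}$ (Fourier modes $e^{2\pi i k\cdot x}$). Thus $T_{>N,\beta}$ and $T_{N,\beta}$ have Fourier multipliers $\frac{1}{1+\beta(2\pi|k|)^2}1_{|k|_\infty>N}$ and $\frac{1}{1+\beta(2\pi|k|)^2}1_{|k|_\infty\le N}$, and their kernels are the periodic functions (convolution kernels on $\mathbb T^d$) with these Fourier coefficients. *)

(* Defs.v *)
From HB Require Import structures.
From mathcomp Require Import all_boot all_order all_algebra.
From mathcomp Require Import complex zify.
From mathcomp Require Import all_classical all_reals all_analysis.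
Set Implicit Arguments.
Unset Strict Implicit.
Unset Printing Implicit Defensive.
Import Order.TTheory GRing.Theory Num.Theory.
Import numFieldNormedType.Exports.
Local Open Scope classical_set_scope.
Local Open Scope ring_scope.

(* The torus T^d is identified with [0,1)^d: functions on T^d are functions on
   d.-tuple R, integrated against Lebesgue measure restricted to [0,1)^d, so
   that only their values on [0,1)^d matter.  They are complex-valued, which
   includes the real-valued ones. *)

Definition unit_interval_measure (R : realType) (A : set R) : \bar R :=
  lebesgue_measure (A `&` `[0%R, 1%R[%classic).

Section unit_interval_measure.
Variable R : realType.

Let m0 : @unit_interval_measure R set0 = 0%E.
Proof. by rewrite /unit_interval_measure set0I measure0. Qed.

Let m_ge0 (A : set R) : (0 <= unit_interval_measure A)%E.
Proof. exact: measure_ge0. Qed.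

Let m_sigma_additive : semi_sigma_additive (@unit_interval_measure R).
Proof.
exact: (@measure_semi_sigma_additive _ _ _
  (mrestr (@lebesgue_measure R) (measurable_itv `[0%R, 1%R[))).
Qed.

HB.instance Definition _ := isMeasure.Build _ _ _ (@unit_interval_measure R)
  m0 m_ge0 m_sigma_additive.

Let mT : @unit_interval_measure R [set: R] = 1%E.
Proof.
rewrite /unit_interval_measure setTI lebesgue_measure_itv /=.
by rewrite lte_fin ltr01 -EFinB subr0.
Qed.

HB.instance Definition _ := Measure_isProbability.Build _ _ _
  (@unit_interval_measure R) mT.

End unit_interval_measure.

Definition tcons (R : realType) (n : nat) (p : R * n.-tuple R) : n.+1.-tuple R :=
  [tuple of p.1 :: p.2].

Lemma measurable_tcons (R : realType) (n : nat) :
  measurable_fun [set: R * n.-tuple R] (@tcons R n).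
Proof. exact: measurable_cons. Qed.

HB.instance Definition _ (R : realType) (n : nat) :=
  isMeasurableFun.Build _ _ _ _ (@tcons R n) (@measurable_tcons R n).

Fixpoint torus_measure (R : realType) (d : nat) :
    probability (d.-tuple R) R :=
  if d is n.+1 then
    distribution (@unit_interval_measure R \x torus_measure R n)%E (@tcons R n)
  else \d_([tuple] : 0.-tuple R).

Lemma torus_measure_box (R : realType) (d : nat) (A : 'I_d -> set R) :
  (forall i, measurable (A i)) ->
  torus_measure R d [set x | forall i, A i (tnth x i)] =
  (\prod_(i < d) lebesgue_measure (A i `&` `[0%R, 1%R[%classic))%E.
Proof.
elim: d A => [|n IHn] A mA.
  rewrite big_ord0 /= diracE mem_set //; by case.
rewrite big_ord_recl /= /distribution /pushforward.
have -> : @tcons R n @^-1` [set x | forall i, A i (tnth x i)] =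
    A ord0 `*` [set x : n.-tuple R | forall i, A (lift ord0 i) (tnth x i)].
  apply/seteqP; split => -[a x] /=.
    move=> H; split; first exact: (H ord0).
    by move=> i; have := H (lift ord0 i); rewrite tnthS.
  move=> [H0 H] i; case: (unliftP ord0 i) => [j ->|->] //.
  by rewrite tnthS.
rewrite product_measure1E //.
  by congr (_ * _)%E; apply: (IHn (fun i => A (lift ord0 i))).
have -> : [set x : n.-tuple R | forall i, A (lift ord0 i) (tnth x i)] =
   \bigcap_i ((fun x : n.-tuple R => tnth x i) @^-1` A (lift ord0 i)).
  by apply/seteqP; split => x /= H i; [move=> _|]; exact: H.
apply: fin_bigcap_measurable; first exact: finite_finset.
move=> i _; rewrite -[X in measurable X]setTI.
exact: measurable_tnth.
Qed.

Local Open Scope complex_scope.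

Definition frequency (d : nat) := d.-tuple int.

Definition max_norm (d : nat) (k : frequency d) : nat :=
  (\max_(j < d) `|tnth k j|)%N.

Definition euclidean_norm (R : realType) (d : nat) (k : frequency d) : R :=
  Num.sqrt (\sum_(j < d) (tnth k j)%:~R ^+ 2).

Definition fourier_mode (R : realType) (d : nat) (k : frequency d)
    (x : d.-tuple R) : R[i] :=
  let t := 2 * pi * \sum_(j < d) (tnth k j)%:~R * tnth x j in
  cos t +i* sin t.

Definition complex_integrable (R : realType) (d : nat)
    (f : d.-tuple R -> R[i]) : Prop :=
  (torus_measure R d).-integrable setT (fun x => (complex.Re (f x))%:E) /\
  (torus_measure R d).-integrable setT (fun x => (complex.Im (f x))%:E).

Definition complex_integral (R : realType) (d : nat)
    (f : d.-tuple R -> R[i]) : R[i] :=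
  (\int[torus_measure R d]_x complex.Re (f x)) +i*
  (\int[torus_measure R d]_x complex.Im (f x)).

Definition fourier_coefficient (R : realType) (d : nat)
    (f : d.-tuple R -> R[i]) (k : frequency d) : R[i] :=
  complex_integral (fun x => f x * (fourier_mode k x)^*).

Definition Lp_norm (R : realType) (d : nat) (p : \bar R)
    (f : d.-tuple R -> R[i]) : \bar R :=
  ('N[torus_measure R d]_p[EFin \o (fun x => Normc.normc (f x))])%E.

Definition in_Linfty (R : realType) (d : nat) (f : d.-tuple R -> R[i]) : Prop :=
  [/\ measurable_fun setT (fun x => complex.Re (f x)),
      measurable_fun setT (fun x => complex.Im (f x)) &
      (Lp_norm +oo%E f < +oo)%E].

(* Symbol of (Id - beta Delta)^{-1}. *)
Definition resolvent_symbol (R : realType) (d : nat) (beta : R)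
    (k : frequency d) : R :=
  (1 + beta * (2 * pi * euclidean_norm R k) ^+ 2)^-1.

Definition high_symbol (R : realType) (d : nat) (beta : R) (N : nat)
    (k : frequency d) : R :=
  if (N < max_norm k)%N then resolvent_symbol beta k else 0.

(* The series with coefficients high_symbol need not converge absolutely, so
   the kernel of T_{>N,beta} is specified, up to a null set, as the L^1
   function with these Fourier coefficients. *)
Definition is_high_kernel (R : realType) (d : nat) (beta : R) (N : nat)
    (K : d.-tuple R -> R[i]) : Prop :=
  complex_integrable K /\
  forall k : frequency d, fourier_coefficient K k = (high_symbol beta N k)%:C.

Definition low_frequencies (d N : nat) : set (frequency d) :=
  [set k | (max_norm k <= N)%N].

Arguments low_frequencies d N : clear implicits.

(* Finitely many frequencies, so the kernel of T_{N,beta} is a trigonometric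
   polynomial, defined everywhere.  In R[i], [0 < z] means that z is real and
   strictly positive. *)
Definition low_kernel (R : realType) (d : nat) (beta : R) (N : nat)
    (x : d.-tuple R) : R[i] :=
  \sum_(k \in low_frequencies d N)
    (resolvent_symbol beta k)%:C * fourier_mode k x.

Definition low_operator (R : realType) (d : nat) (beta : R) (N : nat)
    (f : d.-tuple R -> R[i]) (x : d.-tuple R) : R[i] :=
  \sum_(k \in low_frequencies d N)
    (resolvent_symbol beta k)%:C * fourier_coefficient f k * fourier_mode k x.

Lemma finite_low_frequencies (d N : nat) : finite_set (low_frequencies d N).
Proof.
pose g (s : {ffun 'I_d -> 'I_(2 * N).+1}) : frequency d :=
  [tuple (s i)%:Z - N%:Z | i < d].
apply: (@sub_finite_set _ _ (g @` setT)); last exact/finite_image/finite_finset.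
move=> k /= /bigmax_leqP kN.
exists [ffun i => inord (absz (tnth k i + N%:Z))] => //.
apply: eq_from_tnth => i; rewrite tnth_mktuple ffunE.
have := kN i isT; move: (tnth k i) => z zN.
rewrite inordK; lia.
Qed.

(* Main.v *)
Require Import Defs.
From HB Require Import structures.
From mathcomp Require Import all_boot all_order all_algebra.
From mathcomp Require Import complex.
From mathcomp Require Import all_classical all_reals all_analysis.
From mathcomp Require Import measurable_realfun ess_sup_inf zify ring lra.
Set Implicit Arguments.
Unset Strict Implicit.
Unset Printing Implicit Defensive.
Import Order.TTheory GRing.Theory Num.Theory.
Import numFieldNormedType.Exports.
Local Open Scope classical_set_scope.
Local Open Scope ring_scope.
Local Open Scope complex_scope.

(** Operator norms on L^oo are replaced by multiplier norms on trigonometric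
polynomials: [mult a C] says that the Fourier multiplier [a] increases the sup
norm by a factor at most [C].  By duality the best such [C] is the L^1 norm of
the kernel.

Upper bound: the resolvent has multiplier norm 1 by the discrete maximum
principle, the cut-off to one coordinate has norm O(log N) by averaging Fejer
kernels, and Abel summation in one frequency gains the factor 1/(beta N^2).
Lower bound: multiplying the symbol by a multiplier of norm O(1 + beta N^2)
turns it into the sharp cut-off to the cube, whose norm is at least
c (log N)^d by testing on a product of Fejer's polynomials.

Positivity for d <= 2: applied to the Fejer kernel, the resolvent is at least
some c0 > 0 uniformly in N, and replacing the Fejer weights by the sharp
cut-off costs O(log N / N) if d = 1, and by Abel summation
O(log^2 N / (N |sin (pi x_j)|)) if d = 2.  When both |sin (pi x_j)| are
O(log^2 N / N), the frequencies below N divided by a small power of N add up to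
a multiple of log N, which dominates the remaining ones. *)

(** Sums of absolute coefficients are of no use for the L^1 bounds, since the coefficients of the
    high part need not be summable. Norms on polynomials, by contrast, can be added, multiplied and
    passed to pointwise limits, and the two building blocks, resolvents and Fejer triangles, have
    norm equal to their value at the zero frequency. The factor 1/(beta N^2) survives summation by
    parts because the difference of two resolvents with one frequency frozen is a nonnegative
    multiple of their product, so its norm is at most the difference of the two norms, which
    telescopes.

    For the lower bound, inverting the resolvent on the cube must not cost another logarithm;
    truncated quadratics, which are combinations of Fejer triangles, do it at the price of a
    constant.

    The return from multipliers to L^1 norms needs polynomials close to the sign of a merely
    integrable kernel. They come from showing that the sets with approximable indicators form a
    sigma-algebra.

    For d = 2 the error bound degenerates only near the lattice points, where the low modes are all
    close to 1 and their coefficients sum to order log N. *)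

Local Notation normc := Normc.normc.

(** * Trigonometric polynomials and Fourier multipliers *)

Section ComplexNorm.
Variable R : realType.
Implicit Types (z w : R[i]) (x t : R).

Lemma normc_ge0 z : 0 <= normc z.
Proof. by case: z => a b; exact: sqrtr_ge0. Qed.

Lemma normcC x : normc x%:C = `|x|.
Proof. by rewrite /= expr0n addr0 sqrtr_sqr. Qed.

Lemma normc_sum (I : Type) (s : seq I) (F : I -> R[i]) :
  normc (\sum_(i <- s) F i) <= \sum_(i <- s) normc (F i).
Proof.
elim: s => [|i s IH]; first by rewrite !big_nil Normc.normc0.
by rewrite !big_cons (le_trans (le_normcD _ _)) // lerD2l.
Qed.

Lemma sqr_normc_ReIm z : normc z ^+ 2 = complex.Re z ^+ 2 + complex.Im z ^+ 2.
Proof. by case: z => a b; rewrite /= sqr_sqrtr // addr_ge0 // sqr_ge0. Qed.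

Lemma normr_Re_le z : `|complex.Re z| <= normc z.
Proof.
by rewrite -ler_sqr ?nnegrE ?normc_ge0 // sqr_normc_ReIm real_normK ?num_real // lerDl sqr_ge0.
Qed.

Lemma normr_Im_le z : `|complex.Im z| <= normc z.
Proof.
by rewrite -ler_sqr ?nnegrE ?normc_ge0 // sqr_normc_ReIm real_normK ?num_real // lerDr sqr_ge0.
Qed.

Lemma normc_le_ReIm z : normc z <= `|complex.Re z| + `|complex.Im z|.
Proof.
rewrite -ler_sqr ?nnegrE ?normc_ge0 ?addr_ge0 // sqr_normc_ReIm sqrrD.
by rewrite !real_normK ?num_real // addrAC lerDl mulrn_wge0 // mulr_ge0.
Qed.

Lemma normc_conj z : normc (conjc z) = normc z.
Proof. by case: z => a b; rewrite /= sqrrN. Qed.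

Lemma ReD z w : complex.Re (z + w) = complex.Re z + complex.Re w.
Proof. by case: z; case: w. Qed.

Lemma ImD z w : complex.Im (z + w) = complex.Im z + complex.Im w.
Proof. by case: z; case: w. Qed.

Lemma Re_sum (I : Type) (s : seq I) (F : I -> R[i]) :
  complex.Re (\sum_(i <- s) F i) = \sum_(i <- s) complex.Re (F i).
Proof. by elim: s => [|i s IH]; rewrite ?big_nil // !big_cons ReD IH. Qed.

Lemma Im_sum (I : Type) (s : seq I) (F : I -> R[i]) :
  complex.Im (\sum_(i <- s) F i) = \sum_(i <- s) complex.Im (F i).
Proof. by elim: s => [|i s IH]; rewrite ?big_nil // !big_cons ImD IH. Qed.

Lemma ReZ x z : complex.Re (x%:C * z) = x * complex.Re z.
Proof. by case: z => a b /=; rewrite mul0r subr0. Qed.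

Definition expi t : R[i] := cos t +i* sin t.

Lemma expi0 : expi 0 = 1.
Proof. by rewrite /expi cos0 sin0. Qed.

Lemma expiD t x : expi (t + x) = expi t * expi x.
Proof. by rewrite /expi cosD sinD; simpc; congr (_ +i* _); rewrite addrC // [X in _ + X]mulrC addrC mulrC. Qed.

Lemma expiN t : expi (- t) = conjc (expi t).
Proof. by rewrite /expi cosN sinN. Qed.

Lemma expiDN t : expi t + expi (- t) = (2 * cos t)%:C.
Proof. by apply/eqP; rewrite eq_complex /= cosN sinN subrr mulr2n mulrDl mul1r !eqxx. Qed.

Lemma normc_expi t : normc (expi t) = 1.
Proof. by rewrite /= cos2Dsin2 sqrtr1. Qed.

Lemma expi_sum (I : Type) (s : seq I) (F : I -> R) :
  expi (\sum_(i <- s) F i) = \prod_(i <- s) expi (F i).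
Proof. exact: (big_morph expi expiD expi0). Qed.

Lemma expiMn t n : expi (t *+ n) = expi t ^+ n.
Proof. by elim: n => [|n IH]; rewrite ?expi0 // mulrS exprS expiD IH. Qed.

Lemma expi_2piz (n : int) : expi (2 * pi * n%:~R) = 1.
Proof.
have H : expi (2 * pi) = 1 :> R[i].
  by rewrite /expi mulr_natl -[pi *+ 2]add0r cosD2pi sinD2pi cos0 sin0.
case: n => n; first by rewrite -pmulrn mulr_natr expiMn H expr1n.
by rewrite NegzE mulrNz -pmulrn mulrN mulr_natr expiN expiMn H expr1n conjc1.
Qed.

End ComplexNorm.

Arguments expi : simpl never.
Arguments conjc : simpl never.
Arguments fourier_mode : simpl never.

(** * Calculus of multiplier norms *)

Section TrigPolynomials.
Variables (R : realType) (d : nat).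
Implicit Types (k h : frequency d) (x y : d.-tuple R).
Implicit Types (s : seq (R[i] * frequency d)) (a b : frequency d -> R).

Definition freq_add k h : frequency d := [tuple tnth k j + tnth h j | j < d].
Definition freq_opp k : frequency d := [tuple - tnth k j | j < d].
Definition freq0 : frequency d := [tuple 0 | j < d].
Definition point_add x y : d.-tuple R := [tuple tnth x j + tnth y j | j < d].
Definition point_opp x : d.-tuple R := [tuple - tnth x j | j < d].
Definition axis_point (j : 'I_d) (t : R) : d.-tuple R :=
  [tuple if i == j then t else 0 | i < d].

Lemma fourier_modeE k x :
  fourier_mode k x = expi (2 * pi * \sum_(j < d) (tnth k j)%:~R * tnth x j).
Proof. by []. Qed.

Lemma fourier_mode_point_add k x y :
  fourier_mode k (point_add x y) = fourier_mode k x * fourier_mode k y.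
Proof.
rewrite !fourier_modeE -expiD -mulrDr -big_split; congr (expi (_ * _)).
by apply: eq_bigr => j _; rewrite tnth_mktuple mulrDr.
Qed.

Lemma fourier_mode_freq_add k h x :
  fourier_mode (freq_add k h) x = fourier_mode k x * fourier_mode h x.
Proof.
rewrite !fourier_modeE -expiD -mulrDr -big_split; congr (expi (_ * _)).
by apply: eq_bigr => j _; rewrite tnth_mktuple intrD mulrDl.
Qed.

Lemma fourier_mode_freq_opp k x : fourier_mode (freq_opp k) x = conjc (fourier_mode k x).
Proof.
rewrite !fourier_modeE -expiN -mulrN -sumrN; congr (expi (_ * _)).
by apply: eq_bigr => j _; rewrite tnth_mktuple mulrNz mulNr.
Qed.

Lemma fourier_mode_point_opp k x : fourier_mode k (point_opp x) = conjc (fourier_mode k x).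
Proof.
rewrite !fourier_modeE -expiN -mulrN -sumrN; congr (expi (_ * _)).
by apply: eq_bigr => j _; rewrite tnth_mktuple mulrN.
Qed.

Lemma fourier_mode_axis k j t :
  fourier_mode k (axis_point j t) = expi (2 * pi * ((tnth k j)%:~R * t)).
Proof.
rewrite fourier_modeE (bigD1 j) //= tnth_mktuple eqxx big1 ?addr0 // => i ij.
by rewrite tnth_mktuple (negbTE ij) mulr0.
Qed.

Lemma fourier_mode0 k : fourier_mode k [tuple 0 | j < d] = 1 :> R[i].
Proof. by rewrite fourier_modeE big1 ?mulr0 ?expi0// => j _; rewrite tnth_mktuple mulr0. Qed.

Lemma fourier_mode_freq0 x : fourier_mode freq0 x = 1.
Proof. by rewrite fourier_modeE big1 ?mulr0 ?expi0// => j _; rewrite tnth_mktuple mul0r. Qed.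

Lemma normc_fourier_mode k x : normc (fourier_mode k x) = 1.
Proof. exact: normc_expi. Qed.

Lemma fourier_mode_conjM k x : fourier_mode k x * conjc (fourier_mode k x) = 1.
Proof. rewrite !fourier_modeE. by rewrite -expiN -expiD subrr expi0. Qed.

Lemma freq_oppK : involutive freq_opp.
Proof. by move=> k; apply: eq_from_tnth => j; rewrite !tnth_mktuple opprK. Qed.

Lemma freq_addNK k h : freq_add (freq_add k (freq_opp h)) h = k.
Proof. by apply: eq_from_tnth => j; rewrite !tnth_mktuple subrK. Qed.

(* [s] lists coefficients and frequencies, possibly with repetitions. *)
Definition trig s x : R[i] := \sum_(t <- s) t.1 * fourier_mode t.2 x.

Definition act a s : seq (R[i] * frequency d) := [seq ((a t.2)%:C * t.1, t.2) | t <- s].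

(** [B] runs over all upper bounds, so no supremum has to be formed; the points run over all of R^d,
    which lets translates be used freely. *)
Definition mult a (C : R) : Prop := forall s (B : R),
  (forall x, normc (trig s x) <= B) -> forall x, normc (trig (act a s) x) <= C * B.

Lemma trig_act a s x :
  trig (act a s) x = \sum_(t <- s) (a t.2)%:C * (t.1 * fourier_mode t.2 x).
Proof. by rewrite /trig big_map; apply: eq_bigr => t _ /=; rewrite mulrA. Qed.

Lemma trig_cat s s' x : trig (s ++ s') x = trig s x + trig s' x.
Proof. by rewrite /trig big_cat. Qed.

Lemma act_cat a s s' : act a (s ++ s') = act a s ++ act a s'.
Proof. exact: map_cat. Qed.

Lemma act_act a b s x : trig (act a (act b s)) x = trig (act (fun k => a k * b k) s) x.
Proof.
rewrite !trig_act big_map; apply: eq_bigr => t _ /=.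
by rewrite rmorphM /= !mulrA.
Qed.

Definition trig_scale (c : R[i]) s : seq (R[i] * frequency d) := [seq (c * t.1, t.2) | t <- s].

Lemma trig_scaleE c s x : trig (trig_scale c s) x = c * trig s x.
Proof. by rewrite /trig big_map mulr_sumr; apply: eq_bigr => t _ /=; rewrite mulrA. Qed.

Lemma trig_bound s x : normc (trig s x) <= \sum_(t <- s) normc t.1.
Proof.
apply: le_trans (normc_sum _ _) _; rewrite big_seq [leRHS]big_seq; apply: ler_sum => t _.
by rewrite Normc.normcM normc_fourier_mode mulr1.
Qed.

Definition trig_mul s s' : seq (R[i] * frequency d) :=
  [seq (t.1 * u.1, freq_add t.2 u.2) | t <- s, u <- s'].

Lemma trig_mulE s s' x : trig (trig_mul s s') x = trig s x * trig s' x.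
Proof.
rewrite /trig big_allpairs_dep mulr_suml; apply: eq_bigr => t _.
rewrite mulr_sumr; apply: eq_bigr => u _ /=.
by rewrite fourier_mode_freq_add mulrACA.
Qed.

Lemma act_eq_in a b s : (forall t, t \in s -> a t.2 = b t.2) -> act a s = act b s.
Proof. by move=> ab; apply/eq_in_map => t /ab ->. Qed.

(** A polynomial sees finitely many frequencies, so the comparison symbol may depend on it, for
    instance through a truncation level. *)
Lemma mult_local a C :
  (forall s, exists2 b, (forall t, t \in s -> a t.2 = b t.2) & mult b C) -> mult a C.
Proof. by move=> H s B sB x; have [b ab bC] := H s; rewrite (act_eq_in ab); exact: bC. Qed.

Lemma mult_ext a b C : a =1 b -> mult a C -> mult b C.
Proof. by move=> ab aC; apply: mult_local => s; exists a. Qed.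

Lemma bound_ge0 s (B : R) : (forall x, normc (trig s x) <= B) -> 0 <= B.
Proof. by move=> /(_ [tuple 0 | j < d]); apply: le_trans; exact: normc_ge0. Qed.

Lemma mult_le a C C' : C <= C' -> mult a C -> mult a C'.
Proof.
move=> CC' aC s B sB x; apply: le_trans (aC _ _ sB x) _.
by rewrite ler_wpM2r //; exact: bound_ge0 sB.
Qed.

Lemma mult_ge0 a C : mult a C -> 0 <= C.
Proof.
move=> aC; have := aC [::] 1; rewrite mulr1 => /(_ _ [tuple 0 | j < d]).
by rewrite /trig !big_nil Normc.normc0; apply => x; rewrite big_nil Normc.normc0.
Qed.

Lemma multM a b A B : mult a A -> mult b B -> mult (fun k => a k * b k) (A * B).
Proof. by move=> aA bB s M sM x; rewrite -act_act -mulrA; apply: aA; exact: bB. Qed.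

Lemma trig_actD a b s x :
  trig (act (fun k => a k + b k) s) x = trig (act a s) x + trig (act b s) x.
Proof.
by rewrite !trig_act -big_split; apply: eq_bigr => t _ /=; rewrite rmorphD mulrDl.
Qed.

Lemma multD a b A B : mult a A -> mult b B -> mult (fun k => a k + b k) (A + B).
Proof.
move=> aA bB s M sM x; rewrite trig_actD mulrDl (le_trans (le_normcD _ _)) //.
by apply: lerD; [exact: aA|exact: bB].
Qed.

Lemma trig_actZ c a s x : trig (act (fun k => c * a k) s) x = c%:C * trig (act a s) x.
Proof.
by rewrite !trig_act mulr_sumr; apply: eq_bigr => t _ /=; rewrite rmorphM /= !mulrA.
Qed.

Lemma multZ c a A : mult a A -> mult (fun k => c * a k) (`|c| * A).
Proof.
move=> aA s M sM x; rewrite trig_actZ Normc.normcM normcC -mulrA.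
by rewrite ler_wpM2l //; exact: aA.
Qed.

Lemma multN a A : mult a A -> mult (fun k => - a k) A.
Proof.
move=> /(multZ (-1)); rewrite normrN1 mul1r; apply: mult_ext => k.
by rewrite mulN1r.
Qed.

Lemma multB a b A B : mult a A -> mult b B -> mult (fun k => a k - b k) (A + B).
Proof. by move=> aA /multN; exact: multD. Qed.

Lemma mult1 : mult (fun=> 1) 1.
Proof.
move=> s B sB x; rewrite mul1r trig_act.
under eq_bigr do rewrite mul1r.
exact: sB.
Qed.

Lemma mult_cst c : mult (fun=> c) `|c|.
Proof.
by rewrite -[`|c|]mulr1; apply: mult_ext (multZ c mult1) => k; rewrite mulr1.
Qed.

Lemma mult_sum (I : Type) (r : seq I) (P : pred I) (a : I -> frequency d -> R) (A : I -> R) :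
  (forall i, P i -> mult (a i) (A i)) ->
  mult (fun k => \sum_(i <- r | P i) a i k) (\sum_(i <- r | P i) A i).
Proof.
move=> aA; elim: r => [|i r IH].
  rewrite big_nil; apply: (@mult_ext (fun=> 0)) => [k|]; first by rewrite big_nil.
  by have := mult_cst 0; rewrite normr0.
rewrite big_cons; case: ifPn => Pi; last by apply: mult_ext IH => k; rewrite big_cons (negbTE Pi).
by apply: mult_ext (multD (aA _ Pi) IH) => k; rewrite big_cons Pi.
Qed.

Lemma mult_prod (I : Type) (r : seq I) (P : pred I) (a : I -> frequency d -> R) (A : I -> R) :
  (forall i, P i -> mult (a i) (A i)) ->
  mult (fun k => \prod_(i <- r | P i) a i k) (\prod_(i <- r | P i) A i).
Proof.
move=> aA; elim: r => [|i r IH].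
  by rewrite big_nil; apply: mult_ext mult1 => k; rewrite big_nil.
rewrite big_cons; case: ifPn => Pi; last by apply: mult_ext IH => k; rewrite big_cons (negbTE Pi).
by apply: mult_ext (multM (aA _ Pi) IH) => k; rewrite big_cons Pi.
Qed.

Lemma mult_exp a A n : mult a A -> mult (fun k => a k ^+ n) (A ^+ n).
Proof.
move=> aA; elim: n => [|n IH]; first exact: mult1.
by rewrite exprS; apply: mult_ext (multM aA IH) => k; rewrite exprS.
Qed.

(** On a fixed polynomial the error is a finite sum over its frequencies, so pointwise convergence
    of the symbols suffices. *)
Lemma mult_lim (a_ : nat -> frequency d -> R) a C :
  (forall n, mult (a_ n) C) -> (forall k, a_ n k @[n --> \oo] --> a k) -> mult a C.
Proof.
move=> aC cva s B sB x.
have H n : normc (trig (act a s) x) <=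
    C * B + \sum_(t <- s) `|a t.2 - a_ n t.2| * normc t.1.
  have -> : trig (act a s) x =
      trig (act (a_ n) s) x + trig (act (fun k => a k - a_ n k) s) x.
    rewrite -trig_actD; congr trig; apply: act_eq_in => t _.
    by rewrite addrC subrK.
  apply: le_trans (le_normcD _ _) _; apply: lerD; first exact: aC.
  rewrite trig_act; apply: le_trans (normc_sum _ _) _.
  apply: ler_sum => t _.
  by rewrite !Normc.normcM normcC normc_fourier_mode mulr1.
have L : C * B + \sum_(t <- s) `|a t.2 - a_ n t.2| * normc t.1 @[n --> \oo] -->
    C * B + \sum_(t <- s) `|a t.2 - a t.2| * normc t.1.
  apply: cvgD; first exact: cvg_cst.
  apply: cvg_big => //; first by move=> x0; exact: add_continuous.
  move=> t _; apply: cvgM; last exact: cvg_cst.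
  by apply: cvg_norm; apply: cvgB; [exact: cvg_cst|exact: cva].
have -> : C * B = C * B + \sum_(t <- s) `|a t.2 - a t.2| * normc t.1.
  by rewrite big1 ?addr0 // => t _; rewrite subrr normr0 mul0r.
by apply: cvgr_to_ge L _; near=> n; exact: H.
Unshelve. all: by end_near. Qed.

Lemma trig_mode (c : R[i]) k x : trig [:: (c, k)] x = c * fourier_mode k x.
Proof. by rewrite /trig big_seq1. Qed.

Lemma mult_coef_le a C k : mult a C -> `|a k| <= C.
Proof.
move=> /(_ [:: (1, k)] 1); rewrite mulr1 => H.
have := H _ [tuple 0 | j < d]; rewrite /= trig_mode mulr1 Normc.normcM normc_fourier_mode.
rewrite mulr1 normcC; apply => x.
by rewrite trig_mode Normc.normcM Normc.normc1 normc_fourier_mode mulr1.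
Qed.

(** Translating the symbol conjugates the multiplier with multiplication by the mode [h], which has
    modulus one. *)
Lemma mult_shift a C h : mult a C -> mult (fun k => a (freq_add k h)) C.
Proof.
move=> aC s B sB x.
have H : trig (act (fun k => a (freq_add k h)) s) x =
    conjc (fourier_mode h x) * trig (act a [seq (t.1, freq_add t.2 h) | t <- s]) x.
  have := fourier_mode_conjM h x; move: (conjc _) => m hm.
  rewrite !trig_act big_map mulr_sumr; apply: eq_bigr => t _ /=.
  by rewrite fourier_mode_freq_add -[LHS]mulr1 -hm; ring.
rewrite H Normc.normcM normc_conj normc_fourier_mode mul1r; apply: aC => y.
have -> : trig [seq (t.1, freq_add t.2 h) | t <- s] y = trig s y * fourier_mode h y.
  by rewrite /trig big_map mulr_suml; apply: eq_bigr => t _ /=; rewrite fourier_mode_freq_add mulrA.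
by rewrite Normc.normcM normc_fourier_mode mulr1.
Qed.

(* A multiplier that is the transform of a finite measure along a coordinate axis. *)
Lemma mult_axis_measure a C j :
  (forall s, exists n (w t : 'I_n -> R), \sum_l `|w l| <= C /\
     forall u, u \in s -> (a u.2)%:C =
       \sum_l (w l)%:C * expi (2 * pi * ((tnth u.2 j)%:~R * t l)) :> R[i]) ->
  mult a C.
Proof.
move=> H s B sB x; have [n [w [t [wC aE]]]] := H s.
have -> : trig (act a s) x = \sum_l (w l)%:C * trig s (point_add x (axis_point j (t l))).
  rewrite trig_act big_seq.
  under eq_bigr => u us do rewrite aE // mulr_suml.
  rewrite -big_seq exchange_big; apply: eq_bigr => l _ /=.
  rewrite mulr_sumr; apply: eq_bigr => u _.
  rewrite fourier_mode_point_add fourier_mode_axis -!mulrA; congr (_ * _).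
  by rewrite mulrC -mulrA.
apply: le_trans (normc_sum _ _) _.
apply: (@le_trans _ _ (\sum_l `|w l| * B)).
  by apply: ler_sum => l _; rewrite Normc.normcM normcC ler_wpM2l.
by rewrite -mulr_suml ler_wpM2r //; exact: bound_ge0 sB.
Qed.

(* With [S] the supremum of the solution [u], [(A + 2 sum b) |u| <= B + 2 (sum b) S]. *)
Lemma mult_discrete_resolvent (A : R) (b : 'I_d -> R) (h : R) :
  0 < A -> (forall j, 0 <= b j) ->
  mult (fun k => (A + \sum_j b j * (2 - 2 * cos (2 * pi * ((tnth k j)%:~R * h))))^-1) A^-1.
Proof.
move=> A0 b0 s B sB.
set m := (fun k => _); set u := trig (act m s).
pose c := \sum_j 2 * b j.
have c0 : 0 <= c by apply: sumr_ge0 => j _; rewrite mulr_ge0.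
have m0 k : 0 < A + \sum_j b j * (2 - 2 * cos (2 * pi * ((tnth k j)%:~R * h))).
  rewrite ltr_pwDl // sumr_ge0 // => j _; rewrite mulr_ge0 ?b0 // subr_ge0 ler_piMr //.
have eqn x : (A + c)%:C * u x = trig s x +
    \sum_j (b j)%:C * (u (point_add x (axis_point j h)) + u (point_add x (axis_point j (- h)))).
  have -> : trig s x = trig (act (fun k => (m k)^-1) (act m s)) x.
    rewrite act_act trig_act; apply: eq_bigr => t _.
    by rewrite mulVf ?mul1r // /m invr_eq0 gt_eqF.
  rewrite trig_act /u /trig mulr_sumr.
  under [X in _ = _ + X]eq_bigr do rewrite -big_split mulr_sumr.
  rewrite exchange_big -big_split; apply: eq_bigr => t _ /=.
  under eq_bigr do rewrite !fourier_mode_point_add !fourier_mode_axis.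
  have Hj j (e : R[i]) : (b j)%:C * (t.1 * (e * expi (2 * pi * ((tnth t.2 j)%:~R * h))) +
      t.1 * (e * expi (2 * pi * ((tnth t.2 j)%:~R * - h)))) =
      t.1 * e * (b j * (2 * cos (2 * pi * ((tnth t.2 j)%:~R * h))))%:C.
    by rewrite -!mulrDr !mulrN expiDN rmorphM /=; ring.
  under [X in _ = _ + X]eq_bigr do rewrite Hj.
  rewrite -mulr_sumr -rmorph_sum [X in _ = _ + X]mulrC -mulrDl -rmorphD; congr (_%:C * _).
  rewrite /m invrK /= -addrA -big_split; congr (_ + _); apply: eq_bigr => j _ /=; ring.
pose S := sup [set normc (u x) | x in setT].
have hS : has_sup [set normc (u x) | x in setT].
  split; first by exists (normc (u [tuple 0 | j < d])), [tuple 0 | j < d].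
  by exists (\sum_(t <- act m s) normc t.1) => _ [x _ <-]; exact: trig_bound.
have uS x : normc (u x) <= S by apply: sup_upper_bound => //; exists x.
have Ac : 0 < A + c by rewrite ltr_pwDl.
have step x : (A + c) * normc (u x) <= B + c * S.
  rewrite -(ger0_norm (ltW Ac)) -normcC -Normc.normcM eqn.
  apply: le_trans (le_normcD _ _) _; apply: lerD => //.
  apply: le_trans (normc_sum _ _) _; rewrite mulr_suml; apply: ler_sum => j _.
  rewrite Normc.normcM normcC ger0_norm // [2 * _]mulrC -mulrA ler_wpM2l //.
  by apply: le_trans (le_normcD _ _) _; rewrite mulr_natl mulr2n lerD.
have SB : (A + c) * S <= B + c * S.
  rewrite mulrC -ler_pdivlMr //; apply: sup_le_ub; first by case: hS.
  by move=> _ [x _ <-]; rewrite ler_pdivlMr // mulrC.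
move=> x; rewrite mulrC ler_pdivlMr //; apply: le_trans (_ : S * A <= _).
  by rewrite ler_wpM2r // ltW.
by rewrite mulrC; move: SB; rewrite mulrDl lerD2r.
Qed.

End TrigPolynomials.

(** * Resolvent and Dirichlet multipliers *)

Section Resolvent.
Variables (R : realType) (d : nat).

Lemma cvg_mul_sin (c : R) : n.+1%:R * sin (c / n.+1%:R) @[n --> \oo] --> c.
Proof.
have [->|c0] := eqVneq c 0.
  by under eq_fun do rewrite mul0r sin0 mulr0; exact: cvg_cst.
have H : (fun h : R => h^-1 * sin h) @ 0^' --> (1 : R).
  have D : 'D_1 (@sin R) 0 = 1 by rewrite derive_val cos0.
  have := @derivable_sin R 0; rewrite /derivable => C.
  rewrite -[X in _ --> X]D; apply: cvg_trans C; apply: near_eq_cvg.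
  by apply: nearW => h /=; rewrite sin0 subr0 addr0 [h *: 1]mulr1.
have /cvgr_dnbhsP/(_ (fun n : nat => c * harmonic n)) := H.
have Hu : (forall n, c * harmonic n != 0) /\ c * harmonic n @[n --> \oo] --> 0.
  split; first by move=> n; rewrite mulf_neq0 // invr_eq0.
  by rewrite -[X in _ --> X](mulr0 c); apply: cvgM; [exact: cvg_cst|exact: cvg_harmonic].
move=> /(_ Hu) L.
rewrite -[X in _ --> X]mulr1.
have -> : (fun n => n.+1%:R * sin (c / n.+1%:R)) =
    (fun n => c * ((c * harmonic n)^-1 * sin (c * harmonic n))).
  apply/funext => n; rewrite /harmonic /= invfM invrK !mulrA; congr (_ * _).
  by rewrite divff // mul1r.
by apply: cvgM => //; exact: cvg_cst.
Qed.

(** By [2 - 2 cos (2 y) = (2 sin y)^2] this reduces to [cvg_mul_sin]: the symbol of the second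
    difference with step [1 / n.+1] tends to that of the second derivative. *)
Lemma cvg_cos_second_difference (c : R) :
  n.+1%:R ^+ 2 * (2 - 2 * cos (c / n.+1%:R)) @[n --> \oo] --> c ^+ 2.
Proof.
have -> : (fun n => n.+1%:R ^+ 2 * (2 - 2 * cos (c / n.+1%:R))) =
    (fun n => (2 * (n.+1%:R * sin (c / 2 / n.+1%:R))) ^+ 2).
  apply/funext => n.
  have -> : c / n.+1%:R = (c / 2 / n.+1%:R) *+ 2 by rewrite -mulr_natr; field.
  by rewrite cos_mulr2n cos2sin2; ring.
have -> : c ^+ 2 = (2 * (c / 2)) ^+ 2 by field.
rewrite !expr2; apply: cvgM; apply: cvgM; try exact: cvg_cst; exact: cvg_mul_sin.
Qed.

(** Limit of discrete resolvents with step [1 / n.+1] and weights [b j * n.+1 ^ 2]. Separate weights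
    [b j] allow one coordinate to be frozen: its term moves into [A] and its weight is set to 0. *)
Lemma mult_resolvent (A : R) (b : 'I_d -> R) : 0 < A -> (forall j, 0 <= b j) ->
  mult (fun k => (A + \sum_j b j * (2 * pi * (tnth k j)%:~R) ^+ 2)^-1) A^-1.
Proof.
move=> A0 b0.
apply: (@mult_lim _ _ (fun n k => (A + \sum_j (b j * n.+1%:R ^+ 2) *
   (2 - 2 * cos (2 * pi * ((tnth k j)%:~R * (n.+1%:R^-1)))))^-1)).
  by move=> n; apply: mult_discrete_resolvent => // j; rewrite mulr_ge0 ?sqr_ge0.
move=> k; apply: cvgV.
  by rewrite gt_eqF // ltr_pwDl // sumr_ge0 // => j _; rewrite mulr_ge0 ?sqr_ge0.
apply: cvgD; first exact: cvg_cst.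
apply: cvg_big => [|j _]; first exact: add_continuous.
under eq_fun do rewrite -mulrA.
apply: cvgM; [exact: cvg_cst|].
under eq_fun do rewrite mulrA.
exact: cvg_cos_second_difference.
Qed.

Lemma normc_sqrE (z : R[i]) : (normc z ^+ 2)%:C = z * conjc z.
Proof.
rewrite sqr_normc_ReIm; case: z => a b /=; apply/eqP; rewrite eq_complex /=.
by rewrite -!expr2 mulrN opprK mulrN [b * a]mulrC addNr !eqxx.
Qed.

Lemma conjc_sum (I : Type) (r : seq I) (F : I -> R[i]) :
  conjc (\sum_(i <- r) F i) = \sum_(i <- r) conjc (F i).
Proof. exact: rmorph_sum. Qed.

(** Orthogonality of the [L]-th roots of unity; [|n| < L] excludes the nonzero multiples of [L]. *)
Lemma sum_expi_grid (n : int) (L : nat) : (`|n| < L)%N ->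
  \sum_(l < L) expi (2 * pi * (n%:~R * (l%:R / L%:R))) = (if n == 0 then L%:R else 0) :> R[i].
Proof.
move=> nL; have L0 : L%:R != 0 :> R by rewrite pnatr_eq0; lia.
case: eqVneq => [->|n0].
  under eq_bigr do rewrite mul0r mulr0 expi0.
  by rewrite sumr_const card_ord.
pose z : R[i] := expi (2 * pi * (n%:~R / L%:R)).
under eq_bigr => l _.
  rewrite (_ : _ * _ = (2 * pi * (n%:~R / L%:R)) *+ l); last by rewrite -mulr_natr; ring.
  rewrite expiMn -/z.
  over.
have zL : z ^+ L = 1.
  rewrite /z -expiMn -[RHS](expi_2piz _ n); congr expi; rewrite -mulr_natr.
  by field.
have z1 : z != 1.
  apply/negP => /eqP z1.
  have pi0 := pi_gt0 R.
  have L1 : 0 < L%:R :> R by rewrite ltr0n; lia.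
  (* Half the angle: it lies strictly between 0 and pi, where the sine does not vanish. *)
  pose t : R := pi * (`|n|%:R / L%:R).
  have tpi : 0 < t < pi.
    rewrite /t mulr_gt0 ?divr_gt0 // ?ltr0n ?absz_gt0 //=.
    by rewrite gtr_pMr // ltr_pdivrMr // mul1r ltr_nat.
  have : cos (2 * pi * (n%:~R / L%:R)) = 1 :> R by have := congr1 (@complex.Re R) z1.
  have -> : cos (2 * pi * (n%:~R / L%:R)) = cos (t *+ 2) :> R.
    rewrite -[LHS]cos_norm; congr cos; rewrite !normrM !normfV.
    by rewrite /t natr_absz intr_norm (ger0_norm (ltW pi0)) !normr_nat mulr2n; ring.
  rewrite cos_mulr2n cos2sin2 => h.
  have : sin t ^+ 2 = 0 by move: h; rewrite mulr2n; lra.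
  move/eqP; rewrite sqrf_eq0 => /eqP s0.
  by have := sin_gt0_pi tpi; rewrite s0 ltxx.
apply/eqP; rewrite -(inj_eq (mulfI (_ : z - 1 != 0))); last by rewrite subr_eq0.
by rewrite mulr0 -subrX1 zL subrr.
Qed.

(** The autocorrelation of an interval of [M] points is the triangle [(M - |k|)_+]; this is the
    source of the Fejer weights. *)
Lemma sum_diff_eq (M : nat) (k : int) :
  \sum_(a < M) \sum_(b < M) ((a%:Z - b%:Z + k == 0) : nat) = (M - `|k|)%N.
Proof.
wlog k0 : k / 0 <= k.
  move=> H; case: (leP 0 k) => [|k0]; first exact: H.
  rewrite -abszN -H; last lia.
  rewrite exchange_big; apply: eq_bigr => a _; apply: eq_bigr => b _; lia.
have -> : (M - `|k|)%N = \sum_(a < M | (a < M - `|k|)%N) 1%N.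
  by rewrite -(big_ord_widen _ (fun=> 1%N)) ?leq_subr // sum1_card card_ord.
rewrite [RHS]big_mkcond; apply: eq_bigr => a _.
case: ifPn => aM.
  have bP : (a + `|k| < M)%N by lia.
  rewrite (bigD1 (Ordinal bP)) //= big1 ?addn0; first lia.
  move=> b; rewrite -val_eqE /=; lia.
rewrite big1 // => b _; have := ltn_ord b; lia.
Qed.

(** The triangle is the transform of the squared modulus of a geometric sum, a nonnegative weight,
    so the total mass is its value [M] at 0. Sampling on [L] grid points is exact once [L] exceeds
    all the frequencies involved. *)
Lemma mult_tri (j : 'I_d) (M : nat) :
  mult (fun k : frequency d => (M - `|tnth k j|)%N%:R : R) M%:R.
Proof.
apply: (@mult_axis_measure _ _ _ _ j) => s.
pose L := (\sum_(u <- s) `|tnth u.2 j| + M).+1.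
pose z (l : nat) : R[i] := \sum_(a < M) expi (2 * pi * (a%:R * (l%:R / L%:R))).
have key (k : int) : (`|k| + M < L.+1)%N -> ((M - `|k|)%N%:R : R)%:C =
    \sum_(l < L) (normc (z l) ^+ 2 / L%:R)%:C * expi (2 * pi * (k%:~R * (l%:R / L%:R))).
  move=> kL.
  have L0 : (L%:R : R)%:C != 0 by rewrite -[0]/(0%:C) (inj_eq (@complexI _)) pnatr_eq0.
  apply: (mulIf L0); rewrite mulr_suml.
  transitivity (\sum_(a < M) \sum_(b < M) \sum_(l < L)
     (expi (2 * pi * ((a%:Z - b%:Z + k)%:~R * (l%:R / L%:R))) : R[i])); last first.
    under eq_bigr do rewrite exchange_big /=.
    rewrite exchange_big; apply: eq_bigr => l _ /=.
    rewrite mulrAC -rmorphM /= divfK ?pnatr_eq0 // normc_sqrE.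
    rewrite /z conjc_sum big_distrlr /= mulr_suml.
    apply: eq_bigr => a _; rewrite mulr_suml; apply: eq_bigr => b _.
    rewrite -expiN -!expiD; congr expi; rewrite !rmorphD rmorphN /=; ring.
  under eq_bigr => a _.
    under eq_bigr => b _.
      rewrite sum_expi_grid; last by (have := ltn_ord a; have := ltn_ord b; lia).
      over.
    over.
  rewrite -rmorphM -sum_diff_eq -natrM rmorph_nat big_distrl natr_sum; apply: eq_bigr => a _ /=.
  rewrite big_distrl natr_sum; apply: eq_bigr => b _ /=.
  by case: eqP; rewrite ?mul1n ?mul0n.
exists L, (fun l => normc (z l) ^+ 2 / L%:R), (fun l => l%:R / L%:R); split.
  rewrite le_eqVlt; apply/orP; left; apply/eqP.
  under eq_bigr do rewrite ger0_norm ?divr_ge0 ?sqr_ge0 //.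
  apply: (@complexI R); rewrite rmorph_sum /=.
  have := key 0; rewrite subn0 => -> /=; last by rewrite /L; lia.
  by apply: eq_bigr => l _; rewrite mul0r mulr0 expi0 mulr1.
move=> u us; apply: key.
by rewrite /L (big_rem u) //= -addnA !ltnS leqW // leq_add2l leq_addl.
Qed.

(* The trapezoid [(T (N + M) - T N) / M], with [T M n = (M - |n|)_+], is the
   indicator of [|n| <= N] for [M = 1]; doubling [M] costs two Fejer kernels
   centred at [N + M] and [- N - M]. *)
Lemma mult_trapezoid (j : 'I_d) (N i : nat) (C : R) :
  mult (fun k : frequency d =>
    ((N + 2 ^ i.+1 - `|tnth k j|)%N%:R - (N - `|tnth k j|)%N%:R) / (2 ^ i.+1)%:R : R) C ->
  mult (fun k : frequency d =>
    ((N + 2 ^ i - `|tnth k j|)%N%:R - (N - `|tnth k j|)%N%:R) / (2 ^ i)%:R : R) (C + 1).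
Proof.
move=> H; pose h : frequency d := [tuple (N + 2 ^ i)%:Z | _ < d].
have M0 : (2 ^ i)%:R != 0 :> R by rewrite pnatr_eq0 expn_eq0.
have := multB H (multZ (2 ^ i.+1)%:R^-1
  (multD (mult_shift (freq_opp h) (mult_tri j (2 ^ i))) (mult_shift h (mult_tri j (2 ^ i))))).
have -> : `|(2 ^ i.+1)%:R^-1| * ((2 ^ i)%:R + (2 ^ i)%:R) = 1 :> R.
  by rewrite ger0_norm ?invr_ge0 ?ler0n // expnS natrM; field.
apply: mult_ext => k; rewrite !tnth_mktuple; set n := tnth k j.
have E : (2 * ((N + 2 ^ i - `|n|) - (N - `|n|)) + (2 ^ i - `|(n - (N + 2 ^ i)%:Z)%R|) +
  (2 ^ i - `|(n + (N + 2 ^ i)%:Z)%R|) = (N + 2 ^ i.+1 - `|n|) - (N - `|n|))%N.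
  by rewrite expnS; lia.
move: (congr1 (GRing.natmul (1 : R)) E); rewrite 2!natrD natrM.
have H1 : (N - `|n| <= N + 2 ^ i - `|n|)%N by lia.
have H2 : (N - `|n| <= N + 2 ^ i.+1 - `|n|)%N by lia.
rewrite (natrB _ H1) (natrB _ H2).
rewrite -/n => E'; rewrite -E' expnS natrM.
by field.
Qed.

(** At the scale [2 ^ i >= N] the trapezoid has norm at most [(2 N + 2 ^ i) / 2 ^ i <= 3]. Each of
    the [i] halvings down to scale 1 adds 1. *)
Lemma mult_dirichlet_up_log (j : 'I_d) (N i : nat) : (N <= 2 ^ i)%N ->
  mult (fun k : frequency d => (`|tnth k j| <= N)%N%:R : R) (3 + i%:R).
Proof.
move=> Ni.
have H m : (m <= i)%N -> mult (fun k : frequency d =>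
    ((N + 2 ^ (i - m) - `|tnth k j|)%N%:R - (N - `|tnth k j|)%N%:R) / (2 ^ (i - m))%:R : R)
    (3 + m%:R).
  elim: m => [|m IH] mi.
    rewrite subn0 addr0.
    have M0 : 0 < (2 ^ i)%:R :> R by rewrite ltr0n expn_gt0.
    have := multZ (2 ^ i)%:R^-1 (multB (mult_tri j (N + 2 ^ i)) (mult_tri j N)).
    move/(@mult_ext _ _ _ (fun k : frequency d =>
      ((N + 2 ^ i - `|tnth k j|)%N%:R - (N - `|tnth k j|)%N%:R) / (2 ^ i)%:R : R)) => H.
    apply: mult_le (H _); last by move=> k; rewrite mulrC.
    rewrite ger0_norm; last by rewrite invr_ge0 ltW.
    rewrite mulrC ler_pdivrMr // natrD.
    have : N%:R <= (2 ^ i)%:R :> R by rewrite ler_nat.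
    by lra.
  rewrite (_ : 3 + m.+1%:R = 3 + m%:R + 1 :> R); last by rewrite -(natr1 m) addrA.
  apply: mult_trapezoid.
  rewrite (_ : (i - m.+1).+1 = (i - m)%N); last by lia.
  by apply: IH; exact: ltnW.
have := H i (leqnn _); rewrite subnn expn0; apply: mult_ext => k.
rewrite mulr1n divr1 -natrB; last lia.
by congr (_%:R); case: leqP => kN /=; lia.
Qed.

Lemma mult_dirichlet (j : 'I_d) (N : nat) :
  mult (fun k : frequency d => (`|tnth k j| <= N)%N%:R : R) (5 / ln 2 * ln (N%:R + 2)).
Proof.
have ln2 : 0 < ln 2 :> R by rewrite ln_gt0 // ltr1n.
have [->|N0] := eqVneq N 0%N.
  have := @mult_dirichlet_up_log j 0 0 isT; apply: mult_le.
  rewrite add0r -mulrA mulVf ?gt_eqF //; lra.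
(* The norm is [4 + trunc_log 2 N], and both 1 and [trunc_log 2 N] are at most
   [ln (N + 2) / ln 2]. *)
apply: mult_le (@mult_dirichlet_up_log j N (trunc_log 2 N).+1 _); last first.
  by rewrite ltnW // trunc_log_ltn.
have H1 : (trunc_log 2 N)%:R * ln 2 <= ln (N%:R + 2) :> R.
  rewrite mulrC mulr_natr -lnXn // ler_ln ?posrE ?exprn_gt0 //.
  rewrite -natrX; apply: (@le_trans _ _ N%:R); last by rewrite lerDl.
  by rewrite ler_nat trunc_logP // lt0n.
have H2 : ln 2 <= ln (N%:R + 2) :> R by rewrite ler_ln ?posrE ?ltr_wpDl // lerDr.
rewrite mulrAC ler_pdivlMr // -(natr1 (trunc_log 2 N)); nra.
Qed.

End Resolvent.

(** * Lower bound for the cut-off to a cube *)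

Section SineSums.
Variable R : realType.

Lemma sum_by_parts (a b : nat -> R) n :
  \sum_(k < n) a k * b k =
  a n * (\sum_(k < n) b k) + \sum_(k < n) (a k - a k.+1) * (\sum_(i < k.+1) b i).
Proof.
elim: n => [|n IH]; first by rewrite !big_ord0 mulr0 addr0.
by rewrite !big_ord_recr /= IH; ring.
Qed.

Lemma sum_by_parts_le (a b : nat -> R) (S : R) n :
  (forall k, `|\sum_(i < k) b i| <= S) ->
  `|\sum_(k < n) a k * b k| <= (`|a n| + \sum_(k < n) `|a k - a k.+1|) * S.
Proof.
move=> HS; rewrite sum_by_parts mulrDl mulr_suml.
apply: le_trans (ler_normD _ _) _; rewrite lerD //.
  by rewrite normrM ler_wpM2l.
apply: le_trans (ler_norm_sum _ _ _) _; apply: ler_sum => k _.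
by rewrite normrM ler_wpM2l.
Qed.

Lemma sum_ord_telescope (f : nat -> R) n : \sum_(k < n) (f k - f k.+1) = f 0%N - f n.
Proof.
elim: n => [|n IH]; first by rewrite big_ord0 subrr.
by rewrite big_ord_recr /= IH addrA subrK.
Qed.

Lemma norm_sin_mulrn_le (x : R) n : `|sin (x *+ n)| <= n%:R * `|sin x|.
Proof.
elim: n => [|n IH]; first by rewrite mulr0n sin0 normr0 mul0r.
rewrite mulrS sinD -natr1 mulrDl mul1r addrC [X in X + _]mulrC.
apply: le_trans (ler_normD _ _) _; rewrite !normrM; apply: lerD.
  by apply: le_trans IH; rewrite ler_piMr //; exact: cos_max.
by rewrite ler_piMr //; exact: cos_max.
Qed.

Lemma sin_telescope (x : R) m n :
  2 * sin x * \sum_(k < n) sin (x *+ (2 * (m + k.+1))) =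
  cos (x *+ (2 * m).+1) - cos (x *+ (2 * (m + n)).+1).
Proof.
elim: n => [|n IH]; first by rewrite big_ord0 mulr0 addn0 subrr.
rewrite big_ord_recr /= mulrDr IH.
have -> : cos (x *+ (2 * (m + n)).+1) = cos (x *+ (2 * (m + n.+1)) - x).
  congr cos; have -> : (2 * (m + n.+1) = (2 * (m + n)).+2)%N by lia.
  by rewrite [in RHS]mulrSr addrK.
have -> : cos (x *+ (2 * (m + n.+1)).+1) = cos (x *+ (2 * (m + n.+1)) + x).
  by rewrite mulrSr.
by rewrite cosB cosD; ring.
Qed.

(** With [x = t / 2], cut at [m], the integer part of [1 / |sin x|]. The first [m] terms are each at
    most [2 |sin x|], hence add up to at most 2; the rest is at most 1 by summation by parts, since
    the partial sums of [sin (2 k x)] are at most [1 / |sin x|]. Measuring with [|sin x|] instead of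
    [|x|] avoids reducing [x] modulo the period. *)
Lemma sum_sin_div_le (t : R) n :
  `|\sum_(k < n) sin (t * k.+1%:R) / k.+1%:R| <= 3.
Proof.
pose x := t / 2.
have tE k : t * k%:R = x *+ (2 * k) by rewrite -[RHS]mulr_natr natrM /x; field.
have [s0|s0] := eqVneq (sin x) 0.
  rewrite big1 ?normr0 // => k _; apply/eqP; rewrite mulf_eq0; apply/orP; left.
  by rewrite -normr_le0 tE (le_trans (norm_sin_mulrn_le _ _)) // s0 normr0 mulr0.
have sp : 0 < `|sin x| by rewrite normr_gt0.
pose m := Num.truncn `|sin x|^-1.
have m1 : m%:R <= `|sin x|^-1 by rewrite truncn_le // invr_ge0.
have m2 : `|sin x|^-1 < m.+1%:R by rewrite truncnS_gt.
have head p : (p <= m)%N -> `|\sum_(k < p) sin (t * k.+1%:R) / k.+1%:R| <= 2.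
  move=> pm; apply: le_trans (ler_norm_sum _ _ _) _.
  apply: (@le_trans _ _ (\sum_(k < p) 2 * `|sin x|)).
    apply: ler_sum => k _; rewrite normrM tE normfV normr_nat ler_pdivrMr //.
    by apply: le_trans (norm_sin_mulrn_le _ _) _; rewrite natrM mulrAC.
  rewrite sumr_const card_ord -[_ *+ p]mulr_natr.
  rewrite -mulrA ler_piMr // mulrC -ler_pdivlMr // mul1r (le_trans _ m1) // ler_nat //.
have [nm|mn] := leqP n m; first by apply: le_trans (head _ nm) _; lra.
rewrite -(subnKC (ltnW mn)) big_split_ord /=.
apply: le_trans (ler_normD _ _) _; rewrite [leRHS](_ : 3 = 2 + 1); last by ring.
apply: lerD; first exact: head.
under eq_bigr do rewrite mulrC tE -addnS.
apply: le_trans (@sum_by_parts_le (fun k => (m + k.+1)%:R^-1)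
  (fun k => sin (x *+ (2 * (m + k.+1)))) `|sin x|^-1 _ _) _ => [k|].
  rewrite -(ler_pM2l (_ : 0 < 2 * `|sin x|)) ?mulr_gt0 //.
  rewrite -{1}(ger0_norm (_ : 0 <= 2 :> R)) // -!normrM sin_telescope -mulrA divff ?gt_eqF //.
  by apply: le_trans (ler_normB _ _) _; rewrite mulr1 [2]mulr2n lerD // cos_max.
have dec k : (m + k.+2)%:R^-1 <= (m + k.+1)%:R^-1 :> R.
  by rewrite !addnS lef_pV2 ?posrE // ler_nat.
under eq_bigr do rewrite ger0_norm ?subr_ge0 //.
rewrite (sum_ord_telescope (fun k => (m + k.+1)%:R^-1)) addn1 ger0_norm // addrC subrK.
by rewrite mulrC ler_pdivrMr // mul1r ltW.
Qed.

End SineSums.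

(** * Test polynomials for the sharp cut-off *)

Section BoxMultiplier.
Variables (R : realType) (d : nat).
Implicit Types (k : frequency d) (beta : R).

Definition coord_cut (N : nat) (j : 'I_d) k : R := (`|tnth k j| <= N)%N%:R.

Definition box_cut (N : nat) k : R := (max_norm k <= N)%N%:R.

Lemma box_cutE N k : box_cut N k = \prod_(j < d) coord_cut N j k.
Proof.
rewrite /box_cut /coord_cut /max_norm -natr_prod; congr _%:R.
rewrite (big_morph (fun m => (m <= N)%N) (fun m n => geq_max N m n) (leq0n N)).
by rewrite (big_morph nat_of_bool (fun b c => esym (mulnb b c)) (erefl _)).
Qed.

Definition harm (n : nat) : R := \sum_(k < n) k.+1%:R^-1.

(* Fejer's polynomial [E(N t) \sum_(1 <= l <= N) (E(l t) - E(- l t)) / l] is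
   bounded, while truncation at [N] only keeps the terms [- E((N - l) t) / l]. *)
Definition fejer_coef (N : nat) (u : bool * 'I_N) : R :=
  (if u.1 then 1 else -1) / (u.2).+1%:R.

Definition fejer_freq (N : nat) (u : bool * 'I_N) : int :=
  N%:Z + (if u.1 then (u.2).+1%:Z else - (u.2).+1%:Z).

(** The two signs combine to [2 i sin], so the modulus is at most twice the bound 3 on the sine
    sum. *)
Lemma fejer_poly_bound N (t : R) :
  normc (\sum_(u : bool * 'I_N) (fejer_coef u)%:C * expi (2 * pi * ((fejer_freq u)%:~R * t))) <= 6.
Proof.
rewrite -(pair_bigA _ (fun b l => (fejer_coef (b, l))%:C * expi (2 * pi * ((fejer_freq (b, l))%:~R * t)))) /=.
rewrite big_bool /= -big_split /=.
have E l : (@fejer_coef N (true, l))%:C * expi (2 * pi * ((fejer_freq (true, l))%:~R * t)) +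
    (fejer_coef (false, l))%:C * expi (2 * pi * ((fejer_freq (false, l))%:~R * t)) =
    expi (2 * pi * (N%:R * t)) * (0 +i* 2) * (sin (2 * pi * t * l.+1%:R) / l.+1%:R)%:C :> R[i].
  rewrite /fejer_coef /fejer_freq /=.
  have F (z : int) : expi (2 * pi * ((N%:Z + z)%:~R * t)) =
      expi (2 * pi * (N%:R * t)) * expi (2 * pi * t * z%:~R) :> R[i].
    by rewrite -expiD; congr expi; rewrite intrD; ring.
  rewrite !F mulrNz mulrN -pmulrn.
  move: (expi (2 * pi * (N%:R * t))) (2 * pi * t * l.+1%:R) => [a b] x.
  apply/eqP; rewrite eq_complex /expi /= cosN sinN; apply/andP; split; apply/eqP; ring.
rewrite (eq_bigr _ (fun l _ => E l)) -mulr_sumr !Normc.normcM normc_expi mul1r.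
have -> : normc (0 +i* 2 : R[i]) = 2 by rewrite /= expr0n add0r sqrtr_sqr ger0_norm.
rewrite -rmorph_sum normcC.
have := sum_sin_div_le (2 * pi * t) N; lra.
Qed.

(** Both the test polynomial and its truncation factor over the coordinates. At the origin every
    factor of the truncation equals [- harm N], while the polynomial itself is at most [6 ^ d]
    everywhere. *)
Lemma box_cut_lower_bound N (D : R) : mult (box_cut N) D -> harm N ^+ d <= D * 6 ^+ d.
Proof.
move=> H.
pose s : seq (R[i] * frequency d) :=
  [seq ((\prod_j fejer_coef (g j))%:C, [tuple fejer_freq (g j) | j < d]) |
     g : {ffun 'I_d -> bool * 'I_N}].
have sE x : trig s x = \prod_(j < d) \sum_(u : bool * 'I_N)
    (fejer_coef u)%:C * expi (2 * pi * ((fejer_freq u)%:~R * tnth x j)).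
  rewrite bigA_distr_bigA /trig big_map big_enum /=; apply: eq_bigr => g _.
  rewrite fourier_modeE mulr_sumr expi_sum rmorph_prod -big_split; apply: eq_bigr => j _ /=.
  by rewrite tnth_mktuple.
have sB x : normc (trig s x) <= 6 ^+ d.
  rewrite sE -[X in _ <= _ ^+ X]card_ord -prodr_const.
  rewrite (big_morph _ (@Normc.normcM R) (Normc.normc1 R)).
  by apply: ler_prod => j _; rewrite normc_ge0 fejer_poly_bound.
have := H _ _ sB [tuple 0 | j < d]; apply: le_trans.
suff -> : trig (act (box_cut N) s) [tuple 0 | j < d] = ((- harm N) ^+ d)%:C.
  rewrite normcC normrX normrN ger0_norm //.
  by apply: sumr_ge0 => k _; rewrite invr_ge0.
rewrite trig_act big_map big_enum /=.
transitivity ((\sum_(g : {ffun 'I_d -> bool * 'I_N}) \prod_(j < d)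
   ((`|fejer_freq (g j)| <= N)%N%:R * fejer_coef (g j)) : R)%:C).
  rewrite rmorph_sum; apply: eq_bigr => g _; rewrite fourier_mode0 mulr1 -rmorphM box_cutE.
  congr _%:C; rewrite -big_split; apply: eq_bigr => j _ /=.
  by rewrite /coord_cut tnth_mktuple.
congr _%:C.
rewrite -(bigA_distr_bigA (fun _ u => (`|fejer_freq u| <= N)%N%:R * fejer_coef u)) prodr_const card_ord; congr (_ ^+ _).
rewrite -(pair_bigA _ (fun b l => (`|@fejer_freq N (b, l)| <= N)%N%:R * fejer_coef (b, l))) /=.
rewrite big_bool /= big1 ?add0r => [|l _].
  rewrite -sumrN; apply: eq_bigr => l _.
  rewrite /fejer_coef /fejer_freq /= mulN1r; case: leqP; rewrite ?mul1r //.
  by have := ltn_ord l; lia.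
rewrite /fejer_freq /=; case: leqP; rewrite ?mul0r //; lia.
Qed.

End BoxMultiplier.

(** * High-frequency multipliers *)

Section MultiplierBounds.
Variables (R : realType) (d : nat).
Implicit Types (k : frequency d) (beta : R).

Definition laplace_symbol k : R := \sum_(j < d) (2 * pi * (tnth k j)%:~R) ^+ 2.

Lemma laplace_symbol_ge0 k : 0 <= laplace_symbol k.
Proof. by apply: sumr_ge0 => j _; exact: sqr_ge0. Qed.

Lemma resolvent_symbolE beta k :
  resolvent_symbol beta k = (1 + beta * laplace_symbol k)^-1.
Proof.
rewrite /resolvent_symbol /euclidean_norm exprMn sqr_sqrtr; last first.
  by apply: sumr_ge0 => j _; exact: sqr_ge0.
congr (_ + _ * _)^-1; rewrite mulr_sumr; apply: eq_bigr => j _.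
by rewrite -exprMn.
Qed.

Lemma mult_laplace_resolvent (A B : R) : 0 < A -> 0 <= B ->
  mult (fun k => (A + B * laplace_symbol k)^-1) A^-1.
Proof.
move=> A0 B0; apply: mult_ext (@mult_resolvent R d A (fun=> B) A0 (fun=> B0)) => k.
by rewrite mulr_sumr.
Qed.

Lemma mult_resolvent_symbol beta : 0 < beta -> mult (@resolvent_symbol R d beta) 1.
Proof.
move=> b0; rewrite -[1]invr1.
by apply: mult_ext (mult_laplace_resolvent ltr01 (ltW b0)) => k; rewrite resolvent_symbolE.
Qed.

Lemma mult_box_cut N : mult (@box_cut R d N) ((5 / ln 2 * ln (N%:R + 2)) ^+ d).
Proof.
rewrite -[X in mult _ (_ ^+ X)]card_ord -prodr_const.
apply: mult_ext (mult_prod _ (fun j _ => mult_dirichlet j N)) => k.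
by rewrite box_cutE.
Qed.

(** The truncated parabola [(N^2 - q^2)_+] is a combination of triangles,
    [(2 N - 1) T_N - 2 sum_(m < N) T_m], whose norms add up to at most [(2 N - 1) N + N^2]. It makes
    [q^2] available on [q <= N] without the logarithm of a sharp cut-off. *)
Lemma mult_square_cap (j : 'I_d) (N : nat) :
  mult (fun k : frequency d =>
    if (`|tnth k j| <= N)%N then N%:R ^+ 2 - (tnth k j)%:~R ^+ 2 else 0 : R) (3 * N%:R ^+ 2).
Proof.
pose T m k : R := (m - `|tnth k j|)%N%:R.
have H n k : (2 * n%:R - 1) * T n k - 2 * \sum_(m < n) T m k =
    if (`|tnth k j| <= n)%N then n%:R ^+ 2 - (tnth k j)%:~R ^+ 2 else 0.
  have sq : (tnth k j)%:~R ^+ 2 = `|tnth k j|%N%:R ^+ 2 :> R.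
    by rewrite natr_absz intr_norm real_normK // num_real.
  rewrite {}sq /T; move: `|tnth k j|%N => q; elim: n => [|n IH].
    rewrite big_ord0 sub0n leqn0; case: eqP => [->|_]; rewrite ?expr0n /=; ring.
  rewrite big_ord_recr /= mulrDr opprD addrA; move: IH; set S := \sum_(_ < _) _.
  case: (ltngtP q n.+1) => [qn|qn|qn].
  - have -> : (q <= n)%N by [].
    by rewrite (natrB _ (ltnW qn)) (natrB _ (qn : (q <= n)%N)) -(natr1 n); nra.
  - have -> : (q <= n)%N = false by lia.
    have -> : (n - q = 0)%N by lia. have -> : (n.+1 - q = 0)%N by lia.
    by rewrite !mulr0; lra.
  - have -> : (q <= n)%N = false by lia.
    have -> : (n - q = 0)%N by lia. have -> : (n.+1 - q = 0)%N by lia.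
    by rewrite qn !mulr0; lra.
have [->|N0] := eqVneq N 0%N.
  rewrite expr0n /= mulr0; apply: mult_ext (_ : mult (fun=> 0) 0) => [k|].
    by have := H 0%N k; rewrite /T big_ord0 sub0n !mulr0 subrr expr0n.
  by have := mult_cst (d := d) (0 : R); rewrite normr0.
have := multB (multZ (2 * N%:R - 1 : R) (mult_tri j N))
  (multZ 2 (mult_sum (index_enum 'I_N) (fun m (_ : xpredT m) => mult_tri j (nat_of_ord m)))).
move=> /(mult_ext (b := fun k => if (`|tnth k j| <= N)%N then N%:R ^+ 2 - (tnth k j)%:~R ^+ 2 else 0)).
move=> G; apply: mult_le (G _) => [|k]; last by rewrite -H.
have N1 : 1 <= N%:R :> R by rewrite ler1n lt0n.
rewrite !ger0_norm //; last by lra.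
have : 2 * \sum_(m < N) m%:R <= N%:R ^+ 2 :> R.
  elim: (N) => [|n IH]; first by rewrite big_ord0 mulr0 sqr_ge0.
  by rewrite big_ord_recr /= -natr1; lra.
nra.
Qed.

Lemma high_symbolE beta N k :
  high_symbol beta N k = (1 - box_cut R N k) * resolvent_symbol beta k.
Proof.
rewrite /high_symbol /box_cut ltnNge.
by case: (max_norm k <= N)%N => /=; rewrite ?subrr ?mul0r // subr0 mul1r.
Qed.

(* Multiplying by [V / m], where [V] equals 1 on the box and [V / m] is a
   multiplier of norm [O(1 + beta N^2)], reduces the lower bound to the sharp
   cut-off [1 - box_cut]. *)
Lemma mult_high_lower beta N (D : R) : 0 < beta -> (0 < N)%N ->
  mult (@high_symbol R d beta N) D ->
  mult (@box_cut R d N)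
    ((1 + 4 * d%:R) * (1 + (1 + 2 * beta * ((2 * pi) ^+ 2 * N%:R ^+ 2)) * D)).
Proof.
move=> b0 N0 HD; set kap := (2 * pi) ^+ 2.
have N2 : 0 < N%:R ^+ 2 :> R by rewrite exprn_gt0 // ltr0n.
have kap0 : 0 < kap by rewrite exprn_gt0 // mulr_gt0 // pi_gt0.
have kN : 0 < kap * N%:R ^+ 2 by rewrite mulr_gt0.
(* The resolvent at length scale [1 / N]: multiplied by [1 + beta * laplace_symbol] it has norm
   [O(1 + beta N^2)], by [RL] below. *)
pose Rs k : R := (1 + (kap * N%:R ^+ 2)^-1 * laplace_symbol k)^-1.
have Rs1 : mult Rs 1.
  by rewrite -[1]invr1; apply: mult_laplace_resolvent => //; rewrite invr_ge0 ltW.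
have den k : 0 < 1 + (kap * N%:R ^+ 2)^-1 * laplace_symbol k.
  by rewrite ltr_pwDl // mulr_ge0 ?invr_ge0 ?(ltW kN) // laplace_symbol_ge0.
(* On the box the [j]-th summand is [k_j^2 / N^2], which makes [W] the inverse of [Rs] there. *)
pose W k : R := 1 + \sum_(j < d) (1 - (N%:R ^+ 2)^-1 *
  (if (`|tnth k j| <= N)%N then N%:R ^+ 2 - (tnth k j)%:~R ^+ 2 else 0)).
have WB : mult W (1 + 4 * d%:R).
  have -> : 4 * d%:R = \sum_(j < d) (1 + `|(N%:R ^+ 2)^-1| * (3 * N%:R ^+ 2)) :> R.
    rewrite sumr_const card_ord ger0_norm ?invr_ge0 ?ltW // -[RHS]mulr_natr; congr (_ * _).
    by field; rewrite pnatr_eq0 -lt0n.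
  apply: (mult_ext _ (multD (@mult1 R d) (mult_sum (index_enum 'I_d) (fun j (_ : xpredT j) =>
    multB (@mult1 R d) (multZ (N%:R ^+ 2)^-1 (mult_square_cap j N)))))).
  by move=> k.
have RW k : (max_norm k <= N)%N -> Rs k * W k = 1.
  move=> /bigmax_leqP kN'; suff -> : W k = (Rs k)^-1 by rewrite mulfV // invr_eq0 gt_eqF.
  rewrite /Rs invrK /W; congr (_ + _); rewrite mulr_sumr; apply: eq_bigr => j _.
  rewrite kN' // exprMn -/kap; field.
  by rewrite (gt_eqF kap0) pnatr_eq0 -lt0n N0.
have RL k : laplace_symbol k * Rs k = kap * N%:R ^+ 2 * (1 - Rs k).
  rewrite /Rs; have := laplace_symbol_ge0 k; have := kN.
  move: (kap * _) (laplace_symbol k) => K x K0 x0; field.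
  by rewrite !gt_eqF // ltr_pwDl.
(* [W Rs - W Rs (1 - box_cut) = W Rs box_cut], which is [box_cut] since [W Rs = 1] on the box. *)
have := multB (multM WB Rs1) (multM (multM WB (multD Rs1
  (multZ (beta * (kap * N%:R ^+ 2)) (multB (@mult1 R d) Rs1)))) HD).
move/(mult_ext (b := @box_cut R d N)) => H; apply: mult_le (H _); last move=> k.
  rewrite (ger0_norm (mulr_ge0 (ltW b0) (ltW kN))).
  by rewrite le_eqVlt; apply/orP; left; apply/eqP; ring.
have m0 : 1 + beta * laplace_symbol k != 0.
  by rewrite gt_eqF // ltr_pwDl // mulr_ge0 ?laplace_symbol_ge0 // ltW.
have -> : Rs k + beta * (kap * N%:R ^+ 2) * (1 - Rs k) = Rs k * (1 + beta * laplace_symbol k).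
  by rewrite -[in LHS]mulrA -RL; ring.
rewrite high_symbolE resolvent_symbolE.
transitivity (W k * Rs k * box_cut R N k).
  by field.
rewrite /box_cut; case: leqP => kN'; last by rewrite mulr0.
by rewrite mulrC [W k * _]mulrC RW // mulr1.
Qed.

(** With the [j]-th frequency frozen at size [n], the resolvent becomes [m n], of norm [M n].
    Summing by parts against the cut-offs [coord_cut n] costs [M n - M n.+1] times a logarithm at
    each step, and everything starts at [n = N.+1], where [M] is already below
    [1 / ((2 pi)^2 beta N^2)]. *)
Lemma mult_coord_high beta N (j : 'I_d) : 0 < beta -> (0 < N)%N ->
  mult (fun k => resolvent_symbol beta k * (1 - coord_cut R N j k))
    ((2 + 2 / ln 2) * (5 / ln 2 * ln (N%:R + 2)) / ((2 * pi) ^+ 2 * beta * N%:R ^+ 2)).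
Proof.
move=> b0 N0; set kap := (2 * pi) ^+ 2.
have kap0 : 0 < kap by rewrite exprn_gt0 // mulr_gt0 // pi_gt0.
have bk0 : 0 < kap * beta by rewrite mulr_gt0.
pose M (n : nat) : R := (1 + kap * beta * n%:R ^+ 2)^-1.
pose P (n : nat) : R := 5 / ln 2 * ln (n%:R + 2).
have den n : 0 < 1 + kap * beta * n%:R ^+ 2 by rewrite ltr_pwDl // mulr_ge0 ?sqr_ge0 ?ltW.
have M0 n : 0 < M n by rewrite invr_gt0.
pose m (n : nat) k : R := (1 + kap * beta * n%:R ^+ 2 +
  \sum_i (if i == j then 0 else beta) * (2 * pi * (tnth k i)%:~R) ^+ 2)^-1.
have mM n : mult (m n) (M n) by apply: mult_resolvent => // i; case: ifP => // _; exact: ltW.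
have mden n k : 0 < 1 + kap * beta * n%:R ^+ 2 +
  \sum_i (if i == j then 0 else beta) * (2 * pi * (tnth k i)%:~R) ^+ 2.
  rewrite ltr_pwDl // sumr_ge0 // => i _; rewrite mulr_ge0 ?sqr_ge0 //.
  by case: ifP => // _; exact: ltW.
(* The difference of the two symbols is a nonnegative constant times their product, so [multM]
   yields exactly [M n - M n.+1]. *)
have mD n : mult (fun k => m n k - m n.+1 k) (M n - M n.+1).
  have c0 : 0 <= kap * beta * (2 * n%:R + 1).
    by apply: mulr_ge0; [exact: ltW|have := ler0n R n; lra].
  have -> : M n - M n.+1 = `|kap * beta * (2 * n%:R + 1)| * (M n * M n.+1).
    rewrite ger0_norm // /M; have := den n; have := den n.+1; rewrite -natr1 => h1 h2.
    by field; rewrite !gt_eqF.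
  apply: mult_ext (multZ (kap * beta * (2 * n%:R + 1)) (multM (mM n) (mM n.+1))) => k.
  rewrite /m; have := mden n k; have := mden n.+1 k; rewrite -natr1.
  set X := \sum_i _ => h1 h2.
  by field; rewrite !gt_eqF.
have mE k : resolvent_symbol beta k = m `|tnth k j|%N k.
  rewrite resolvent_symbolE /m /laplace_symbol (bigD1 j) //= [in RHS](bigD1 j) //= eqxx mul0r add0r.
  rewrite mulrDr addrA; congr (_ + _ + _)^-1.
    by rewrite natr_absz intr_norm real_normK ?num_real // exprMn mulrCA mulrA.
  by rewrite mulr_sumr; apply: eq_bigr => i /negbTE ->.
have PD n : P n.+1 - P n <= 5 / ln 2 / n.+1%:R.
  rewrite -mulrBr ler_wpM2l ?divr_ge0 ?ln_ge0 ?ler1n //.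
  have n2 : 0 < n%:R + 2 :> R by rewrite ltr_wpDl.
  have -> : n.+1%:R + 2 = (n%:R + 2) * (1 + (n%:R + 2)^-1) :> R.
    by rewrite -natr1; field; rewrite gt_eqF.
  have i2 : 0 < (n%:R + 2)^-1 :> R by rewrite invr_gt0.
  rewrite lnM ?posrE // ?addr_gt0 // addrC addKr.
  apply: (@le_trans _ _ (n%:R + 2)^-1).
    by apply: le_ln1Dx; rewrite (lt_trans _ i2) // ltrN10.
  by rewrite lef_pV2 ?posrE // -natr1 lerD2l ler1n.
pose c5 : R := 5 / ln 2.
have c50 : 0 <= c5 by rewrite divr_ge0 ?ln_ge0 ?ler1n.
have MB n : (0 < n)%N -> M n <= (kap * beta * n%:R ^+ 2)^-1.
  by move=> n0; rewrite /M lef_pV2 ?posrE ?den // ?lerDr // mulr_gt0 // exprn_gt0 // ltr0n.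
(* Abel summation in the [j]-th frequency. *)
pose F L := M L * P L + \sum_(N.+1 <= n < L) (M n - M n.+1) * P n.
(* Passing from [L] to [L.+1] adds [M L.+1 * (P L.+1 - P L)], of order [L^-3]; up to a constant this
   is at most [1 / N] times the telescoping [1 / L - 1 / L.+1]. *)
have FB L : (N < L)%N -> F L <= M N.+1 * P N.+1 + c5 / (kap * beta * N%:R) * (N%:R^-1 - L%:R^-1).
  have c0 : 0 <= c5 / (kap * beta * N%:R) :> R.
    by rewrite divr_ge0 // mulr_ge0 ?ler0n // ltW.
  elim: L => // L IH; rewrite ltnS leq_eqVlt => /orP[/eqP <-|NL].
    rewrite /F big_geq // addr0 lerDl mulr_ge0 // subr_ge0 lef_pV2 ?posrE ?ltr0n //.
    by rewrite ler_nat.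
  have -> : F L.+1 = F L + M L.+1 * (P L.+1 - P L).
    by rewrite /F big_nat_recr //=; ring.
  apply: le_trans (lerD (IH NL) _) _; first exact: lexx.
  rewrite -addrA lerD2l -[leRHS](_ : c5 / (kap * beta * N%:R) * (N%:R^-1 - L%:R^-1) +
    c5 / (kap * beta * N%:R) * (L%:R^-1 - L.+1%:R^-1) = _); last by rewrite -mulrDr addrA subrK.
  rewrite lerD2l.
  have L0 : 0 < L%:R :> R by rewrite ltr0n; lia.
  have L1 : 0 < L.+1%:R :> R by rewrite ltr0n.
  have n0 : 0 < N%:R :> R by rewrite ltr0n.
  apply: le_trans (_ : (kap * beta * L.+1%:R ^+ 2)^-1 * (c5 / L.+1%:R) <= _).
    apply: le_trans (ler_wpM2l (ltW (M0 _)) (PD L)) _.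
    by apply: ler_wpM2r; [rewrite divr_ge0 // ltW|exact: MB].
  have -> : L%:R^-1 - L.+1%:R^-1 = (L%:R * L.+1%:R)^-1 :> R.
    by rewrite -natr1; field; rewrite natr1 !gt_eqF.
  have le3 : N%:R * (L%:R * L.+1%:R) <= L.+1%:R * (L.+1%:R * L.+1%:R) :> R.
    by rewrite -!natrM ler_nat leq_mul // ?leq_mul // ltnW // ltnW.
  move: (kap * beta) bk0 (L.+1%:R : R) L1 (L%:R : R) L0 (N%:R : R) n0 le3 => a a0 x x0 y y0 z z0 le3.
  have -> : (a * x ^+ 2)^-1 * (c5 / x) = c5 / a * (x * (x * x))^-1 by field; rewrite !gt_eqF.
  have -> : c5 / (a * z) / (y * x) = c5 / a * (z * (y * x))^-1 by field; rewrite !gt_eqF.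
  apply: ler_wpM2l; first by rewrite divr_ge0 // ltW.
  by rewrite lef_pV2 // posrE !mulr_gt0.
apply: mult_local => s.
pose L := (\sum_(u <- s) `|tnth u.2 j| + N).+1.
(* For [|k_j| <= N] the terms telescope to 0; for [N < |k_j| < L] they leave the resolvent itself.
   The level [L] exceeds every frequency of [s]. *)
exists (fun k => m L k * coord_cut R L j k - m N.+1 k * coord_cut R N j k +
  \sum_(N.+1 <= n < L) (m n k - m n.+1 k) * coord_cut R n j k).
  move=> t ts.
  have qL : (`|tnth t.2 j| < L)%N.
    by rewrite ltnS (big_rem t) //= -addnA leq_addr.
  rewrite mE /coord_cut; move: qL; set q := `|tnth t.2 j|%N => qL.
  rewrite (ltnW qL) mulr1.
  have [qN|Nq] := leqP q N.
    rewrite subrr mulr0 mulr1 [X in _ + X](_ : _ = m N.+1 t.2 - m L t.2); first by ring.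
    rewrite -[RHS]opprB -(telescope_sumr (fun n => m n t.2)) ?ltnS ?leq_addl // -sumrN.
    apply: eq_big_nat => n /andP[Nn _].
    by rewrite (leq_trans qN (ltnW Nn)) mulr1 opprB.
  rewrite subr0 mulr1 mulr0 subr0 (big_cat_nat (n := q)) //=; last exact: ltnW.
  rewrite big_nat big1 ?add0r; last first.
    by move=> n /andP[_ nq]; rewrite leqNgt nq mulr0.
  rewrite [X in _ + X](_ : _ = m q t.2 - m L t.2); first by ring.
  rewrite -[RHS]opprB -(telescope_sumr (fun n => m n t.2)) ?(ltnW qL) // -sumrN.
  apply: eq_big_nat => n /andP[qn _].
  by rewrite qn mulr1 opprB.
have := multD (multB (multM (mM L) (mult_dirichlet j L)) (multM (mM N.+1) (mult_dirichlet j N)))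
  (mult_sum (index_iota N.+1 L) (fun n (_ : xpredT n) => multM (mD n) (mult_dirichlet j n))).
apply: mult_le.
have NL : (N < L)%N by rewrite ltnS leq_addl.
have FB' := FB L NL; rewrite /F in FB'.
have n0 : 0 < N%:R :> R by rewrite ltr0n.
have L0 : 0 < L%:R :> R by rewrite ltr0n.
have h1 : c5 / (kap * beta * N%:R) * (N%:R^-1 - L%:R^-1) <= c5 * (kap * beta * N%:R ^+ 2)^-1.
  apply: le_trans (_ : c5 / (kap * beta * N%:R) * N%:R^-1 <= _).
    apply: ler_wpM2l; last by rewrite gerBl invr_ge0 ltW.
    by rewrite divr_ge0 // mulr_ge0 // ltW.
  by rewrite -mulrA -invfM expr2 mulrA.
have MN1 := MB N.+1 isT.
have MM : (kap * beta * N.+1%:R ^+ 2)^-1 <= (kap * beta * N%:R ^+ 2)^-1.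
  have sq n : (0 < n)%N -> 0 < kap * beta * n%:R ^+ 2.
    by move=> ?; rewrite mulr_gt0 // exprn_gt0 // ltr0n.
  by rewrite lef_pV2 ?posrE ?sq // ler_pM2l // ler_sqr ?nnegrE ?ler0n // ler_nat.
have PNN : P N.+1 - P N <= c5 / N.+1%:R := PD N; have c5N : c5 / N.+1%:R <= c5 by rewrite ler_pdivrMr ?ltr0n // ler_peMr // ler1n.
have ln2 : 0 < ln 2 :> R by rewrite ln_gt0 // ltr1n.
have c5P : c5 <= P N / ln 2.
  rewrite ler_pdivlMr //.
  by rewrite /P ler_wpM2l // ler_ln ?posrE ?ltr_wpDl // lerDr.
set e := (kap * beta * N%:R ^+ 2)^-1 in MM h1 *.
have e0 : 0 <= e by rewrite invr_ge0 mulr_ge0 ?sqr_ge0 // ltW.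
have M1 := M0 N.+1; have PN0 : 0 <= P N := mult_ge0 (mult_dirichlet j N).
(* The contributions are [P N + c5], [P N] and [c5], each times [e]; [c5 <= P N / ln 2] gives the
   factor [2 + 2 / ln 2]. *)
change (M L * P L + M N.+1 * P N + \sum_(N.+1 <= i < L) (M i - M i.+1) * P i <=
   (2 + 2 / ln 2) * P N * e).
have g1 : M N.+1 * P N.+1 <= e * (P N + c5).
  apply: le_trans (ler_wpM2l (ltW M1) (_ : _ <= P N + c5)) _; first by rewrite -lerBlDl (le_trans PNN).
  by apply: ler_wpM2r; [rewrite addr_ge0|apply: le_trans MN1 MM].
have g2 : M N.+1 * P N <= e * P N by apply: ler_wpM2r => //; apply: le_trans MN1 MM.
have g3 : e * c5 <= e * (P N / ln 2) by apply: ler_wpM2l.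
move: FB' h1 g1 g2 g3; set S := \sum_(_ <= _ < _) _; rewrite mulrDr mulrA.
set u := e * (P N / ln 2); have -> : (2 + 2 / ln 2) * P N * e = 2 * (e * P N) + 2 * u.
  by rewrite /u; ring.
lra.
Qed.

(* [1 - \prod_j x_j] expands as [\sum_j (1 - x_j) \prod_(i < j) x_i]. *)
Lemma mult_high_large beta N (P D : R) : 0 < beta ->
  1 <= P -> 0 <= D ->
  (forall j, mult (@coord_cut R d N j) P) ->
  (forall j, mult (fun k => resolvent_symbol beta k * (1 - coord_cut R N j k)) (P * D)) ->
  mult (@high_symbol R d beta N) (d%:R * P ^+ d * D).
Proof.
move=> b0 P1 D0 HP HD.
have H (r : seq 'I_d) : mult (fun k => resolvent_symbol beta k *
    (1 - \prod_(j <- r) coord_cut R N j k)) ((size r)%:R * P ^+ size r * D).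
  elim: r => [|j r IH].
    rewrite !mul0r; apply: mult_ext (_ : mult (fun=> 0) 0) => [k|].
      by rewrite big_nil subrr mulr0.
    by have := mult_cst (d := d) (0 : R); rewrite normr0.
  apply: mult_le (_ : P * D + P * ((size r)%:R * P ^+ size r * D) <= _) _.
    rewrite /= -natr1 exprS.
    have : 1 <= P ^+ size r by rewrite exprn_ege1.
    have : 0 <= P * D by rewrite mulr_ge0 // (le_trans ler01).
    nra.
  apply: mult_ext (multD (HD j) (multM (HP j) IH)) => k.
  by rewrite big_cons; ring.
have := H (enum 'I_d); rewrite size_enum_ord.
by apply: mult_ext => k; rewrite high_symbolE box_cutE mulrC big_enum.
Qed.

Lemma mult_high_upper beta N : 0 < beta -> (0 < N)%N ->
  mult (@high_symbol R d beta N)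
   ((5 / ln 2) ^+ d * (4 + 2 * d%:R * (2 + 2 / ln 2) / (2 * pi) ^+ 2) /
     (1 + beta * N%:R ^+ 2) * ln (N%:R + 2) ^+ d).
Proof.
move=> b0 N0; pose P : R := 5 / ln 2 * ln (N%:R + 2).
have ln2 : 0 < ln 2 :> R by rewrite ln_gt0 // ltr1n.
have P1 : 1 <= P.
  have : ln 2 <= ln (N%:R + 2) :> R by rewrite ler_ln ?posrE ?ltr_wpDl // lerDr.
  by rewrite /P mulrAC ler_pdivlMr //; lra.
have kap0 : 0 < (2 * pi) ^+ 2 :> R by rewrite exprn_gt0 // mulr_gt0 // pi_gt0.
have N2 : 0 < N%:R ^+ 2 :> R by rewrite exprn_gt0 // ltr0n.
have Pd : 1 <= P ^+ d by rewrite exprn_ege1.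
have bN : 0 < 1 + beta * N%:R ^+ 2 by rewrite addr_gt0 // mulr_gt0.
pose C : R := d%:R * (2 + 2 / ln 2) / (2 * pi) ^+ 2.
have C0 : 0 <= C.
  by apply: divr_ge0; [rewrite mulr_ge0 // addr_ge0 // divr_ge0 // ltW|exact: ltW].
have -> : (5 / ln 2) ^+ d * (4 + 2 * d%:R * (2 + 2 / ln 2) / (2 * pi) ^+ 2) /
     (1 + beta * N%:R ^+ 2) * ln (N%:R + 2) ^+ d = P ^+ d * (4 + 2 * C) / (1 + beta * N%:R ^+ 2).
  rewrite /P; move: (5 / ln 2) (ln (N%:R + 2)) => a b.
  by rewrite [(a * b) ^+ d]exprMn /C; move: (a ^+ d) (b ^+ d) ((1 + beta * N%:R ^+ 2)^-1) => *; ring.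
have [bN1|bN1] := leP (beta * N%:R ^+ 2) 1.
  apply: mult_le (_ : 1 + P ^+ d <= _) _.
    rewrite ler_pdivlMr //; nra.
  apply: mult_ext (multB (mult_resolvent_symbol b0)
     (_ : mult (fun k => box_cut R N k * resolvent_symbol beta k) (P ^+ d))) => [k|].
    by rewrite high_symbolE; ring.
  by rewrite -[P ^+ d]mulr1; apply: multM; [exact: mult_box_cut|exact: mult_resolvent_symbol].
apply: mult_le (@mult_high_large beta N P ((2 + 2 / ln 2) / ((2 * pi) ^+ 2 * beta * N%:R ^+ 2))
  b0 P1 _ _ _).
- have -> : d%:R * P ^+ d * ((2 + 2 / ln 2) / ((2 * pi) ^+ 2 * beta * N%:R ^+ 2)) =
     P ^+ d * C / (beta * N%:R ^+ 2).
    rewrite /C; move: (P ^+ d) ((2 * pi) ^+ 2) (N%:R ^+ 2) (2 / ln 2) => p a b c.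
    by rewrite !invfM; ring.
  move: (beta * _) bN1 bN => b b1 bp; have b2 : 0 < b := lt_trans ltr01 b1.
  rewrite ler_pdivrMr // mulrAC ler_pdivlMr // -[leLHS]mulrA -[leRHS]mulrA.
  apply: ler_wpM2l; first exact: le_trans Pd.
  rewrite -subr_ge0 [leRHS](_ : _ = C * (b - 1) + 4 * b); last by ring.
  by apply: addr_ge0; apply: mulr_ge0 => //; [rewrite subr_ge0 ltW|exact: ltW].
- apply: divr_ge0; first by rewrite addr_ge0 // divr_ge0 // ltW.
  by apply: mulr_ge0 (ltW N2); apply: mulr_ge0; exact: ltW.
- by move=> j; exact: mult_dirichlet.
- move=> j; apply: mult_le (mult_coord_high j b0 N0).
  by rewrite le_eqVlt; apply/orP; left; apply/eqP; rewrite /P; ring.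
Qed.

End MultiplierBounds.

(** * Integration on the torus *)

Section ComplexIntegrals.
Variables (R : realType) (d : nat).
Local Notation mu := (torus_measure R d).
Implicit Types f g : d.-tuple R -> R[i].

Definition complex_measurable f : Prop :=
  measurable_fun setT (fun x => complex.Re (f x)) /\
  measurable_fun setT (fun x => complex.Im (f x)).

Lemma complex_integrable_measurable f : complex_integrable f -> complex_measurable f.
Proof.
by move=> [/measurable_int/measurable_EFinP ? /measurable_int/measurable_EFinP ?].
Qed.

Lemma bounded_integrable (f : d.-tuple R -> R) (B : R) : measurable_fun setT f ->
  (forall x, `|f x| <= B) -> mu.-integrable setT (EFin \o f).
Proof.
move=> mf fB; apply: measurable_bounded_integrable => //.
  by rewrite (le_lt_trans (probability_le1 mu measurableT)) // ltry.
exists B; split; first exact: num_real.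
by move=> M BM x _ /=; rewrite (le_trans (fB x)) // ltW.
Qed.

Lemma normc_measurable f : complex_measurable f -> measurable_fun setT (fun x => normc (f x)).
Proof.
move=> [mr mi].
have -> : (fun x => normc (f x)) =
    (fun x => Num.sqrt (complex.Re (f x) ^+ 2 + complex.Im (f x) ^+ 2)).
  by apply/funext => x; case: (f x).
apply: measurableT_comp; first exact: (continuous_measurable_fun (@sqrt_continuous R)).
by apply: measurable_funD; apply: measurable_funX.
Qed.

Lemma complex_integrable_normc f : complex_integrable f ->
  mu.-integrable setT (EFin \o (fun x => normc (f x))).
Proof.
move=> If; have [mr mi] := complex_integrable_measurable If.
have [Ir Ii] := If.
apply: (@le_integrable _ _ _ mu setT measurableT _
  (fun x => `|(complex.Re (f x))%:E| + `|(complex.Im (f x))%:E|)%E).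
- by apply/measurable_EFinP; exact: normc_measurable.
- move=> x _; rewrite /= lee_fin (ger0_norm (normc_ge0 _)) [leRHS]ger0_norm ?addr_ge0 //.
  exact: normc_le_ReIm.
- by apply: integrableD => //; exact: integrable_abse.
Qed.

Lemma complex_integrableD f g : complex_integrable f -> complex_integrable g ->
  complex_integrable (fun x => f x + g x).
Proof.
move=> [fr fi] [gr gi]; split.
  by apply: eq_integrable (integrableD measurableT fr gr) => // x _; rewrite /= ReD.
by apply: eq_integrable (integrableD measurableT fi gi) => // x _; rewrite /= ImD.
Qed.

Lemma complex_integralD f g : complex_integrable f -> complex_integrable g ->
  complex_integral (fun x => f x + g x) = complex_integral f + complex_integral g.
Proof.
move=> [fr fi] [gr gi]; rewrite /complex_integral.
apply/eqP; rewrite eq_complex /=; apply/andP; split; apply/eqP.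
  by rewrite -RintegralD //; apply: eq_Rintegral => x _; rewrite ReD.
by rewrite -RintegralD //; apply: eq_Rintegral => x _; rewrite ImD.
Qed.

Lemma complex_integrableZ f (c : R[i]) : complex_integrable f ->
  complex_integrable (fun x => c * f x).
Proof.
move=> [fr fi]; case: c => a b; split.
  apply: eq_integrable (integrableB measurableT (integrableZl measurableT a fr)
    (integrableZl measurableT b fi)) => // x _ /=.
  by case: (f x) => u v /=.
apply: eq_integrable (integrableD measurableT (integrableZl measurableT a fi)
    (integrableZl measurableT b fr)) => // x _ /=.
by case: (f x) => u v /=; congr EFin; ring.
Qed.

Lemma complex_integralZ f (c : R[i]) : complex_integrable f ->
  complex_integral (fun x => c * f x) = c * complex_integral f.
Proof.
move=> [fr fi]; rewrite /complex_integral; case: c => a b.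
have IZ (h : d.-tuple R -> R) (r : R) : mu.-integrable setT (fun x => (h x)%:E) ->
    mu.-integrable setT (EFin \o (fun x => r * h x)).
  by move=> Ih; exact: (integrableZl measurableT r Ih).
apply/eqP; rewrite eq_complex /=; apply/andP; split; apply/eqP.
  rewrite -!RintegralZl // -RintegralB //; try exact: IZ.
  by apply: eq_Rintegral => x _; case: (f x).
rewrite -!RintegralZl // -RintegralD //; try exact: IZ.
by apply: eq_Rintegral => x _; case: (f x) => u v /=; ring.
Qed.

Lemma complex_integral_sum (I : Type) (r : seq I) (F : I -> d.-tuple R -> R[i]) :
  (forall i, complex_integrable (F i)) ->
  complex_integral (fun x => \sum_(i <- r) F i x) = \sum_(i <- r) complex_integral (F i).
Proof.
move=> IF; suff [] : complex_integrable (fun x => \sum_(i <- r) F i x) /\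
  complex_integral (fun x => \sum_(i <- r) F i x) = \sum_(i <- r) complex_integral (F i) by [].
elim: r => [|i r [IH1 IH2]].
  have -> : (fun x => \sum_(i <- [::]) F i x) = (fun=> 0) by apply/funext => x; rewrite big_nil.
  split; first by split; exact: integrable0.
  by rewrite big_nil /complex_integral /= /Rintegral integral0.
have -> : (fun x => \sum_(j <- i :: r) F j x) = (fun x => F i x + \sum_(j <- r) F j x).
  by apply/funext => x; rewrite big_cons.
by split; [exact: complex_integrableD|rewrite complex_integralD // big_cons IH2].
Qed.

(* Rotate the integral to the real axis. *)
Lemma normc_complex_integral_le f : complex_integrable f ->
  normc (complex_integral f) <= \int[mu]_x normc (f x).
Proof.
move=> If; set z := complex_integral f; set I := \int[mu]_x normc (f x).
have [->|z0] := eqVneq (normc z) 0.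
  by apply: Rintegral_ge0 => x _; exact: normc_ge0.
have zp : 0 < normc z by rewrite lt_def z0 normc_ge0.
have E : (normc z ^+ 2)%:C = complex_integral (fun x => conjc z * f x).
  by rewrite complex_integralZ // -/z mulrC normc_sqrE.
have : normc z ^+ 2 <= normc z * I.
  have [Ir Ii] := complex_integrableZ (conjc z) If.
  have -> : normc z ^+ 2 = \int[mu]_x complex.Re (conjc z * f x).
    by have := congr1 (@complex.Re R) E.
  have In := complex_integrable_normc If.
  rewrite -RintegralZl //; apply: le_Rintegral => //.
    exact: (integrableZl measurableT (normc z) In).
  move=> x _; apply: le_trans (ler_norm _) _; apply: le_trans (normr_Re_le _) _.
  by rewrite Normc.normcM normc_conj.
by rewrite expr2 ler_pM2l.
Qed.

Lemma complex_integrableM f g (B : R) : complex_integrable f -> complex_measurable g ->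
  (forall x, normc (g x) <= B) -> complex_integrable (fun x => f x * g x).
Proof.
move=> If [mr mi] gB.
have bdd h : (forall x, `|h x| <= B) -> [bounded h x | x in (setT : set (d.-tuple R))].
  move=> hB; exists B; split; first exact: num_real.
  by move=> M BM x _ /=; rewrite (le_trans (hB x)) // ltW.
have br : [bounded complex.Re (g x) | x in setT].
  by apply: bdd => x; exact: le_trans (normr_Re_le _) (gB x).
have bi : [bounded complex.Im (g x) | x in setT].
  by apply: bdd => x; exact: le_trans (normr_Im_le _) (gB x).
have [Ir Ii] := If; split.
  apply: eq_integrable (integrableB measurableT (integrableMl measurableT Ir mr br)
    (integrableMl measurableT Ii mi bi)) => // x _ /=.
  by case: (f x) (g x) => u v [a b].
apply: eq_integrable (integrableD measurableT (integrableMl measurableT Ir mi bi)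
    (integrableMl measurableT Ii mr br)) => // x _ /=.
by case: (f x) (g x) => u v [a b].
Qed.

Lemma measurable_phase (k : frequency d) :
  measurable_fun setT (fun x : d.-tuple R => 2 * pi * \sum_(j < d) (tnth k j)%:~R * tnth x j).
Proof.
apply: measurable_funM; first exact: measurable_cst.
apply: measurable_sum => j; apply: measurable_funM; first exact: measurable_cst.
exact: measurable_tnth.
Qed.

Lemma measurable_fourier_mode (k : frequency d) : complex_measurable (fourier_mode k).
Proof.
split; apply: (measurableT_comp _ (measurable_phase k)).
  exact: (continuous_measurable_fun (@continuous_cos R)).
exact: (continuous_measurable_fun (@continuous_sin R)).
Qed.

Lemma complex_integrable_mode (c : R[i]) (k : frequency d) :
  complex_integrable (fun x : d.-tuple R => c * fourier_mode k x).
Proof.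
apply: complex_integrableZ; have [mr mi] := measurable_fourier_mode k.
split; apply: (@bounded_integrable _ 1) => // x; rewrite -(normc_fourier_mode k x).
  exact: normr_Re_le.
exact: normr_Im_le.
Qed.

Lemma measurable_trig s : complex_measurable (@trig R d s).
Proof.
have H (t : R[i] * frequency d) : complex_measurable (fun x => t.1 * fourier_mode t.2 x).
  by apply: complex_integrable_measurable; exact: complex_integrable_mode.
split.
  under eq_fun do rewrite /trig Re_sum.
  by apply: measurable_sum => t; have [] := H t.
under eq_fun do rewrite /trig Im_sum.
by apply: measurable_sum => t; have [] := H t.
Qed.

Lemma complex_integrable_trig s : complex_integrable (@trig R d s).
Proof.
have [mr mi] := measurable_trig s.
split; apply: (@bounded_integrable _ (\sum_(t <- s) normc t.1)) => // x.
  exact: le_trans (normr_Re_le _) (trig_bound _ _).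
exact: le_trans (normr_Im_le _) (trig_bound _ _).
Qed.

End ComplexIntegrals.

(** * Orthogonality of the Fourier modes *)

Section Orthogonality.
Variable R : realType.

(* Lebesgue measure lives on a copy of [R] with another display. *)
Let idTR : measurableTypeR R -> R := idfun.

#[local] HB.instance Definition _ :=
  @isMeasurableFun.Build _ _ _ _ idTR (@measurable_id _ _ setT).

(** Passes to Lebesgue measure on the closed interval, where the fundamental theorem of calculus is
    available. *)
Lemma unit_interval_integral (f : R -> R) (B : R) : continuous f ->
  (forall x, `|f x| <= B) ->
  (\int[@unit_interval_measure R]_x (f x)%:E =
   \int[lebesgue_measure]_(x in `[0%R, 1%R]) (f x)%:E)%E.
Proof.
move=> cf fB; have mf := continuous_measurable_fun cf.
pose D : set R := `[0%R, 1%R[%classic; have mD : measurable D by exact: measurable_itv.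
have -> : (\int[@unit_interval_measure R]_x (f x)%:E =
    \int[@unit_interval_measure R]_(x in D) (f x)%:E)%E.
  rewrite [RHS]integral_mkcond; apply: ae_eq_integral => //.
  - exact/measurable_EFinP.
  - by apply/(measurable_restrictT _ _).1 => //; apply/measurable_EFinP; exact: measurable_funTS.
  exists (~` D); split.
  - exact: measurableC.
  - by rewrite /= /unit_interval_measure setICl measure0.
  move=> x /= h Dx; apply: h => _; by rewrite patchE mem_set.
transitivity (\int[pushforward (@lebesgue_measure R) idTR]_(x in D) (f x)%:E)%E.
  apply: eq_measure_integral => A mA AD.
  by change (lebesgue_measure (A `&` D) = lebesgue_measure A); rewrite setIidl.
rewrite integral_pushforward //; last 2 first.
- exact/measurable_EFinP.
- apply: measurable_bounded_integrable => //.
  + change (lebesgue_measure (`[0%R, 1%R[%classic : set R) < +oo)%E.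
    by rewrite lebesgue_measure_itv /= lte_fin ltr01 ltry.
  + exact: measurable_funTS.
  + exists B; split; first exact: num_real.
    by move=> M BM x _ /=; rewrite (le_trans (fB x)) // ltW.
rewrite integral_itv_bndo_bndc //.
apply/measurable_EFinP; exact: measurable_funTS.
Qed.

Lemma integral_cos_sin (n : int) : n != 0 ->
  (\int[@unit_interval_measure R]_x (cos (2 * pi * (n%:~R * x)))%:E = 0)%E /\
  (\int[@unit_interval_measure R]_x (sin (2 * pi * (n%:~R * x)))%:E = 0)%E.
Proof.
move=> n0; pose w : R := 2 * pi * n%:~R.
have w0 : w != 0 by rewrite !mulf_neq0 ?intr_eq0 // gt_eqF // pi_gt0.
have wE x : 2 * pi * (n%:~R * x) = w * x by rewrite mulrA.
have dsin (x : R) : is_derive x 1 (fun x => sin (w * x) / w) (cos (w * x)).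
  by apply: is_derive_eq; rewrite /GRing.scale /= !mulr0 ?addr0 ?add0r; field.
have dcos (x : R) : is_derive x 1 (fun x => - cos (w * x) / w) (sin (w * x)).
  by apply: is_derive_eq; rewrite /GRing.scale /= !mulr0 ?addr0 ?add0r; field.
have c1 : continuous (fun x : R => cos (w * x)).
  move=> x; apply: continuous_comp; last exact: continuous_cos.
  exact: mulrl_continuous.
have c2 : continuous (fun x : R => sin (w * x)).
  move=> x; apply: continuous_comp; last exact: continuous_sin.
  exact: mulrl_continuous.
have FTC (f F : R -> R) : continuous f -> (forall x, `|f x| <= 1) -> (forall x : R, is_derive x 1 F (f x)) ->
    F 1 = F 0 -> (\int[@unit_interval_measure R]_x (f x)%:E = 0)%E.
  move=> cf f1 dF F10; rewrite (unit_interval_integral cf f1).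
  have cF (x : R) : {for x, continuous F}.
    by apply: differentiable_continuous; apply/derivable1_diffP; exact: ex_derive.
  rewrite (@continuous_FTC2 _ f F) //.
  - by rewrite F10 subee.
  - exact: continuous_subspaceT.
  - by split => [x _||]; [exact: ex_derive|apply: cvg_at_right_filter; exact: cF|
      apply: cvg_at_left_filter; exact: cF].
  - by move=> x _; rewrite derive1E derive_val.
have e1 : expi w = 1 :> R[i] by rewrite /w expi_2piz.
split; under eq_integral do rewrite wE.
  apply: FTC c1 (fun x => cos_max _) dsin _; have := congr1 (@complex.Im R) e1 => /=.
  by rewrite mulr1 mulr0 sin0 => ->.
apply: FTC c2 (fun x => sin_max _) dcos _; have := congr1 (@complex.Re R) e1 => /=.
by rewrite mulr1 mulr0 cos0 => ->.
Qed.

End Orthogonality.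

Section TorusOrthogonality.
Variable R : realType.

Lemma integral_torus_tcons (n : nat) (f : n.+1.-tuple R -> R) (B : R) :
  measurable_fun setT f -> (forall x, `|f x| <= B) ->
  (\int[torus_measure R n.+1]_x (f x)%:E =
   \int[@unit_interval_measure R]_a \int[torus_measure R n]_x (f (tcons (a, x)))%:E)%E.
Proof.
move=> mf fB.
have mft : measurable_fun setT (fun p : R * n.-tuple R => f (tcons p)).
  by apply: measurableT_comp => //; exact: measurable_tcons.
have If : (@unit_interval_measure R \x torus_measure R n)%E.-integrable setT
    (EFin \o (fun p : R * n.-tuple R => f (tcons p))).
  apply: measurable_bounded_integrable => //.
    apply: (le_lt_trans (@probability_le1 _ _ _ (@unit_interval_measure R \x torus_measure R n)%E
      _ measurableT)); exact: ltry.
  exists B; split; first exact: num_real.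
  by move=> M BM x _ /=; rewrite (le_trans (fB _)) // ltW.
transitivity (\int[(@unit_interval_measure R \x torus_measure R n)%E]_p (f (tcons p))%:E)%E.
  rewrite /= /distribution integral_pushforward //.
  exact/measurable_EFinP.
by rewrite -(integral12_prod_meas1 If).
Qed.

Lemma fourier_mode_tcons (n : nat) (k : frequency n.+1) (a : R) (x : n.-tuple R) :
  fourier_mode k (tcons (a, x)) =
  expi (2 * pi * ((thead k)%:~R * a)) * fourier_mode [tuple of behead k] x.
Proof.
rewrite !fourier_modeE -expiD -mulrDr big_ord_recl; congr (expi (_ * (_ + _))).
apply: eq_bigr => j _; rewrite /tcons tnthS tnth_behead; congr ((tnth k _)%:~R * _).
by apply/val_inj; rewrite /= inordK // ltnS.
Qed.

Lemma integral_torus_cst (d : nat) (r : R) : (\int[torus_measure R d]_x r%:E = r%:E)%E.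
Proof.
rewrite integral_cst //; transitivity (r%:E * 1)%E; last exact: mule1.
by congr (_ * _)%E; exact: probability_setT.
Qed.

Lemma complex_integral_cst (d : nat) (c : R[i]) :
  complex_integral (fun _ : d.-tuple R => c) = c.
Proof.
by rewrite /complex_integral /Rintegral !integral_torus_cst; case: c.
Qed.

(** Induction on the dimension: if some later frequency is nonzero the inner integral vanishes,
    otherwise the first one is nonzero and the outer integral does. *)
Lemma complex_integral_mode (d : nat) (k : frequency d) :
  complex_integral (fourier_mode (R := R) k) = (k == freq0 d)%:R.
Proof.
have [->|] := eqVneq k (freq0 d).
  have -> : fourier_mode (R := R) (freq0 d) = (fun=> 1).
    by apply/funext => x; rewrite fourier_mode_freq0.
  exact: complex_integral_cst.
elim: d k => [|n IH] k k0.
  by move: k0; rewrite (tuple0 k) (tuple0 (freq0 0)) eqxx.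
have [mr mi] := measurable_fourier_mode R k.
have Br x : `|complex.Re (fourier_mode (R := R) k x)| <= 1.
  by rewrite -(normc_fourier_mode k x); exact: normr_Re_le.
have Bi x : `|complex.Im (fourier_mode (R := R) k x)| <= 1.
  by rewrite -(normc_fourier_mode k x); exact: normr_Im_le.
suff [zr zi] : (\int[torus_measure R n.+1]_x (complex.Re (fourier_mode k x))%:E = 0 /\
    \int[torus_measure R n.+1]_x (complex.Im (fourier_mode k x))%:E = 0)%E.
  by rewrite /complex_integral /Rintegral zr zi.
rewrite (integral_torus_tcons mr Br) (integral_torus_tcons mi Bi).
have [k'0|k'0] := eqVneq ([tuple of behead k] : frequency n) (freq0 n).
  have h0 : thead k != 0.
    apply: contra k0 => /eqP h0; apply/eqP; rewrite (tuple_eta k) h0; apply: eq_from_tnth => i.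
    rewrite tnth_mktuple; case: (unliftP ord0 i) => [j ->|->] //.
    move: (congr1 (fun t : frequency n => tnth t j) k'0); rewrite /= tnth_mktuple tnthS => <-.
    by congr (tnth _ _); exact/val_inj.
  have [Hc Hs] := integral_cos_sin R h0.
  have E (a : R) (x : n.-tuple R) : fourier_mode k (tcons (a, x)) = expi (2 * pi * ((thead k)%:~R * a)).
    by rewrite fourier_mode_tcons k'0 fourier_mode_freq0 mulr1.
  split; [rewrite -[RHS]Hc|rewrite -[RHS]Hs]; apply: eq_integral => a _.
    under eq_integral do rewrite E.
    exact: integral_torus_cst.
  under eq_integral do rewrite E.
  exact: integral_torus_cst.
have Z := IH _ k'0.
have inner (a : R) : complex_integral (fun x : n.-tuple R => fourier_mode k (tcons (a, x))) = 0 /\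
    complex_integrable (fun x : n.-tuple R => fourier_mode k (tcons (a, x))).
  have -> : (fun x : n.-tuple R => fourier_mode k (tcons (a, x))) = (fun x =>
     expi (2 * pi * ((thead k)%:~R * a)) * fourier_mode [tuple of behead k] x).
    by apply/funext => x; rewrite fourier_mode_tcons.
  split; last exact: complex_integrable_mode.
  rewrite complex_integralZ ?Z ?mulr0 //.
  have := complex_integrable_mode (1 : R[i]) [tuple of behead k].
  by congr complex_integrable; apply/funext => x; rewrite mul1r.
split; rewrite -[RHS](integral0 (@unit_interval_measure R) setT); apply: eq_integral => a _;
  have [/eqP] := inner a; rewrite eq_complex /= => /andP[/eqP hr /eqP hi] [Ir Ii].
  by rewrite -[LHS]fineK ?integrable_fin_num //; exact: (congr1 EFin hr).
by rewrite -[LHS]fineK ?integrable_fin_num //; exact: (congr1 EFin hi).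
Qed.

End TorusOrthogonality.

(** * Pairing with trigonometric polynomials *)

Section Pairing.
Variables (R : realType) (d : nat).
Local Notation mu := (torus_measure R d).
Implicit Types s : seq (R[i] * frequency d).

Lemma fourier_coefficientE (f : d.-tuple R -> R[i]) (k : frequency d) :
  fourier_coefficient f k = complex_integral (fun x => f x * fourier_mode (freq_opp k) x).
Proof.
by congr complex_integral; apply/funext => x; rewrite fourier_mode_freq_opp.
Qed.

Lemma complex_integrable_mul_mode (f : d.-tuple R -> R[i]) k :
  complex_integrable f -> complex_integrable (fun x => f x * fourier_mode k x).
Proof.
move=> If; apply: (@complex_integrableM R d f _ 1) => //.
  exact: measurable_fourier_mode.
by move=> x; rewrite normc_fourier_mode.
Qed.

(** The pairing is bilinear, without conjugation, which is why opposite frequencies occur. *)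
Lemma complex_integral_mul_trig (f : d.-tuple R -> R[i]) s : complex_integrable f ->
  complex_integral (fun x => f x * trig s x) =
  \sum_(t <- s) t.1 * fourier_coefficient f (freq_opp t.2).
Proof.
move=> If; have -> : (fun x => f x * trig s x) =
    (fun x => \sum_(t <- s) t.1 * (f x * fourier_mode t.2 x)).
  apply/funext => x; rewrite /trig mulr_sumr; apply: eq_bigr => t _.
  by rewrite mulrCA.
rewrite complex_integral_sum => [|t].
  apply: eq_bigr => t _; rewrite complex_integralZ; last exact: complex_integrable_mul_mode.
  by rewrite fourier_coefficientE freq_oppK.
by apply: complex_integrableZ; exact: complex_integrable_mul_mode.
Qed.

Lemma complex_integral_trig_mul_trig s s' :
  complex_integral (fun x => trig s x * trig s' x) =
  \sum_(t <- s) \sum_(u <- s') t.1 * u.1 * (freq_add t.2 u.2 == freq0 d)%:R.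
Proof.
have -> : (fun x => trig s x * trig s' x) = (fun x => \sum_(v <- trig_mul s s')
    v.1 * fourier_mode v.2 x).
  by apply/funext => x; rewrite -trig_mulE.
rewrite complex_integral_sum => [|v]; last exact: complex_integrable_mode.
rewrite big_allpairs_dep; apply: eq_bigr => t _; apply: eq_bigr => u _ /=.
rewrite complex_integralZ ?complex_integral_mode //.
have := complex_integrable_mode (1 : R[i]) (freq_add t.2 u.2).
by congr complex_integrable; apply/funext => x; rewrite mul1r.
Qed.

Lemma fourier_coefficient_trig s k :
  fourier_coefficient (trig s) k = \sum_(t <- s | t.2 == k) t.1.
Proof.
rewrite fourier_coefficientE.
have -> : (fun x => trig s x * fourier_mode (freq_opp k) x) =
    (fun x => trig s x * trig [:: (1, freq_opp k)] x).
  by apply/funext => x; rewrite trig_mode mul1r.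
rewrite complex_integral_trig_mul_trig [RHS]big_mkcond; apply: eq_bigr => t _.
rewrite big_seq1 /= mulr1.
have -> : (freq_add t.2 (freq_opp k) == freq0 d) = (t.2 == k).
  apply/eqP/eqP => [h|->].
    by rewrite -(freq_addNK t.2 k) h; apply: eq_from_tnth => j; rewrite !tnth_mktuple add0r.
  by apply: eq_from_tnth => j; rewrite !tnth_mktuple subrr.
by case: eqP => _; rewrite ?mulr1 // mulr0.
Qed.

(** The multiplier is convolution with [K], and a convolution increases the sup norm at most by the
    L^1 norm of its kernel: the easy half of the duality. *)
Lemma mult_of_kernel (K : d.-tuple R -> R[i]) (a : frequency d -> R) :
  complex_integrable K -> (forall k, fourier_coefficient K k = (a k)%:C) ->
  mult a (\int[mu]_x normc (K x)).
Proof.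
move=> IK Ka s B sB x.
(* The polynomial [y -> trig s (x - y)]. *)
pose s' : seq (R[i] * frequency d) := [seq (t.1 * fourier_mode t.2 x, freq_opp t.2) | t <- s].
have s'E y : trig s' y = trig s (point_add x (point_opp y)).
  rewrite /trig big_map; apply: eq_bigr => t _ /=.
  by rewrite fourier_mode_point_add fourier_mode_point_opp fourier_mode_freq_opp mulrA.
have -> : trig (act a s) x = complex_integral (fun y => K y * trig s' y).
  rewrite complex_integral_mul_trig // big_map trig_act; apply: eq_bigr => t _ /=.
  by rewrite freq_oppK Ka mulrC.
have I1 : complex_integrable (fun y => K y * trig s' y).
  apply: (@complex_integrableM R d K _ B) => // [|y]; first exact: measurable_trig.
  by rewrite s'E.
apply: le_trans (normc_complex_integral_le I1) _.
have IN := complex_integrable_normc IK.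
rewrite -RintegralZr //; apply: le_Rintegral => //.
- exact: complex_integrable_normc.
- exact: (integrableZr measurableT B IN).
move=> y _; rewrite Normc.normcM s'E; apply: ler_wpM2l => //; exact: normc_ge0.
Qed.

End Pairing.

(** * L^1 norms by duality with trigonometric polynomials *)

Section RealTrigPolynomials.
Variables (R : realType) (d : nat).
Implicit Types (phi psi : d.-tuple R -> R).

Definition is_trig phi : Prop :=
  exists s : seq (R[i] * frequency d), forall x, trig s x = (phi x)%:C.

Lemma is_trig_cst (c : R) : is_trig (fun=> c).
Proof. by exists [:: (c%:C, freq0 d)] => x; rewrite trig_mode fourier_mode_freq0 mulr1. Qed.

Lemma is_trigD phi psi : is_trig phi -> is_trig psi -> is_trig (fun x => phi x + psi x).
Proof. by move=> [s sE] [u uE]; exists (s ++ u) => x; rewrite trig_cat sE uE rmorphD. Qed.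

Lemma is_trigM phi psi : is_trig phi -> is_trig psi -> is_trig (fun x => phi x * psi x).
Proof. by move=> [s sE] [u uE]; exists (trig_mul s u) => x; rewrite trig_mulE sE uE rmorphM. Qed.

Lemma is_trigX phi n : is_trig phi -> is_trig (fun x => phi x ^+ n).
Proof.
move=> Hp; elim: n => [|n IH]; first exact: is_trig_cst.
by under eq_fun do rewrite exprS; exact: is_trigM.
Qed.

Lemma is_trigB phi psi : is_trig phi -> is_trig psi -> is_trig (fun x => phi x - psi x).
Proof.
move=> Hp Hs; under eq_fun do rewrite -mulN1r.
by apply: is_trigD => //; apply: is_trigM => //; exact: is_trig_cst.
Qed.

Lemma is_trig_Re (s : seq (R[i] * frequency d)) : is_trig (fun x => complex.Re (trig s x)).
Proof.
pose s' : seq (R[i] * frequency d) := [seq (conjc t.1, freq_opp t.2) | t <- s].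
exists (trig_scale (2^-1)%:C (s ++ s')) => x.
have s'E : trig s' x = conjc (trig s x).
  rewrite /trig big_map conjc_sum; apply: eq_bigr => t _ /=.
  by rewrite fourier_mode_freq_opp rmorphM.
rewrite trig_scaleE trig_cat s'E; case: (trig s x) => a b.
by apply/eqP; rewrite eq_complex /=; apply/andP; split; apply/eqP; field.
Qed.

Lemma is_trig_cos_coord (i : 'I_d) : is_trig (fun x => cos (2 * pi * tnth x i)) /\
  is_trig (fun x => sin (2 * pi * tnth x i)).
Proof.
pose k : frequency d := [tuple (j == i)%:Z | j < d].
have E x : fourier_mode k x = expi (2 * pi * tnth x i).
  rewrite fourier_modeE; congr (expi (_ * _)).
  rewrite (bigD1 i) //= tnth_mktuple eqxx mul1r big1 ?addr0 // => j ij.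
  by rewrite tnth_mktuple (negbTE ij) mul0r.
split.
  have := is_trig_Re [:: (1, k)]; congr is_trig; apply/funext => x.
  by rewrite trig_mode mul1r E.
have := is_trig_Re [:: (0 -i* 1, k)]; congr is_trig; apply/funext => x.
by rewrite trig_mode E /expi /=; ring.
Qed.

Lemma is_trig_measurable phi : is_trig phi -> measurable_fun setT phi.
Proof.
move=> [s sE]; have [mr _] := measurable_trig s.
by have -> : phi = (fun x => complex.Re (trig s x)) by apply/funext => x; rewrite sE.
Qed.

End RealTrigPolynomials.

(* [(1 - u^n)^(2^n %/ n.+1)] tends to the indicator of [u <= 1/2] on [[0, 1]],
   including at [u = 1/2]. *)
Lemma cvg_threshold (R : realType) (u : R) : 0 <= u <= 1 ->
  (1 - u ^+ n) ^+ (2 ^ n %/ n.+1)%N @[n --> \oo] --> ((u <= 2^-1)%R%:R : R).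
Proof.
move=> /andP[u0 u1].
have un n : 0 <= u ^+ n <= 1 by rewrite exprn_ge0 //= exprn_ile1.
have bern (x : R) m : 0 <= x <= 1 -> 1 - m%:R * x <= (1 - x) ^+ m.
  move=> /andP[x0 x1]; elim: m => [|m IH]; first by rewrite mul0r subr0.
  rewrite exprS -natr1; have : 0 <= m%:R * x by rewrite mulr_ge0.
  have : (1 - x) * (1 - m%:R * x) <= (1 - x) * (1 - x) ^+ m by rewrite ler_wpM2l // subr_ge0.
  nra.
have bern' (x : R) m : 0 <= x <= 1 -> (1 - x) ^+ m * (1 + m%:R * x) <= 1.
  move=> /andP[x0 x1]; elim: m => [|m IH]; first by rewrite mul0r addr0 mulr1.
  rewrite exprS -natr1; have : 0 <= m%:R * x by rewrite mulr_ge0.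
  have p0 : 0 <= (1 - x) ^+ m by rewrite exprn_ge0 // subr_ge0.
  have -> : 1 + (m%:R + 1) * x = 1 + m%:R * x + x by ring.
  move: ((1 - x) ^+ m) (m%:R * x) IH p0 => p q IH p0 q0.
  have : 0 <= p * (x * (q + x)) by rewrite !mulr_ge0 // addr_ge0.
  nra.
(* For [u <= 1/2] the exponent times [u^n] is at most [1 / n.+1], and Bernoulli's inequality
   applies. *)
case: leP => h.
  have H n : 1 - harmonic n <= (1 - u ^+ n) ^+ (2 ^ n %/ n.+1)%N <= 1.
    apply/andP; split; last by rewrite exprn_ile1 // ?subr_ge0 ?gerBl; have /andP[] := un n.
    apply: le_trans (bern _ _ (un n)); rewrite lerB // /harmonic /=.
    have q : (2 ^ n %/ n.+1 * n.+1)%N%:R <= 2 ^+ n :> R by rewrite -natrX ler_nat leq_divM.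
    rewrite -[leRHS]mul1r ler_pdivlMr // mulrAC -natrM.
    apply: (@le_trans _ _ (2 ^+ n * u ^+ n)); first by rewrite ler_wpM2r // exprn_ge0.
    rewrite -exprMn exprn_ile1 ?mulr_ge0 //.
    by rewrite mulrC -ler_pdivlMr // mul1r.
  apply: (squeeze_cvgr (nearW _ H)); last exact: cvg_cst.
  by rewrite -[X in _ --> X](subr0 1); apply: cvgB; [exact: cvg_cst|exact: cvg_harmonic].
(* For [u > 1/2], [(2 u)^n = (1 + eta)^(2 n)]; the square root makes Bernoulli's linear bound
   quadratic in [n], enough to beat the division by [n.+1] in the exponent. *)
pose eta := Num.sqrt (2 * u) - 1.
have u2 : 1 < 2 * u by rewrite mulrC -ltr_pdivrMr // mul1r.
have eta0 : 0 < eta by rewrite subr_gt0 -[ltLHS]sqrtr1 ltr_sqrt // (lt_trans ltr01).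
have eta1 : eta <= 1.
  have : Num.sqrt (2 * u) <= Num.sqrt (2 ^+ 2) by rewrite ler_sqrt // expr2; nra.
  by rewrite sqrtr_sqr ger0_norm // /eta; lra.
have pow n : 1 + n%:R * eta <= (1 + eta) ^+ n.
  elim: n => [|n IH]; first by rewrite mul0r addr0.
  rewrite exprS -natr1; have : 0 <= n%:R * eta by rewrite mulr_ge0 // ltW.
  have : (1 + eta) * (1 + n%:R * eta) <= (1 + eta) * (1 + eta) ^+ n.
    by rewrite ler_wpM2l // addr_ge0 // ltW.
  by move: eta0; nra.
have H n : 0 <= (1 - u ^+ n) ^+ (2 ^ n %/ n.+1)%N <= eta ^- 2 * harmonic n.
  have /andP[un0 un1] := un n.
  have p0 : 0 <= (1 - u ^+ n) ^+ (2 ^ n %/ n.+1)%N by rewrite exprn_ge0 // subr_ge0.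
  rewrite p0 /= /harmonic /= -invfM -[leRHS]mul1r ler_pdivlMr ?mulr_gt0 ?exprn_gt0 //.
  apply: le_trans (bern' _ (2 ^ n %/ n.+1)%N (un n)); apply: ler_wpM2l => //.
  set m := (2 ^ n %/ n.+1)%N.
  have m1 : 2 ^+ n <= (m%:R + 1) * n.+1%:R :> R.
    by rewrite natr1 -natrM -natrX ler_nat ltnW // ltn_ceil.
  have m2 : (eta * n.+1%:R) ^+ 2 <= (m%:R + 1) * n.+1%:R * u ^+ n.
    apply: (@le_trans _ _ (2 ^+ n * u ^+ n)); last by rewrite ler_wpM2r.
    rewrite -exprMn -[in leRHS](@sqr_sqrtr _ (2 * u)); last by rewrite (le_trans ler01) // ltW.
    rewrite -exprM mulnC exprM ler_sqr ?nnegrE ?exprn_ge0 ?sqrtr_ge0 ?mulr_ge0 ?(ltW eta0) //.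
    rewrite (_ : Num.sqrt (2 * u) = 1 + eta); last by rewrite addrC subrK.
    apply: le_trans (pow n); rewrite -natr1; lra.
  have n1 : 0 < n.+1%:R :> R by [].
  rewrite -(ler_pM2r n1); move: m2 un1; set x := u ^+ n => m2 un1.
  have : eta ^+ 2 * n.+1%:R * n.+1%:R <= (m%:R + 1) * x * n.+1%:R.
    by move: m2; rewrite exprMn; nra.
  have : x * n.+1%:R <= n.+1%:R by rewrite ler_piMl.
  nra.
apply: (squeeze_cvgr (nearW _ H)); first exact: cvg_cst.
by rewrite -[X in _ --> X](mulr0 (eta ^- 2)); apply: cvgM; [exact: cvg_cst|exact: cvg_harmonic].
Qed.

(** * Trigonometric approximation of indicators *)

Section Density.
Variables (R : realType) (d : nat) (w : d.-tuple R -> R).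
Local Notation mu := (torus_measure R d).
Hypothesis w0 : forall x, 0 <= w x.
Hypothesis Iw : mu.-integrable setT (EFin \o w).
Implicit Types (phi psi : d.-tuple R -> R).

Definition unit_valued phi := forall x, 0 <= phi x <= 1.

Lemma weighted_integrable psi (B : R) : measurable_fun setT psi ->
  (forall x, `|psi x| <= B) -> mu.-integrable setT (EFin \o (fun x => w x * psi x)).
Proof.
move=> mp pB; have bdd : [bounded psi x | x in setT].
  exists B; split; first exact: num_real.
  by move=> M BM x _ /=; rewrite (le_trans (pB x)) // ltW.
exact: (integrableMl measurableT Iw mp bdd).
Qed.

(* Bounded functions approximable by [[0, 1]]-valued trigonometric polynomials
   in [L^1(w dx)]. *)
Definition approximable psi : Prop :=
  [/\ measurable_fun setT psi, unit_valued psi & forall e : R, 0 < e ->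
    exists phi, [/\ is_trig phi, unit_valued phi &
      \int[mu]_x (w x * `|phi x - psi x|) < e]].

Lemma dist_integrable phi psi : measurable_fun setT phi -> measurable_fun setT psi ->
  unit_valued phi -> unit_valued psi ->
  mu.-integrable setT (EFin \o (fun x => w x * `|phi x - psi x|)).
Proof.
move=> mp ms up us; apply: (@weighted_integrable _ 1).
  by apply: measurableT_comp => //; apply: measurable_funB.
move=> x; rewrite normr_id ler_norml.
by have /andP[? ?] := up x; have /andP[? ?] := us x; apply/andP; split; lra.
Qed.

Lemma trig_approximable phi : is_trig phi -> unit_valued phi -> approximable phi.
Proof.
move=> tp up; split => //; first exact: is_trig_measurable.
move=> e e0; exists phi; split => //.
rewrite (@eq_Rintegral _ _ _ mu setT (fun=> 0)) ?Rintegral_cst ?mul0r //.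
by move=> x _; rewrite subrr normr0 mulr0.
Qed.

Lemma approximable_close psi :
  measurable_fun setT psi -> unit_valued psi ->
  (forall e : R, 0 < e -> exists phi, approximable phi /\
      \int[mu]_x (w x * `|phi x - psi x|) < e) -> approximable psi.
Proof.
move=> ms us H; split => // e e0.
have e20 : 0 < e / 2 by rewrite divr_gt0.
have [phi [[mp up Hp] dp]] := H _ e20.
have [chi [tc uc dc]] := Hp _ e20.
exists chi; split => //.
have mc := is_trig_measurable tc.
have I1 := dist_integrable mc mp uc up; have I2 := dist_integrable mp ms up us.
apply: (@le_lt_trans _ _ (\int[mu]_x (w x * `|chi x - phi x|) +
    \int[mu]_x (w x * `|phi x - psi x|))); last by rewrite [e]splitr ltrD.
rewrite -RintegralD //; apply: le_Rintegral => //.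
- exact: dist_integrable.
- exact: (integrableD measurableT I1 I2).
move=> x _; rewrite -mulrDr; apply: ler_wpM2l => //.
exact: ler_distD.
Qed.

Lemma approximable_lim (psi_ : nat -> d.-tuple R -> R) psi :
  (forall n, approximable (psi_ n)) -> measurable_fun setT psi -> unit_valued psi ->
  {ae mu, forall x, psi_ n x @[n --> \oo] --> psi x} -> approximable psi.
Proof.
move=> Hn ms us cv; apply: approximable_close => // e e0.
have mn n : measurable_fun setT (psi_ n) by have [] := Hn n.
have un n : unit_valued (psi_ n) by have [] := Hn n.
have [] := @dominated_convergence _ _ _ mu setT measurableT
  (fun n x => (w x * `|psi_ n x - psi x|)%:E) (fun=> 0%E) (EFin \o w).
- by move=> n; exact: measurable_int (dist_integrable (mn n) ms (un n) us).
- exact: measurable_cst.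
- apply: filterS cv => x cx _; apply: cvg_EFin; first by apply: nearW.
  rewrite -[X in _ --> X](mulr0 (w x)); apply: cvgM; first exact: cvg_cst.
  rewrite -(normr0 R) -(subrr (psi x)); apply: cvg_norm.
  by apply: cvgB => //; exact: cvg_cst.
- exact: Iw.
- apply: nearW => x n _; rewrite /= lee_fin normrM normr_id (ger0_norm (w0 x)).
  rewrite ler_piMr // ler_norml.
  by have /andP[? ?] := un n x; have /andP[? ?] := us x; apply/andP; split; lra.
move=> _ _; rewrite integral0 => /fine_cvg /= L.
have /cvgr_lt/(_ e e0) : \int[mu]_x (w x * `|psi_ n x - psi x|) @[n --> \oo] --> (0 : R) by exact: L.
move=> [N _ /(_ N (leqnn N))] H.
by exists (psi_ N).
Qed.

Lemma approximableC psi : approximable psi -> approximable (fun x => 1 - psi x).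
Proof.
move=> [mp up Hp]; split.
- by apply: measurable_funB => //; exact: measurable_cst.
- by move=> x; have /andP[? ?] := up x; apply/andP; split; lra.
move=> e e0; have [phi [tp uphi dp]] := Hp _ e0.
exists (fun x => 1 - phi x); split.
- by apply: is_trigB => //; exact: is_trig_cst.
- by move=> x; have /andP[? ?] := uphi x; apply/andP; split; lra.
apply: le_lt_trans dp; rewrite le_eqVlt; apply/orP; left; apply/eqP.
apply: eq_Rintegral => x _; congr (_ * _); rewrite distrC; congr `|_|; ring.
Qed.

Lemma approximableM phi psi : approximable phi -> approximable psi ->
  approximable (fun x => phi x * psi x).
Proof.
move=> [mp up Hp] [ms us Hs].
have uM f g : unit_valued f -> unit_valued g -> unit_valued (fun x => f x * g x).
  move=> uf ug x; have /andP[? ?] := uf x; have /andP[? ?] := ug x.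
  by rewrite mulr_ge0 //= mulr_ile1.
split; [exact: measurable_funM|exact: uM|].
move=> e e0; have e20 : 0 < e / 2 by rewrite divr_gt0.
have [f [tf uf df]] := Hp _ e20; have [g [tg ug dg]] := Hs _ e20.
exists (fun x => f x * g x); split; [exact: is_trigM|exact: uM|].
have mf := is_trig_measurable tf; have mg := is_trig_measurable tg.
have I1 := dist_integrable mf mp uf up; have I2 := dist_integrable mg ms ug us.
apply: (@le_lt_trans _ _ (\int[mu]_x (w x * `|f x - phi x|) +
    \int[mu]_x (w x * `|g x - psi x|))); last by rewrite [e]splitr ltrD.
rewrite -RintegralD //; apply: le_Rintegral => //.
- by apply: dist_integrable; [exact: measurable_funM|exact: measurable_funM|exact: uM|exact: uM].
- exact: (integrableD measurableT I1 I2).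
move=> x _; rewrite -mulrDr; apply: ler_wpM2l => //.
have -> : f x * g x - phi x * psi x = (f x - phi x) * g x + phi x * (g x - psi x) by ring.
apply: le_trans (ler_normD _ _) _; rewrite !normrM.
have /andP[g0 g1] := ug x; have /andP[p0 p1] := up x.
by rewrite (ger0_norm g0) (ger0_norm p0) lerD // ?ler_piMr // ler_piMl.
Qed.

Definition approximable_set (A : set (d.-tuple R)) : Prop :=
  measurable A /\ approximable (\1_A).

Lemma indic_unit_valued (A : set (d.-tuple R)) : unit_valued (\1_A).
Proof. by move=> x; rewrite indicE; case: (x \in A); rewrite /= ?lexx ler01. Qed.

Lemma approximable_set_lim (A : set (d.-tuple R)) (psi_ : nat -> d.-tuple R -> R) :
  measurable A -> (forall n, approximable (psi_ n)) ->
  {ae mu, forall x, psi_ n x @[n --> \oo] --> (\1_A x : R)} -> approximable_set A.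
Proof.
move=> mA H cv; split => //; apply: approximable_lim H _ _ cv.
  exact: measurable_indic.
exact: indic_unit_valued.
Qed.

(** A complement corresponds to [1 - phi], a finite union to a product of complements, and a
    countable union to a pointwise limit of those, under dominated convergence. *)
Lemma approximable_sets_sigma_algebra : sigma_algebra setT approximable_set.
Proof.
split.
- split => //; rewrite indic0; apply: trig_approximable; first exact: is_trig_cst.
  by move=> x; rewrite /= lexx ler01.
- move=> A [mA HA]; split; first exact: measurableD.
  have -> : \1_([set: d.-tuple R] `\` A) = (fun x => 1 - \1_A x) :> (_ -> R).
    apply/funext => x; rewrite !indicE setTD in_setC.
    by case: (x \in A); rewrite /= ?subrr ?subr0.
  exact: approximableC.
move=> A HA; apply: (@approximable_set_lim _ (fun n x => 1 - \prod_(k < n) (1 - \1_(A k) x))).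
- by apply: bigcupT_measurable => k; have [] := HA k.
- move=> n; apply: approximableC; elim: n => [|n IH].
    under eq_fun do rewrite big_ord0.
    apply: trig_approximable; first exact: is_trig_cst.
    by move=> x; rewrite /= lexx ler01.
  under eq_fun do rewrite big_ord_recr /=.
  by apply: approximableM => //; apply: approximableC; have [] := HA n.
apply: nearW => x; have [xA|xA] := pselect ((\bigcup_k A k) x).
  rewrite indicE mem_set //=; have [k _ Ak] := xA.
  apply: cvg_near_cst; exists k.+1 => // n /= kn.
  by rewrite (bigD1 (Ordinal kn)) //= indicE mem_set //= subrr mul0r subr0.
rewrite indicE memNset //=; apply: cvg_near_cst; apply: nearW => n.
rewrite big1 ?subrr // => k _; rewrite indicE memNset ?subr0 // => Ak.
by apply: xA; exists k.
Qed.

(** [u = 1/2 + g/4] maps [[-2, 2]] to [[0, 1]] and turns [g <= 0] into [u <= 1/2]; the polynomials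
    of [cvg_threshold] in [u] then converge pointwise to the indicator. *)
Lemma approximable_sublevel (g : d.-tuple R -> R) : is_trig g -> (forall x, `|g x| <= 2) ->
  approximable_set [set x | g x <= 0].
Proof.
move=> tg g2; pose u x := 2^-1 + 4^-1 * g x.
have tu : is_trig u.
  by apply: is_trigD; [exact: is_trig_cst|apply: is_trigM => //; exact: is_trig_cst].
have uu : unit_valued u.
  by move=> x; have := g2 x; rewrite ler_norml /u => /andP[? ?]; apply/andP; split; lra.
apply: (@approximable_set_lim _ (fun n x => (1 - u x ^+ n) ^+ (2 ^ n %/ n.+1)%N)).
- have -> : [set x | g x <= 0] = setT `&` g @^-1` `]-oo, 0]%classic.
    by rewrite setTI; apply/seteqP; split => x /=; rewrite in_itv.
  by apply: (is_trig_measurable tg) => //; exact: measurable_itv.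
- move=> n; apply: trig_approximable.
    by apply: is_trigX; apply: is_trigB; [exact: is_trig_cst|exact: is_trigX].
  move=> x; have /andP[u0 u1] := uu x.
  have h : 0 <= 1 - u x ^+ n <= 1 by rewrite subr_ge0 exprn_ile1 //= gerBl exprn_ge0.
  by have /andP[? ?] := h; rewrite exprn_ge0 //= exprn_ile1.
apply: nearW => x; have := cvg_threshold (uu x).
have -> : (u x <= 2^-1) = (x \in [set x | g x <= 0]).
  have -> : (u x <= 2^-1) = (g x <= 0) by rewrite /u gerDl pmulr_rle0.
  by apply/idP/idP => [h|/set_mem //]; apply/mem_set.
by rewrite indicE.
Qed.

End Density.

(** * Approximation of all measurable sets and duality *)

Section Duality.
Variables (R : realType) (d : nat).
Local Notation mu := (torus_measure R d).

Definition unit_cube : set (d.-tuple R) := [set x | forall i, 0 <= tnth x i < 1].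

Lemma unit_cubeE : unit_cube = [set x | forall i, (`[0%R, 1%R[%classic : set R) (tnth x i)].
Proof. by apply/seteqP; split => x /= H i; have := H i; rewrite in_itv. Qed.

Lemma measurable_unit_cube : measurable unit_cube.
Proof.
rewrite unit_cubeE; have -> : [set x : d.-tuple R | forall i, (`[0%R, 1%R[%classic : set R) (tnth x i)] =
   \bigcap_i ((fun x : d.-tuple R => tnth x i) @^-1` `[0%R, 1%R[%classic).
  by apply/seteqP; split => x /= H i; [move=> _|]; exact: H.
apply: fin_bigcap_measurable; first exact: finite_finset.
by move=> i _; rewrite -[X in measurable X]setTI; apply: measurable_tnth => //; exact: measurable_itv.
Qed.

Lemma torus_measure_unit_cubeC : mu (~` unit_cube) = 0%E.
Proof.
rewrite probability_setC; last exact: measurable_unit_cube.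
have E : mu unit_cube = 1%E.
  rewrite unit_cubeE.
  have := @torus_measure_box R d (fun=> `[0%R, 1%R[%classic) (fun i => measurable_itv _).
  rewrite big1 => [H|i _]; first exact: H.
  by rewrite setIid lebesgue_measure_itv /= lte_fin ltr01 -EFinB subr0.
by rewrite [X in (1 - X)%E]E subee.
Qed.

Variable w : d.-tuple R -> R.
Hypothesis w0 : forall x, 0 <= w x.
Hypothesis Iw : mu.-integrable setT (EFin \o w).

(** Points off the unit cube form a null set, so half-spaces, which are not periodic, may be
    compared inside the cube with periodic sets. *)
Lemma approximable_set_ae (A B : set (d.-tuple R)) : approximable_set w A -> measurable B ->
  (forall x, (forall i, 0 <= tnth x i < 1) -> A x <-> B x) -> approximable_set w B.
Proof.
move=> [mA HA] mB AB; apply: (@approximable_set_lim _ _ _ w0 Iw _ (fun=> \1_A)) => //.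
exists (~` unit_cube); split.
- exact: measurableC measurable_unit_cube.
- exact: torus_measure_unit_cubeC.
move=> x /= nc cx; apply: nc.
have -> : \1_B x = \1_A x :> R.
  rewrite !indicE; have -> // : (x \in B) = (x \in A).
  by apply/idP/idP => /set_mem h; apply/mem_set; apply/(AB x cx).
exact: cvg_cst.
Qed.

Lemma cos_2pi_le (x a : R) : 0 <= x <= 2^-1 -> 0 <= a <= 2^-1 ->
  (cos (2 * pi * a) <= cos (2 * pi * x)) = (x <= a).
Proof.
have p0 := pi_gt0 R.
have H (t : R) : 0 <= t <= 2^-1 -> 2 * pi * t \in `[0, pi].
  move=> /andP[t0 t1]; rewrite in_itv /=; apply/andP; split; first by rewrite !mulr_ge0 // ltW.
  nra.
move=> hx ha; rewrite !leNgt (ltr_cos (H _ ha) (H _ hx)).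
by rewrite ltr_pM2l // mulr_gt0.
Qed.

Lemma sin_2pi_ge0 (x : R) : 0 <= x < 1 -> (0 <= sin (2 * pi * x)) = (x <= 2^-1).
Proof.
have p0 := pi_gt0 R; move=> /andP[x0 x1]; have [h|h] := leP x 2^-1.
  apply: sin_ge0_pi; apply/andP; split; first by rewrite !mulr_ge0 // ltW.
  nra.
apply/negbTE; rewrite -ltNge.
have -> : sin (2 * pi * x) = - sin (2 * pi * x - pi).
  by rewrite sinB sinpi cospi mulr0 subr0 mulrN1 opprK.
rewrite oppr_lt0; apply: sin_gt0_pi; apply/andP; split; nra.
Qed.

(** On [[0, 1)] the sign of [sin (2 pi x)] tells on which side of [1/2] the point lies, and on each
    side [cos (2 pi x)] is monotone, so the half-space is a Boolean combination of sublevel sets of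
    polynomials. *)
Lemma approximable_coord_le (i : 'I_d) (a : R) : approximable_set w [set x | tnth x i <= a].
Proof.
have mB : measurable [set x : d.-tuple R | tnth x i <= a].
  have -> : [set x : d.-tuple R | tnth x i <= a] = setT `&` (fun x => tnth x i) @^-1` `]-oo, a]%classic.
    by rewrite setTI; apply/seteqP; split => x /=; rewrite in_itv.
  by apply: measurable_tnth => //; exact: measurable_itv.
have [S0 SC SU] := approximable_sets_sigma_algebra w0 Iw.
have [tc ts] := is_trig_cos_coord R i.
have SsinP : approximable_set w [set x | - sin (2 * pi * tnth x i) <= 0].
  apply: approximable_sublevel => //.
    by under eq_fun do rewrite -mulN1r; apply: is_trigM => //; exact: is_trig_cst.
  by move=> x; rewrite normrN (le_trans (sin_max _)) // ler1n.
have cosb (t x : R) : -1 <= t <= 1 -> `|cos x - t| <= 2.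
  move=> /andP[t0 t1]; have := cos_le1 x; have := cos_geN1 x => c0 c1.
  by rewrite ler_norml; apply/andP; split; lra.
pose ca := cos (2 * pi * a).
have cab : -1 <= ca <= 1 by rewrite cos_geN1 cos_le1.
have Scos1 : approximable_set w [set x | cos (2 * pi * tnth x i) - ca <= 0].
  apply: approximable_sublevel => //; last by move=> x; exact: cosb.
  by apply: is_trigB => //; exact: is_trig_cst.
have Scos2 : approximable_set w [set x | ca - cos (2 * pi * tnth x i) <= 0].
  apply: approximable_sublevel => //; last by move=> x; rewrite distrC; exact: cosb.
  by apply: is_trigB => //; exact: is_trig_cst.
have [a0|a0] := ltP a 0.
  apply: approximable_set_ae S0 mB _ => x cx; split => // xa.
  by have /andP[x0 _] := cx i; move: (le_lt_trans (le_trans x0 xa) a0); rewrite ltxx.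
have [a1|a1] := leP 1 a.
  apply: (approximable_set_ae (SC _ S0)) mB _ => x cx; split => _; last by split.
  by have /andP[_ x1] := cx i; rewrite /= (le_trans (ltW x1)).
have SI A B : approximable_set w A -> approximable_set w B -> approximable_set w (A `&` B).
  move=> [mA HA] [mB' HB]; split; first exact: measurableI.
  by rewrite indicI; exact: approximableM.
have SUn A B : approximable_set w A -> approximable_set w B -> approximable_set w (A `|` B).
  move=> HA HB; rewrite -[_ `|` _]setCK setCU -setTD; apply: (SC).
  by apply: SI; rewrite -setTD; exact: SC.
have [ah|ah] := leP a 2^-1.
  apply: (approximable_set_ae (SI _ _ SsinP Scos2) mB) => x cx.
  have hx := cx i; have /andP[x0 x1] := hx; rewrite /= oppr_le0 subr_le0 sin_2pi_ge0 //.
  split => [[xh]|xa].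
    by rewrite cos_2pi_le ?x0 ?a0.
  have xh := le_trans xa ah; split => //.
  by rewrite cos_2pi_le ?x0 ?a0.
apply: (approximable_set_ae (SUn _ _ SsinP Scos1) mB) => x cx.
have hx := cx i; have /andP[x0 x1] := hx; rewrite /= oppr_le0 subr_le0 sin_2pi_ge0 //.
have C (y : R) : cos (2 * pi * (1 - y)) = cos (2 * pi * y).
  have -> : 2 * pi * (1 - y) = - (2 * pi * y) + pi *+ 2 by rewrite mulr2n; ring.
  by rewrite cosD2pi cosN.
have [xh|xh] := leP (tnth x i) 2^-1.
  by split => // _; [rewrite (le_trans xh) // ltW|left].
rewrite /ca -C -[X in _ <= X]C cos_2pi_le; first last.
- by apply/andP; split; lra.
- by apply/andP; split; lra.
by split => [[//|]|]; [lra|right; lra].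
Qed.

(** The product sigma-algebra is generated by the coordinates, and the Borel sets of the line by
    half-lines. *)
Lemma measurable_approximable (A : set (d.-tuple R)) : measurable A -> approximable_set w A.
Proof.
have SA := approximable_sets_sigma_algebra w0 Iw.
have [S0 SC SU] := SA.
have coord (i : 'I_d) (B : set R) : measurable B ->
    approximable_set w ((fun x => tnth x i) @^-1` B).
  move=> mB; suff : [set B : set R | approximable_set w ((fun x => tnth x i) @^-1` B)] B by [].
  move: B mB; have -> : (measurable : set (set R)) = <<s @RGenOInfty.G R >>.
    exact: (RGenOInfty.measurableE R).
  apply: smallest_sub; first split.
  - by rewrite /= preimage_set0.
  - by move=> B HB; rewrite /= setTD preimage_setC -setTD; exact: SC.
  - by move=> B HB; rewrite /= preimage_bigcup; exact: SU.
  move=> _ [a ->] /=.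
  have -> : (fun x : d.-tuple R => tnth x i) @^-1` `]a, +oo[%classic =
      setT `\` [set x | tnth x i <= a].
    apply/seteqP; split => x /=; rewrite in_itv /= andbT.
      by move=> ax; split => //; apply/negP; rewrite -ltNge.
    by move=> [_ /negP]; rewrite -ltNge.
  by apply: (SC); exact: approximable_coord_le.
move: A; apply: smallest_sub => //.
apply: (big_ind (fun S : set (set (d.-tuple R)) => S `<=` approximable_set w)) => //.
  by move=> S T HS HT A [/HS|/HT].
by move=> i _ A [B mB <-]; rewrite setTI; exact: coord.
Qed.

End Duality.

(* Test against [2 phi - 1], where [phi] approximates the indicator of [f >= 0]. *)
Lemma L1_norm_le_trig (R : realType) (d : nat) (f : d.-tuple R -> R) (C : R) :
  (torus_measure R d).-integrable setT (EFin \o f) ->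
  (forall s, (forall x, normc (trig s x) <= 1) ->
     normc (complex_integral (fun x => (f x)%:C * trig s x)) <= C) ->
  \int[torus_measure R d]_x `|f x| <= C.
Proof.
set mu := torus_measure R d; pose w x := `|f x|; move=> If H.
have w0 x : 0 <= w x := normr_ge0 _.
have Iw : mu.-integrable setT (EFin \o w) by exact: integrable_norm.
apply/ler_addgt0Pr => e e0.
pose A := [set x | 0 <= f x].
have mf : measurable_fun setT f by apply/measurable_EFinP; exact: measurable_int If.
have mA : measurable A.
  have -> : A = setT `&` f @^-1` `[0, +oo[%classic.
    by rewrite setTI; apply/seteqP; split => x /=; rewrite in_itv /= andbT.
  by apply: mf => //; exact: measurable_itv.
have [_ [m1 u1 HA]] := measurable_approximable w0 Iw mA.
have e20 : 0 < e / 2 by rewrite divr_gt0.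
have [phi [tp up dp]] := HA _ e20.
have mphi := is_trig_measurable tp.
pose g x := 2 * phi x - 1.
have tg : is_trig g.
  by apply: is_trigB; [apply: is_trigM => //|]; exact: is_trig_cst.
have g1 x : `|g x| <= 1.
  by have /andP[? ?] := up x; rewrite ler_norml /g; apply/andP; split; lra.
have [s sE] := tg.
have mg := is_trig_measurable tg.
have Ifg : mu.-integrable setT (EFin \o (fun x => f x * g x)).
  have bdd : [bounded g x | x in setT].
    exists 1; split; first exact: num_real.
    by move=> M BM x _ /=; rewrite (le_trans (g1 x)) // ltW.
  exact: (integrableMl measurableT If mg bdd).
have fg : \int[mu]_x (f x * g x) <= C.
  have := H s _; have -> : complex_integral (fun x => (f x)%:C * trig s x) =
      (\int[mu]_x (f x * g x))%:C.
    apply/eqP; rewrite eq_complex /=; apply/andP; split; apply/eqP.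
      by apply: eq_Rintegral => x _; rewrite sE -rmorphM.
    rewrite (@eq_Rintegral _ _ _ mu setT (fun=> 0)) ?Rintegral_cst ?mul0r //.
    by move=> x _; rewrite sE -rmorphM.
  rewrite normcC => h; apply: le_trans (ler_norm _) (h _) => x.
  by rewrite sE normcC.
have Id := dist_integrable Iw mphi m1 up u1.
apply: (@le_trans _ _ (\int[mu]_x (f x * g x) + 2 * \int[mu]_x (w x * `|phi x - \1_A x|))).
  have I2 : mu.-integrable setT (EFin \o (fun x => 2 * (w x * `|phi x - \1_A x|))).
    exact: (integrableZl measurableT 2 Id).
  rewrite -RintegralZl // -RintegralD //; apply: le_Rintegral => //.
    exact: (integrableD measurableT Ifg I2).
  move=> x _; rewrite /w indicE /g; have /andP[p0 p1] := up x.
  have [fx|fx] := leP 0 (f x).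
    rewrite mem_set //= (ger0_norm fx) ler0_norm; last by lra.
    by nra.
  rewrite memNset /=; last by rewrite /A /=; apply/negP; rewrite -ltNge.
  by rewrite (ltr0_norm fx) subr0 ger0_norm //; nra.
rewrite lerD //; lra.
Qed.

(** * Kernels and operators *)

(** Completeness of L^1 for absolutely convergent series: the sum [G] of the absolute values is
    integrable, hence finite almost everywhere, and dominates all partial sums. *)
Lemma L1_series_cvg (dd : measure_display) (T : measurableType dd) (R : realType)
    (mu : {measure set T -> \bar R}) (q : nat -> T -> R) (S : R) :
  (forall j, mu.-integrable setT (EFin \o q j)) ->
  (forall n, \sum_(j < n) \int[mu]_x `|q j x| <= S) ->
  exists f : T -> R, mu.-integrable setT (EFin \o f) /\
    \int[mu]_x `|\sum_(j < n) q j x - f x| @[n --> \oo] --> (0 : R).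
Proof.
move=> Iq qS.
have mq j : measurable_fun setT (q j) by apply/measurable_EFinP; exact: measurable_int (Iq j).
have mnq j : measurable_fun setT (fun x => `|q j x|%:E).
  by apply/measurable_EFinP; exact: measurableT_comp.
pose G x : \bar R := (\sum_(j <oo) `|q j x|%:E)%E.
have G0 x : (0 <= G x)%E by apply: nneseries_ge0 => j _ _; rewrite lee_fin.
have IG : (\int[mu]_x G x <= S%:E)%E.
  rewrite integral_nneseries //.
  apply: lime_le; first by apply: is_cvg_nneseries => j _ _; apply: integral_ge0 => x _; rewrite lee_fin.
  apply: nearW => n; rewrite big_mkord.
  have E j : (\int[mu]_x `|q j x|%:E = (\int[mu]_x `|q j x|)%:E)%E.
    by rewrite /Rintegral fineK // integrable_fin_num //; exact: integrable_norm (Iq j).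
  by under eq_bigr do rewrite E; rewrite sumEFin lee_fin.
have mG : measurable_fun setT G.
  by apply: ge0_emeasurable_sum => // n x _; rewrite lee_fin.
have intG : mu.-integrable setT G.
  apply/integrableP; split => //; under eq_integral do rewrite gee0_abs //.
  by rewrite (le_lt_trans IG) // ltry.
have mA : measurable [set x | G x < +oo]%E.
  have -> : [set x | (G x < +oo)%E] = setT `&` [set x | (G x < +oo)%E] by rewrite setTI.
  exact: emeasurable_fun_infty_o.
pose A : set T := [set x | (G x < +oo)%E].
have aeA : {ae mu, forall x, A x}.
  by apply: filterS (integrable_ae measurableT intG) => x h; rewrite /A /= ltey_eq h.
(* Cutting off to the set where [G] is finite makes the partial sums converge everywhere, so that
   the limit is measurable. *)
pose p n x : R := \sum_(j < n) q j x * \1_A x.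
have mp n : measurable_fun setT (p n).
  apply: measurable_sum => j; apply: measurable_funM => //; exact: measurable_indic.
have pE n x : A x -> p n x = \sum_(j < n) q j x.
  by move=> Ax; apply: eq_bigr => j _; rewrite indicE mem_set //= mulr1.
have p0 n x : ~ A x -> p n x = 0.
  by move=> Ax; rewrite /p big1 // => j _; rewrite indicE memNset //= mulr0.
have pG n x : (`|(p n x)%:E| <= G x)%E.
  have [Ax|Ax] := pselect (A x); last by rewrite p0 // abse0.
  rewrite pE //; apply: le_trans (_ : (\sum_(0 <= j < n) `|q j x|%:E <= _)%E).
    by rewrite big_mkord sumEFin lee_fin ler_norm_sum.
  by apply: nneseries_lim_ge => j _ _; rewrite lee_fin.
have cvp x : cvgn (fun n => p n x).
  have [Ax|Ax] := pselect (A x); last first.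
    have -> : (fun n => p n x) = (fun=> 0) by apply/funext => n; rewrite p0.
    exact: is_cvg_cst.
  have -> : (fun n => p n x) = series (fun j => q j x).
    by apply/funext => n; rewrite pE // seriesEord.
  apply: normed_cvg; change (cvgn (fun n => \sum_(0 <= k < n) `|q k x|)).
  have Gf : G x \is a fin_num by rewrite ge0_fin_numE.
  apply: nondecreasing_is_cvgn.
    by apply: nondecreasing_series => j _ _.
  exists (fine (G x)) => _ [n _ <-]; rewrite -lee_fin fineK // -sumEFin.
  by apply: nneseries_lim_ge => j _ _; rewrite lee_fin.
pose f x : R := limn (fun n => p n x).
have mf : measurable_fun setT f by apply: (@measurable_fun_cvg _ _ _ setT p) => // x _; exact: cvp.
have [] := @dominated_convergence _ _ _ mu setT measurableT (fun n => EFin \o p n) (EFin \o f) G.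
- by move=> n; apply/measurable_EFinP.
- exact/measurable_EFinP.
- by apply: nearW => x _; apply: cvg_EFin; [exact: nearW|exact: cvp].
- exact: intG.
- by apply: nearW => x n _; exact: pG.
move=> If /fine_cvg /= L _; exists f; split => //.
apply: cvg_trans L; apply: near_eq_cvg; apply: nearW => n; rewrite /Rintegral; congr fine.
apply: ae_eq_integral => //.
- apply/measurable_EFinP; apply: measurableT_comp => //; exact: measurable_funB.
- apply/measurable_EFinP; apply: measurableT_comp => //; apply: measurable_funB => //.
  exact: measurable_sum.
by apply: filterS aeA => x Ax _ /=; rewrite pE.
Qed.

(** * L^1 norms of kernels with even symbols *)

Section KernelNorm.
Variables (R : realType) (d : nat).
Local Notation mu := (torus_measure R d).
Implicit Types (K : d.-tuple R -> R[i]) (a : frequency d -> R).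

Lemma complex_integrable_conj K : complex_integrable K -> complex_integrable (fun x => conjc (K x)).
Proof.
move=> [Ir Ii]; split.
  by apply: eq_integrable Ir => // x _; case: (K x).
by apply: eq_integrable (integrableN Ii) => // x _ /=; case: (K x) => u v /=; rewrite ?EFinN.
Qed.

Lemma complex_integral_conj K : complex_integrable K ->
  complex_integral (fun x => conjc (K x)) = conjc (complex_integral K).
Proof.
move=> [Ir Ii]; rewrite /complex_integral; apply/eqP; rewrite eq_complex /=.
apply/andP; split; apply/eqP; first by apply: eq_Rintegral => x _; case: (K x).
rewrite -mulN1r -RintegralZl //; apply: eq_Rintegral => x _; case: (K x) => u v /=.
by rewrite mulN1r.
Qed.

Lemma fourier_coefficient_conj K k : complex_integrable K ->
  fourier_coefficient (fun x => conjc (K x)) k = conjc (fourier_coefficient K (freq_opp k)).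
Proof.
move=> IK; rewrite !fourier_coefficientE freq_oppK -complex_integral_conj; last first.
  exact: complex_integrable_mul_mode.
congr complex_integral; apply/funext => x.
by rewrite rmorphM /= fourier_mode_freq_opp.
Qed.

Lemma fourier_coefficientD K K' k : complex_integrable K -> complex_integrable K' ->
  fourier_coefficient (fun x => K x + K' x) k =
  fourier_coefficient K k + fourier_coefficient K' k.
Proof.
move=> IK IK'; rewrite !fourier_coefficientE -complex_integralD; try exact: complex_integrable_mul_mode.
by congr complex_integral; apply/funext => x; rewrite mulrDl.
Qed.

Lemma fourier_coefficientZ (c : R[i]) K k : complex_integrable K ->
  fourier_coefficient (fun x => c * K x) k = c * fourier_coefficient K k.
Proof.
move=> IK; rewrite !fourier_coefficientE -complex_integralZ; last exact: complex_integrable_mul_mode.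
by congr complex_integral; apply/funext => x; rewrite mulrA.
Qed.

(** Since [a] is even, the integral of [f] against a polynomial is the multiplier applied to that
    polynomial, evaluated at the origin. *)
Lemma real_kernel_L1_le (f : d.-tuple R -> R) a C :
  mu.-integrable setT (EFin \o f) -> (forall k, a (freq_opp k) = a k) ->
  (forall k, fourier_coefficient (fun x => (f x)%:C) k = (a k)%:C) -> mult a C ->
  \int[mu]_x `|f x| <= C.
Proof.
move=> If aev fa aC; apply: L1_norm_le_trig => // s s1.
have IC : complex_integrable (fun x => (f x)%:C) by split => //; exact: integrable0.
rewrite complex_integral_mul_trig //.
have := aC s 1 s1 [tuple 0 | j < d]; rewrite mulr1 trig_act; apply: le_trans.
rewrite le_eqVlt; apply/orP; left; apply/eqP; congr normc; apply: eq_bigr => t _.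
by rewrite fa aev fourier_mode0 mulr1 mulrC.
Qed.

(** A real even symbol gives [K] and its conjugate the same coefficients. *)
Lemma kernel_parts K a : complex_integrable K -> (forall k, a (freq_opp k) = a k) ->
  (forall k, fourier_coefficient K k = (a k)%:C) ->
  (forall k, fourier_coefficient (fun x => (complex.Re (K x))%:C) k = (a k)%:C) /\
  (forall k, fourier_coefficient (fun x => (complex.Im (K x))%:C) k = 0).
Proof.
move=> IK aev Ka; have IK' := complex_integrable_conj IK.
have coefc k : fourier_coefficient (fun x => conjc (K x)) k = (a k)%:C.
  by rewrite fourier_coefficient_conj // Ka aev conjc_real.
split=> k.
  have -> : (fun x => (complex.Re (K x))%:C) = (fun x => (2^-1)%:C * (K x + conjc (K x))).
    apply/funext => x; case: (K x) => u v; apply/eqP; rewrite eq_complex /=.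
    by apply/andP; split; apply/eqP; field.
  rewrite fourier_coefficientZ; last exact: complex_integrableD.
  rewrite fourier_coefficientD // Ka coefc -!rmorphD -rmorphM /=; by congr _%:C; field.
have -> : (fun x => (complex.Im (K x))%:C) = (fun x => (0 -i* 2^-1) * (K x + (- 1) * conjc (K x))).
  apply/funext => x; case: (K x) => u v; apply/eqP; rewrite eq_complex /=.
  by apply/andP; split; apply/eqP; field.
rewrite fourier_coefficientZ; last by apply: complex_integrableD => //; exact: complex_integrableZ.
rewrite fourier_coefficientD ?fourier_coefficientZ //; last exact: complex_integrableZ.
by rewrite Ka coefc mulN1r subrr mulr0.
Qed.

(** The imaginary part has zero coefficients, so duality with the symbol 0 makes its L^1 norm
    vanish, and no constant is lost in passing to complex kernels. *)
Lemma kernel_L1_le K a C : complex_integrable K -> (forall k, a (freq_opp k) = a k) ->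
  (forall k, fourier_coefficient K k = (a k)%:C) -> mult a C ->
  \int[mu]_x normc (K x) <= C.
Proof.
move=> IK aev Ka aC; have [Ir Ii] := IK; have [Kr Ki] := kernel_parts IK aev Ka.
have r1 := real_kernel_L1_le Ir aev Kr aC.
have i1 : \int[mu]_x `|complex.Im (K x)| <= 0.
  apply: (@real_kernel_L1_le _ (fun=> 0)) => //.
  by have := mult_cst (d := d) (0 : R); rewrite normr0.
have Ir' : mu.-integrable setT (EFin \o (fun x => `|complex.Re (K x)|)) by exact: integrable_norm Ir.
have Ii' : mu.-integrable setT (EFin \o (fun x => `|complex.Im (K x)|)) by exact: integrable_norm Ii.
apply: (@le_trans _ _ (\int[mu]_x (`|complex.Re (K x)| + `|complex.Im (K x)|))).
  apply: le_Rintegral => //.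
  - exact: complex_integrable_normc.
  - exact: (integrableD measurableT Ir' Ii').
  by move=> x _; exact: normc_le_ReIm.
by rewrite RintegralD // -[leRHS]addr0 lerD.
Qed.

End KernelNorm.

(** * Kernels as L^1 sums of polynomial blocks *)

Section FrequencyBox.
Variables (R : realType) (d : nat).
Implicit Types (k : frequency d) (a : frequency d -> R).

Definition freq_box N : seq (frequency d) :=
  finmap.enum_fset (fset_set (low_frequencies d N)).

Lemma mem_freq_box N k : (k \in freq_box N) = (max_norm k <= N)%N.
Proof.
have /(_ k) E := in_fset_set (finite_low_frequencies d N).
transitivity (k \in low_frequencies d N); first exact: E.
by apply/idP/idP => [|h]; rewrite inE.
Qed.

Lemma freq_box_uniq N : uniq (freq_box N).
Proof. exact: finmap.fset_uniq. Qed.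

Lemma max_norm_opp k : max_norm (freq_opp k) = max_norm k.
Proof. by apply: eq_bigr => j _; rewrite tnth_mktuple abszN. Qed.

Lemma freq_box_opp N : perm_eq [seq freq_opp k | k <- freq_box N] (freq_box N).
Proof.
apply: uniq_perm; rewrite ?freq_box_uniq ?map_inj_uniq ?freq_box_uniq //.
  exact: inv_inj (@freq_oppK d).
move=> k; rewrite mem_freq_box -max_norm_opp -mem_freq_box.
by apply/mapP/idP => [[h hb ->]|kb]; [rewrite freq_oppK|exists (freq_opp k); rewrite ?freq_oppK].
Qed.

Definition symbol_poly a N : seq (R[i] * frequency d) := [seq ((a k)%:C, k) | k <- freq_box N].

Lemma trig_symbol_poly a N x : trig (symbol_poly a N) x =
  \sum_(k <- freq_box N) (a k)%:C * fourier_mode k x.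
Proof. by rewrite /trig big_map. Qed.

Lemma fourier_coefficient_symbol_poly a N k :
  fourier_coefficient (trig (symbol_poly a N)) k = (a k * (max_norm k <= N)%N%:R)%:C.
Proof.
rewrite fourier_coefficient_trig big_map /= -big_filter.
have [kN|kN] := boolP (max_norm k <= N)%N; last first.
  rewrite mulr0 big1_seq // => h; rewrite mem_filter /= => /andP [/eqP -> ].
  by rewrite mem_freq_box (negbTE kN).
rewrite mulr1 big_filter big_mkcond (bigD1_seq k) ?freq_box_uniq ?mem_freq_box //=.
by rewrite eqxx big1 ?addr0 // => h /negbTE ->.
Qed.
End FrequencyBox.

Section KernelExistence.
Variables (R : realType) (d : nat).
Local Notation mu := (torus_measure R d).
Implicit Types (k : frequency d) (a : frequency d -> R).

Lemma complex_integrable_real (f : d.-tuple R -> R) :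
  mu.-integrable setT (EFin \o f) -> complex_integrable (fun x => (f x)%:C).
Proof. by move=> If; split => //; exact: integrable0. Qed.

Lemma normc_fourier_coefficient_le (f : d.-tuple R -> R) k :
  mu.-integrable setT (EFin \o f) ->
  normc (fourier_coefficient (fun x => (f x)%:C) k) <= \int[mu]_x `|f x|.
Proof.
move=> If; rewrite fourier_coefficientE.
apply: le_trans (normc_complex_integral_le _) _.
  exact/complex_integrable_mul_mode/complex_integrable_real.
rewrite le_eqVlt; apply/orP; left; apply/eqP; apply: eq_Rintegral => x _.
by rewrite Normc.normcM normc_fourier_mode mulr1 normcC.
Qed.

Lemma symbol_poly_L1_le a (N : nat) (C : R) : (forall k, a (freq_opp k) = a k) ->
  (forall k, (N < max_norm k)%N -> a k = 0) -> mult a C ->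
  \int[mu]_x `|complex.Re (trig (symbol_poly a N) x)| <= C /\
  forall k, fourier_coefficient (fun x => (complex.Re (trig (symbol_poly a N) x))%:C) k = (a k)%:C.
Proof.
move=> aev aN aC.
have I := @complex_integrable_trig R d (symbol_poly a N).
have co k : fourier_coefficient (trig (symbol_poly a N)) k = (a k)%:C.
  rewrite fourier_coefficient_symbol_poly leqNgt.
  by have [/aN ->|] := boolP (N < max_norm k)%N; rewrite ?mulr1 ?mul0r.
have [Kr _] := kernel_parts I aev co; split => //.
by apply: (@real_kernel_L1_le _ _ _ a) => //; case: I.
Qed.

(* The kernel is the L^1-convergent sum of those of the blocks [h j - h j.+1]. *)
Lemma kernel_of_multipliers (h : nat -> frequency d -> R) (M : nat -> nat) (E : nat -> R) (S : R) :
  (forall j k, h j (freq_opp k) = h j k) -> (forall j, mult (h j) (E j)) ->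
  (forall j k, (M j < max_norm k)%N -> h j k = h j.+1 k) ->
  (forall k, exists n0, forall n, (n0 <= n)%N -> h n k = 0) ->
  (forall n, \sum_(j < n) E j <= S) ->
  exists K : d.-tuple R -> R[i], complex_integrable K /\
    forall k, fourier_coefficient K k = (h 0%N k)%:C.
Proof.
move=> hev hE hM h0 ES.
pose a j k := h j k - h j.+1 k.
have aev j k : a j (freq_opp k) = a j k by rewrite /a !hev.
have aM j k : (M j < max_norm k)%N -> a j k = 0 by move=> /hM; rewrite /a => ->; rewrite subrr.
pose q j x : R := complex.Re (trig (symbol_poly (a j) (M j)) x).
have Iq j : mu.-integrable setT (EFin \o q j) by have [] := @complex_integrable_trig R d (symbol_poly (a j) (M j)).
have [qE qa] : (forall j, \int[mu]_x `|q j x| <= E j + E j.+1) /\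
    forall j k, fourier_coefficient (fun x => (q j x)%:C) k = (a j k)%:C.
  by split => j; have [] := symbol_poly_L1_le (aev j) (@aM j) (multB (hE j) (hE j.+1)).
have qS n : \sum_(j < n) \int[mu]_x `|q j x| <= S + S.
  apply: (@le_trans _ _ (\sum_(j < n) (E j + E j.+1))); first by apply: ler_sum => j _.
  rewrite big_split /= lerD //; first exact: ES.
  apply: le_trans (ES n.+1).
  by rewrite big_ord_recl lerDr (mult_ge0 (hE 0%N)).
have [f [If L]] := L1_series_cvg Iq qS.
exists (fun x => (f x)%:C); split; first exact: complex_integrable_real.
move=> k.
pose P n x : R := \sum_(j < n) q j x.
have IP n : mu.-integrable setT (EFin \o P n).
  have -> : EFin \o P n = (fun x => \sum_(j < n) (q j x)%:E)%E.
    by apply/funext => x; rewrite /= sumEFin.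
  exact: (@integrable_sum _ _ _ mu _ measurableT _ (index_enum 'I_n) xpredT (fun j x => (q j x)%:E) (fun j _ => Iq j)).
have Pa n : fourier_coefficient (fun x => (P n x)%:C) k = (h 0%N k - h n k)%:C.
  rewrite -(sum_ord_telescope (fun j => h j k)) rmorph_sum /=.
  have -> : (fun x => (P n x)%:C) = (fun x => \sum_(j < n) (q j x)%:C).
    by apply/funext => x; rewrite rmorph_sum.
  rewrite fourier_coefficientE; under eq_fun do rewrite mulr_suml.
  rewrite complex_integral_sum => [|j]; last exact/complex_integrable_mul_mode/complex_integrable_real.
  by apply: eq_bigr => j _; rewrite -fourier_coefficientE qa.
have [n0 hn0] := h0 k.
have B n : (n0 <= n)%N ->
    normc ((h 0%N k)%:C - fourier_coefficient (fun x => (f x)%:C) k) <=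
    \int[mu]_x `|\sum_(j < n) q j x - f x|.
  move=> n0n; have := Pa n; rewrite (hn0 n) // subr0 => <-.
  have IB : mu.-integrable setT (EFin \o (fun x => P n x - f x)) by exact: (integrableB measurableT (IP n) If).
  apply: le_trans (normc_fourier_coefficient_le k IB).
  rewrite -mulN1r -fourier_coefficientZ; last exact: complex_integrable_real.
  rewrite -fourier_coefficientD; last 2 first.
  - exact: complex_integrable_real.
  - exact/complex_integrableZ/complex_integrable_real.
  suff -> : (fun x => (P n x)%:C + (-1) * (f x)%:C) = (fun x => (P n x - f x)%:C) by [].
  by apply/funext => x; rewrite mulN1r [RHS]rmorphB.
have : normc ((h 0%N k)%:C - fourier_coefficient (fun x => (f x)%:C) k) <= 0.
  rewrite -(cvg_lim _ L) //; apply: limr_ge; first exact: cvgP L.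
  by exists n0 => // n /= /B.
move=> n_le0; apply/esym/eqP; rewrite -subr_eq0; apply/eqP/Normc.eq0_normc.
by apply/eqP; rewrite eq_le n_le0 normc_ge0.
Qed.

End KernelExistence.

(** * Existence and size of the high-frequency kernel *)

Section HighKernel.
Variables (R : realType) (d : nat).
Local Notation mu := (torus_measure R d).
Implicit Types (k : frequency d).

(** One term of the exponential series at [ln y]; it absorbs the logarithms when the blocks are
    summed. *)
Lemma ln_exp_le_factM (y : R) : 1 <= y -> ln y ^+ d <= d`!%:R * y.
Proof.
move=> y1; have y0 : 0 < y by lra.
case: d => [|n]; first by rewrite expr0 fact0 mul1r.
have := expR_ge1Dxn n (ln_ge0 y1); rewrite lnK ?posrE // => h.
have f0 : 0 < (n.+1)`!%:R :> R by rewrite ltr0n fact_gt0.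
rewrite mulrC -ler_pdivrMr //; lra.
Qed.

Lemma le_ln_harm (n : nat) : ln n.+1%:R <= harm R n.
Proof.
elim: n => [|n IHn]; first by rewrite ln1 /harm big_ord0.
rewrite /harm big_ord_recr /= -/(harm R n).
have p : 0 < n.+1%:R^-1 :> R by rewrite invr_gt0.
have -> : n.+2%:R = n.+1%:R * (1 + n.+1%:R^-1) :> R.
  by rewrite mulrDr mulr1 divff // [in LHS]mulrSr.
rewrite lnM ?posrE ?addr_gt0 //.
by rewrite lerD // le_ln1Dx // (lt_trans _ p) // ltrN10.
Qed.

Lemma ln_add2_le_harm (n : nat) : (0 < n)%N -> ln (n%:R + 2) <= 2 * harm R n.
Proof.
move=> n0; apply: le_trans (_ : 2 * ln n.+1%:R <= _); last by rewrite ler_pM2l // le_ln_harm.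
have n1 : 1 <= n%:R :> R by rewrite ler1n.
rewrite [2 * _]mulrC mulr_natr -lnXn ?ltr0n // ler_ln ?posrE ?exprn_gt0 ?ltr0n //.
by rewrite -[n.+1%:R]natr1; nra.
Qed.

Lemma laplace_symbol_opp k : laplace_symbol R (freq_opp k) = laplace_symbol R k.
Proof. by apply: eq_bigr => j _; rewrite tnth_mktuple rmorphN /= mulrN sqrrN. Qed.

Lemma resolvent_symbol_opp (beta : R) k : resolvent_symbol beta (freq_opp k) = resolvent_symbol beta k.
Proof. by rewrite !resolvent_symbolE laplace_symbol_opp. Qed.

Lemma high_symbol_opp (beta : R) N k : high_symbol beta N (freq_opp k) = high_symbol beta N k.
Proof. by rewrite /high_symbol max_norm_opp resolvent_symbol_opp. Qed.

Definition high_upper_constant : R := (5 / ln 2) ^+ d * (4 + 2 * d%:R * (2 + 2 / ln 2) / (2 * pi) ^+ 2).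

Lemma high_upper_constant_gt0 : 0 < high_upper_constant.
Proof.
have ln2 : 0 < ln 2 :> R by rewrite ln_gt0 // ltr1n.
rewrite /high_upper_constant mulr_gt0 ?exprn_gt0 ?divr_gt0 //.
rewrite ltr_pwDl // divr_ge0 ?sqr_ge0 // !mulr_ge0 // addr_ge0 // divr_ge0 //; exact: ltW.
Qed.

(** Dyadic cut-offs [N 2^j]: the norm [E j] decays like [(N 2^j)^-2] up to logarithms, and
    [ln (y + 2) ^ d <= 3 d! y] leaves a geometric series. Its sum may depend on [beta], as only
    existence is at stake. *)
Lemma high_kernel_exists (beta : R) N : 0 < beta -> (0 < N)%N ->
  exists K : d.-tuple R -> R[i], is_high_kernel beta N K.
Proof.
move=> b0 N0.
pose Cd := high_upper_constant; have Cd0 : 0 <= Cd by exact/ltW/high_upper_constant_gt0.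
pose E j : R := Cd / (1 + beta * (N * 2 ^ j)%N%:R ^+ 2) * ln ((N * 2 ^ j)%N%:R + 2) ^+ d.
have N2 j : (0 < N * 2 ^ j)%N by rewrite muln_gt0 N0 expn_gt0.
pose G : R := 3 * Cd * d`!%:R / beta.
have G0 : 0 <= G.
  apply: divr_ge0; last exact: ltW.
  by apply: mulr_ge0; [exact: mulr_ge0|exact: ler0n].
have EG j : E j <= G * 2^-1 ^+ j.
  pose y : R := (N * 2 ^ j)%N%:R.
  have y2 : 2 ^+ j <= y by rewrite -natrX ler_nat leq_pmull.
  have p2 : 0 < 2 ^+ j :> R by rewrite exprn_gt0.
  have y1 : 1 <= y by rewrite /y ler1n.
  have y0 : 0 < y by lra.
  have f0 : 0 < d`!%:R :> R by rewrite ltr0n fact_gt0.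
  have L : ln (y + 2) ^+ d <= d`!%:R * (3 * y).
    apply: le_trans (ln_exp_le_factM _) _; first lra.
    by rewrite ler_pM2l //; lra.
  have D : (1 + beta * y ^+ 2)^-1 <= (beta * y ^+ 2)^-1.
    by rewrite lef_pV2 ?posrE ?addr_gt0 ?mulr_gt0 ?exprn_gt0 // lerDr.
  apply: le_trans (_ : Cd / (beta * y ^+ 2) * (d`!%:R * (3 * y)) <= _).
    apply: ler_pM => //.
    - by rewrite divr_ge0 // addr_ge0 // mulr_ge0 // ?sqr_ge0 // ltW.
    - by rewrite exprn_ge0 // ln_ge0 // -/y; lra.
    - by rewrite ler_wpM2l.
  have -> : Cd / (beta * y ^+ 2) * (d`!%:R * (3 * y)) = G / y.
    rewrite /G; move: (y) y0 => z z0; field; apply/andP; split; exact: lt0r_neq0.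
  rewrite exprVn ler_wpM2l ?lef_pV2 ?posrE //.
have geo n : \sum_(j < n) 2^-1 ^+ j = 2 - 2 * 2^-1 ^+ n :> R.
  elim: n => [|n IHn]; first by rewrite big_ord0 expr0; lra.
  by rewrite big_ord_recr /= IHn exprS; lra.
have [] := @kernel_of_multipliers R d (fun j => high_symbol beta (N * 2 ^ j))
  (fun j => (N * 2 ^ j.+1)%N) E (2 * G) (fun j k => high_symbol_opp beta _ k)
  (fun j => mult_high_upper b0 (N2 j)).
- move=> j k; rewrite /high_symbol => h; rewrite h.
  by rewrite (leq_ltn_trans _ h) // leq_pmul2l // leq_pexp2l.
- move=> k; exists (max_norm k) => n kn; rewrite /high_symbol ltnNge.
  by rewrite (leq_trans kn) //= (leq_trans (ltnW (ltn_expl n (isT : (1 < 2)%N)))) // leq_pmull.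
- move=> n; apply: (@le_trans _ _ (\sum_(j < n) G * 2^-1 ^+ j)).
    by apply: ler_sum => j _; exact: EG.
  rewrite -mulr_sumr geo mulrC ler_wpM2r //.
  by rewrite gerBl mulr_ge0 // exprn_ge0.
by move=> K [IK KE]; exists K; split => // k; rewrite KE expn0 muln1.
Qed.

Lemma Lp_norm1E (f : d.-tuple R -> R[i]) : complex_integrable f ->
  Lp_norm 1 f = (\int[mu]_x normc (f x))%:E.
Proof.
move=> If; rewrite /Lp_norm Lnorm1 /Rintegral fineK; last first.
  exact: (integrable_fin_num measurableT (complex_integrable_normc If)).
by apply: eq_integral => x _; rewrite /= ger0_norm // normc_ge0.
Qed.

(** [12 ^ d] is [6 ^ d] from the test polynomial times [2 ^ d] from [ln (N + 2) <= 2 harm N]. With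
    kappa = (2 pi)^2, [2 + 6 kappa] is [(1 + 2 kappa) + (1 + 4 kappa)], the second term serving to
    absorb an additive 1. *)
Definition high_lower_constant : R := (12 ^+ d * (1 + 4 * d%:R) * (2 + 6 * (2 * pi) ^+ 2))^-1.

Lemma high_lower_constant_gt0 : 0 < high_lower_constant.
Proof.
rewrite /high_lower_constant invr_gt0 !mulr_gt0 ?exprn_gt0 //.
by apply: ltr_pwDl => //; apply: mulr_ge0; [exact: ler0n|exact: sqr_ge0].
Qed.

Lemma high_kernel_L1_upper (beta : R) N K : 0 < beta -> (0 < N)%N -> is_high_kernel (d := d) beta N K ->
  (Lp_norm 1 K <= (high_upper_constant / (1 + beta * N%:R ^+ 2) * ln (N%:R + 2) ^+ d)%:E)%E.
Proof.
move=> b0 N0 [IK KE]; rewrite Lp_norm1E // lee_fin.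
exact: (kernel_L1_le IK (high_symbol_opp beta N) KE (mult_high_upper b0 N0)).
Qed.

(** The norm that [mult_high_lower] gives for the cut-off has a term without [D]. It is absorbed
    because [D] is at least the symbol at a frequency of max norm [N.+1], hence at least a constant
    over [1 + beta N^2]. *)
Lemma high_kernel_L1_lower (beta : R) N K : (0 < d)%N -> 0 < beta -> (0 < N)%N ->
  is_high_kernel (d := d) beta N K ->
  ((high_lower_constant / (1 + beta * N%:R ^+ 2) * ln (N%:R + 2) ^+ d)%:E <= Lp_norm 1 K)%E.
Proof.
move=> d0 b0 N0 [IK KE]; rewrite Lp_norm1E // lee_fin.
move: (mult_of_kernel IK KE); set D := (X in mult _ X) => multD.
have h1 := box_cut_lower_bound (mult_high_lower b0 N0 multD).
pose kap : R := (2 * pi) ^+ 2.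
have kap0 : 0 <= kap by exact: sqr_ge0.
pose z : R := beta * N%:R ^+ 2.
have z0 : 0 <= z by rewrite mulr_ge0 ?sqr_ge0 // ltW.
have D0 := mult_ge0 multD.
have h2 : 1 <= (1 + 4 * kap) * (D * (1 + z)).
  pose k0 : frequency d := [tuple if (i : nat) == 0%N then N.+1%:Z else 0 | i < d].
  have kN : (N < max_norm k0)%N.
    rewrite /max_norm (bigD1 (Ordinal d0)) //= leq_max; apply/orP; left.
    by rewrite tnth_mktuple.
  have L0 : laplace_symbol R k0 = kap * N.+1%:R ^+ 2.
    rewrite /laplace_symbol (bigD1 (Ordinal d0)) //= big1 => [|i].
      by rewrite tnth_mktuple /= addr0 exprMn.
    rewrite -val_eqE tnth_mktuple /= => /negbTE ->; rewrite mulr0 expr0n //.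
  have := mult_coef_le k0 multD; rewrite /high_symbol kN resolvent_symbolE L0.
  have N1 : N.+1%:R <= 2 * N%:R :> R by rewrite -natrM ler_nat; lia.
  have N2 : N.+1%:R ^+ 2 <= 4 * N%:R ^+ 2 :> R.
    have n0 : 0 <= N%:R :> R by []. have n1 : 0 <= N.+1%:R :> R by []. by nra.
  have pos : 0 < 1 + beta * (kap * N.+1%:R ^+ 2).
    apply: ltr_pwDl => //; apply: mulr_ge0; first exact: ltW.
    by apply: mulr_ge0 => //; exact: sqr_ge0.
  rewrite ger0_norm ?invr_ge0 ?(ltW pos) // -div1r ler_pdivrMr // => /le_trans; apply.
  rewrite [leRHS]mulrCA ler_wpM2l //.
  have : beta * kap * N.+1%:R ^+ 2 <= beta * kap * (4 * N%:R ^+ 2).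
    by rewrite ler_wpM2l // mulr_ge0 //; exact: ltW.
  have -> : beta * kap * (4 * N%:R ^+ 2) = 4 * kap * z by rewrite /z; ring.
  have kz : 0 <= kap * z by rewrite mulr_ge0.
  rewrite mulrA; lra.
have h3 : ln (N%:R + 2) ^+ d <= 12 ^+ d * ((1 + 4 * d%:R) * (1 + (1 + 2 * kap) * (D * (1 + z)))).
  apply: le_trans (_ : (2 * harm R N) ^+ d <= _).
    rewrite lerXn2r ?nnegrE ?ln_add2_le_harm //; first by rewrite ln_ge0 //; have : 0 <= N%:R :> R by []; lra.
    by rewrite mulr_ge0 // sumr_ge0.
  rewrite exprMn (_ : 12 = 2 * 6 :> R) ?exprMn -?[leRHS]mulrA ?ler_pM2l ?exprn_gt0 //; last by rewrite -natrM.
  apply: le_trans h1 _; rewrite mulrC.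
  have p4 : 0 <= 1 + 4 * d%:R :> R by apply: addr_ge0 => //; apply: mulr_ge0.
  apply: ler_wpM2l; first exact: exprn_ge0.
  apply: ler_wpM2l => //.
  rewrite lerD2l (_ : 2 * beta * _ = 2 * kap * z); last by rewrite /z /kap; ring.
  have kz : 0 <= kap * z by rewrite mulr_ge0.
  by rewrite mulrC [leRHS]mulrCA ler_wpM2l //; lra.
set A : R := 12 ^+ d * (1 + 4 * d%:R); have A0 : 0 < A.
  by rewrite /A mulr_gt0 ?exprn_gt0 // ltr_pwDl // mulr_ge0.
have z1 : 0 < 1 + z by lra.
rewrite mulrAC ler_pdivrMr -/z // /high_lower_constant -/A -/kap mulrC ler_pdivrMr; last by rewrite mulr_gt0 //; lra.
apply: le_trans h3 _; rewrite mulrA -/A -/D [leRHS]mulrCA ler_pM2l //.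
move: h2; move: (D * (1 + z)) => X; nra.
Qed.

End HighKernel.

(** * The low-frequency operator on bounded functions *)

Section BoxOperator.
Variables (R : realType) (d : nat).
Local Notation mu := (torus_measure R d).
Implicit Types (k : frequency d) (a : frequency d -> R) (f : d.-tuple R -> R[i]) (x y : d.-tuple R).

Definition box_operator a N f x : R[i] :=
  \sum_(k <- freq_box d N) (a k)%:C * fourier_coefficient f k * fourier_mode k x.

Lemma low_kernelE (beta : R) N x :
  low_kernel beta N x = trig (symbol_poly (resolvent_symbol beta) N) x.
Proof.
rewrite trig_symbol_poly /low_kernel fsbig_finite //; exact: finite_low_frequencies.
Qed.

Lemma low_operatorE (beta : R) N f x :
  low_operator beta N f x = box_operator (resolvent_symbol beta) N f x.
Proof. rewrite /low_operator fsbig_finite //; exact: finite_low_frequencies. Qed.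

Lemma symbol_poly_real a N x : (forall k, a (freq_opp k) = a k) ->
  trig (symbol_poly a N) x = (complex.Re (trig (symbol_poly a N) x))%:C.
Proof.
move=> aev; suff : conjc (trig (symbol_poly a N) x) = trig (symbol_poly a N) x.
  by case: (trig _ _) => u v [] v0; congr (_ +i* _); lra.
rewrite trig_symbol_poly conjc_sum -[in RHS](perm_big _ (freq_box_opp d N)) big_map /=.
apply: eq_bigr => k _; rewrite aev fourier_mode_freq_opp rmorphM /=.
by congr (_ * _); exact: conjc_real.
Qed.

Lemma box_operator_trig a N s x :
  box_operator a N (trig s) x = trig (act (fun k => box_cut R N k * a k) s) x.
Proof.
rewrite trig_act /box_operator.
under eq_bigr do rewrite fourier_coefficient_trig mulr_sumr mulr_suml big_mkcond.
rewrite exchange_big /=; apply: eq_bigr => t _.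
rewrite /box_cut; have [tN|tN] := boolP (max_norm t.2 <= N)%N.
  rewrite mul1r (bigD1_seq t.2) ?mem_freq_box ?freq_box_uniq //= eqxx big1 ?addr0 ?mulrA //.
  by move=> k; rewrite eq_sym => /negbTE ->.
rewrite mul0r mul0r big1_seq // => k /andP [_]; rewrite mem_freq_box => kN.
by case: eqP => // tk; rewrite tk kN in tN.
Qed.

Definition translate_poly a N x : seq (R[i] * frequency d) :=
  [seq ((a k)%:C * fourier_mode k x, freq_opp k) | k <- freq_box d N].

Lemma trig_translate_poly a N x y :
  trig (translate_poly a N x) y = trig (symbol_poly a N) (point_add x (point_opp y)).
Proof.
rewrite /trig !big_map /=; apply: eq_bigr => k _.
by rewrite fourier_mode_freq_opp fourier_mode_point_add fourier_mode_point_opp mulrA.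
Qed.

Lemma box_operator_integral a N f x : complex_integrable f ->
  box_operator a N f x = complex_integral (fun y => f y * trig (translate_poly a N x) y).
Proof.
move=> If; rewrite complex_integral_mul_trig // big_map /=; apply: eq_bigr => k _.
by rewrite freq_oppK mulrAC.
Qed.

(** Pairing the translated kernel with a polynomial gives the operator applied to that polynomial at
    [x], which the multiplier norm bounds. *)
Lemma translate_poly_L1_le a N C x : (forall k, a (freq_opp k) = a k) ->
  mult (fun k => box_cut R N k * a k) C ->
  \int[mu]_y normc (trig (translate_poly a N x) y) <= C.
Proof.
move=> aev aC.
pose g y := complex.Re (trig (translate_poly a N x) y).
have gE y : trig (translate_poly a N x) y = (g y)%:C.
  by rewrite /g trig_translate_poly; exact: symbol_poly_real.
have Ig : mu.-integrable setT (EFin \o g) by have [] := @complex_integrable_trig R d (translate_poly a N x).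
rewrite (_ : \int[mu]_y _ = \int[mu]_y `|g y|); last by apply: eq_Rintegral => y _; rewrite gE normcC.
apply: L1_norm_le_trig => // s s1.
have -> : (fun y => (g y)%:C * trig s y) = (fun y => trig s y * trig (translate_poly a N x) y).
  by apply/funext => y; rewrite -gE mulrC.
rewrite -box_operator_integral ?box_operator_trig; last exact: complex_integrable_trig.
by rewrite -[C]mulr1; exact: aC.
Qed.

Lemma Lp_normooE f : Lp_norm +oo%E f = ess_sup mu (fun x => (normc (f x))%:E).
Proof.
rewrite /Lp_norm Lnorm.unlock /= probability_setT lte01; congr ess_sup.
by apply/funext => x; rewrite /= ger0_norm // normc_ge0.
Qed.

Lemma in_Linfty_bound f : in_Linfty f -> exists M : R,
  [/\ 0 <= M, Lp_norm +oo%E f = M%:E & {ae mu, forall x, normc (f x) <= M}].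
Proof.
move=> [_ _]; rewrite Lp_normooE => h.
have n0 : (0 <= ess_sup mu (fun x => (normc (f x))%:E))%E.
  have mu0 : (0 < mu setT)%E by rewrite probability_setT lte01.
  apply: (ess_sup_gee mu0).
  by apply: nearW => x; rewrite lee_fin normc_ge0.
have fin : ess_sup mu (fun x => (normc (f x))%:E) \is a fin_num by rewrite ge0_fin_numE.
exists (fine (ess_sup mu (fun x => (normc (f x))%:E))); split.
- exact: fine_ge0.
- by rewrite fineK.
apply: filterS (ess_sup_ge mu (fun x => (normc (f x))%:E)) => x.
by rewrite -[X in (_ <= X)%E](fineK fin) lee_fin.
Qed.

Lemma in_Linfty_integrable f : in_Linfty f -> complex_integrable f.
Proof.
move=> If; have [M [M0 _ fM]] := in_Linfty_bound If.
suff H (g : d.-tuple R -> R) : measurable_fun setT g -> (forall x, `|g x| <= normc (f x)) ->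
    mu.-integrable setT (EFin \o g).
  by case: If => mr mi _; split; apply: H => // x; [exact: normr_Re_le|exact: normr_Im_le].
move=> mg gf; apply/integrableP; split; first exact/measurable_EFinP.
apply: (@le_lt_trans _ _ (\int[mu]_x M%:E)%E); last by rewrite integral_torus_cst ltry.
apply: ae_ge0_le_integral => //.
- by apply: measurableT_comp => //; exact/measurable_EFinP.
- by apply: filterS fM => x xM _; rewrite lee_fin (le_trans (gf x)).
Qed.

(** The multiplier norm only concerns polynomials; bounded functions are reached through the L^1
    norm of the translated kernel. *)
Lemma box_operator_Linfty a N C f : (forall k, a (freq_opp k) = a k) ->
  mult (fun k => box_cut R N k * a k) C -> in_Linfty f ->
  (Lp_norm +oo%E (box_operator a N f) <= C%:E * Lp_norm +oo%E f)%E.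
Proof.
move=> aev aC If; have [M [M0 -> fM]] := in_Linfty_bound If.
have Cf := in_Linfty_integrable If.
rewrite Lp_normooE; apply/ess_supP; apply: nearW => x; rewrite -EFinM lee_fin.
rewrite box_operator_integral //.
set t := trig (translate_poly a N x).
have It : complex_integrable t by exact: complex_integrable_trig.
have Ift : complex_integrable (fun y => f y * t y).
  apply: (complex_integrableM Cf (measurable_trig _)) => y; exact: trig_bound.
apply: le_trans (normc_complex_integral_le Ift) _.
have IMt : mu.-integrable setT (EFin \o (fun y => M * normc (t y))).
  by have := integrableZl measurableT M (complex_integrable_normc It).
apply: (@le_trans _ _ (\int[mu]_y (M * normc (t y)))).
  rewrite -lee_fin /Rintegral !fineK; last 2 first.
  - exact: (integrable_fin_num measurableT IMt).
  - exact: (integrable_fin_num measurableT (complex_integrable_normc Ift)).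
  apply: ae_ge0_le_integral => //.
  - by move=> y _; rewrite lee_fin normc_ge0.
  - exact: (measurable_int _ (complex_integrable_normc Ift)).
  - by move=> y _; rewrite lee_fin mulr_ge0 // normc_ge0.
  - exact: (measurable_int _ IMt).
  - apply: filterS fM => y yM _; rewrite lee_fin Normc.normcM ler_wpM2r //; exact: normc_ge0.
rewrite RintegralZl //; last exact: complex_integrable_normc.
by rewrite mulrC ler_wpM2r //; exact: translate_poly_L1_le.
Qed.

Lemma low_operator_Linfty (beta : R) N C f : mult (fun k => box_cut R N k * resolvent_symbol beta k) C ->
  in_Linfty f -> (Lp_norm +oo%E (low_operator beta N f) <= C%:E * Lp_norm +oo%E f)%E.
Proof.
move=> mC If; have -> : low_operator beta N f = box_operator (resolvent_symbol beta) N f.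
  by apply/funext => x; rewrite low_operatorE.
apply: box_operator_Linfty => //; exact: resolvent_symbol_opp.
Qed.

(** The low part is the resolvent, of norm 1, minus the high part. *)
Lemma low_operator_effective (beta : R) N f : 0 < beta -> (0 < N)%N -> in_Linfty f ->
  (Lp_norm +oo%E (low_operator beta N f) <=
   (1 + high_upper_constant R d / (1 + beta * N%:R ^+ 2) * ln (N%:R + 2) ^+ d)%:E * Lp_norm +oo%E f)%E.
Proof.
move=> b0 N0; apply: low_operator_Linfty.
apply: (mult_ext _ (multB (mult_resolvent_symbol b0) (mult_high_upper b0 N0))) => k.
by rewrite high_symbolE; ring.
Qed.

(** A positive kernel has L^1 norm equal to its integral, the coefficient at frequency 0, which is
    1. Positivity on the unit cube determines the integral, since the complement is null. *)
Lemma low_kernel_positive_mass (beta : R) N : 0 < beta ->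
  (forall x, (forall j, 0 <= tnth x j < 1) -> 0 < low_kernel beta N x) ->
  Lp_norm 1 (low_kernel (d := d) beta N) = 1%E /\
  mult (fun k : frequency d => box_cut R N k * resolvent_symbol beta k) 1.
Proof.
move=> b0 K0.
pose s := symbol_poly (@resolvent_symbol R d beta) N.
have KE : low_kernel (d := d) beta N = trig s by apply/funext => x; exact: low_kernelE.
have IK : complex_integrable (trig s) by exact: complex_integrable_trig.
have co k : fourier_coefficient (trig s) k = (box_cut R N k * resolvent_symbol beta k)%:C.
  by rewrite fourier_coefficient_symbol_poly mulrC.
have mass : \int[mu]_x normc (trig s x) = 1.
  transitivity (\int[mu]_x complex.Re (trig s x)).
    rewrite /Rintegral; congr fine; apply: ae_eq_integral => //.
    - exact: (measurable_int _ (complex_integrable_normc IK)).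
    - by case: IK => /measurable_int.
    exists (~` @unit_cube R d); split; [apply: measurableC; exact: (@measurable_unit_cube R d)|exact: (@torus_measure_unit_cubeC R d)|].
    move=> x /= nx cx; apply: nx => _; congr _%:E.
    have := K0 x cx; rewrite KE; case: (trig s x) => u v; rewrite ltcE /= => /andP [/eqP -> u0].
    by rewrite expr0n /= addr0 sqrtr_sqr gtr0_norm.
  have : complex_integral (trig s) = 1.
    have := co (freq0 d); rewrite fourier_coefficientE.
    have -> : (fun x => trig s x * fourier_mode (freq_opp (freq0 d)) x) = trig s.
      by apply/funext => x; rewrite fourier_mode_freq_opp fourier_mode_freq0 conjc1 mulr1.
    move=> ->; rewrite resolvent_symbolE /box_cut.
    have z j : tnth (freq0 d) j = 0 by rewrite tnth_mktuple.
    rewrite (_ : max_norm _ = 0%N); last by apply: big1 => j _; rewrite z.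
    rewrite /laplace_symbol big1 => [|j _]; last by rewrite z mulr0 expr0n.
    by rewrite mulr0 addr0 invr1 mulr1.
  by move=> /(congr1 (@complex.Re R)).
split; first by rewrite KE Lp_norm1E // mass.
by rewrite -mass; exact: mult_of_kernel.
Qed.

End BoxOperator.

(** * Positivity of the low-frequency kernel *)

Section BoxSums.
Implicit Types (d N : nat).

Definition int_box N : seq int := [seq Posz i | i <- iota 0 N.+1] ++ [seq Negz i | i <- iota 0 N].

Lemma mem_int_box N (n : int) : (n \in int_box N) = (`|n| <= N)%N.
Proof.
rewrite mem_cat; case: n => i.
  rewrite mem_map; last by move=> ? ? [].
  rewrite mem_iota add0n ltnS absz_nat; case: (leqP i N) => //= _.
  by apply/negbTE/mapP => -[].
rewrite orbC mem_map; last by move=> ? ? [].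
rewrite mem_iota add0n -[`|Negz i|%N]/(i.+1); case: (ltnP i N) => //= _.
by apply/negbTE/negP => /mapP [].
Qed.

Lemma int_box_uniq N : uniq (int_box N).
Proof.
rewrite cat_uniq !map_inj_uniq ?iota_uniq ?andbT //=; last 2 first.
- by move=> ? ? [].
- by move=> ? ? [].
by apply/hasPn => _ /mapP [i _ ->]; apply/mapP => -[].
Qed.

Lemma sum_int_box (V : nmodType) N (F : int -> V) :
  \sum_(n <- int_box N) F n = \sum_(i < N.+1) F i%:Z + \sum_(i < N) F (- i.+1%:Z).
Proof.
have E n : iota 0 n = index_iota 0 n by rewrite /index_iota subn0.
by rewrite big_cat !big_map !E !big_mkord.
Qed.

Definition freq_cons d (n : int) (k : frequency d) : frequency d.+1 := [tuple of n :: k].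

Lemma max_norm_cons d n (k : frequency d) : max_norm (freq_cons n k) = maxn `|n| (max_norm k).
Proof.
rewrite /max_norm big_ord_recl /= tnth0; congr maxn.
by apply: eq_bigr => j _; rewrite tnthS.
Qed.

Lemma sum_freq_box_cons (V : nmodType) d N (F : frequency d.+1 -> V) :
  \sum_(k <- freq_box d.+1 N) F k =
  \sum_(n <- int_box N) \sum_(k <- freq_box d N) F (freq_cons n k).
Proof.
transitivity (\sum_(k <- [seq freq_cons n h | n <- int_box N, h <- freq_box d N]) F k);
  last by rewrite big_allpairs_dep.
apply: perm_big; apply: uniq_perm; first exact: freq_box_uniq.
  apply: allpairs_uniq; [exact: int_box_uniq|exact: freq_box_uniq|].
  by move=> [n k] [n' k'] _ _ /= /(congr1 val) /= [-> /val_inj ->].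
move=> k; rewrite mem_freq_box; case: (tupleP k) => n h.
rewrite -/(freq_cons n h) max_norm_cons geq_max.
apply/andP/allpairsP => [[nN hN]|[[n' h'] /= [nN hN e]]].
  by exists (n, h); rewrite mem_int_box mem_freq_box.
have [-> hh] : n = n' /\ h = h' :> seq int by have /(congr1 val) /= [-> ->] := e.
have {hh}-> : h = h' by exact: val_inj.
by rewrite mem_int_box in nN; rewrite mem_freq_box in hN.
Qed.

Lemma freq_box0 N : freq_box 0 N = [:: [tuple]].
Proof.
apply: perm_small_eq => //; apply: uniq_perm; first exact: freq_box_uniq.
  by [].
move=> k; rewrite mem_freq_box inE /max_norm big_ord0 leq0n; apply/esym/eqP.
exact: tuple0.
Qed.

Lemma size_freq_box d N : size (freq_box d N) = ((2 * N + 1) ^ d)%N.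
Proof.
elim: d => [|d IHd]; first by rewrite freq_box0.
rewrite -sum1_size sum_freq_box_cons; under eq_bigr do rewrite sum1_size IHd.
rewrite big_const_seq count_predT iter_addn_0 /int_box size_cat !size_map !size_iota.
rewrite expnS mulnC; congr muln; lia.
Qed.

Lemma sum_freq_boxS (V : nmodType) d N (F : frequency d -> V) :
  \sum_(k <- freq_box d N.+1) F k =
  \sum_(k <- freq_box d N) F k + \sum_(k <- freq_box d N.+1 | max_norm k == N.+1) F k.
Proof.
rewrite (bigID (fun k => max_norm k <= N)%N) /=; congr (_ + _).
  rewrite -big_filter; apply: perm_big; apply: uniq_perm; rewrite ?filter_uniq ?freq_box_uniq //.
  move=> k; rewrite mem_filter !mem_freq_box; lia.
rewrite big_seq_cond [RHS]big_seq_cond; apply: eq_bigl => k.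
rewrite mem_freq_box; lia.
Qed.
End BoxSums.

(** * Counting frequencies by max norm *)

Section ShellSums.
Variable R : realType.
Implicit Types (d N : nat).

(** The number of frequencies of max norm [r.+1]; the shift leaves the zero frequency apart. *)
Definition shell d (r : nat) : nat := ((2 * r + 3) ^ d - (2 * r + 1) ^ d)%N.

Lemma sum_max_norm d N (g : nat -> R) :
  \sum_(k <- freq_box d N) g (max_norm k) = g 0%N + \sum_(r < N) (shell d r)%:R * g r.+1.
Proof.
elim: N => [|N IHN].
  rewrite big_ord0 addr0 big_seq_cond.
  rewrite (eq_bigr (fun=> g 0%N)) => [|k]; last first.
    by rewrite mem_freq_box leqn0 andbT => /eqP ->.
  rewrite -big_seq_cond big_const_seq count_predT iter_addr_0.
  by rewrite size_freq_box muln0 add0n exp1n mulr1n.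
rewrite sum_freq_boxS IHN big_ord_recr /= -addrA; congr (_ + (_ + _)).
rewrite (eq_bigr (fun=> g N.+1)) => [|k /eqP -> //].
rewrite big_const_seq iter_addr_0 -[LHS]mulr_natl; congr (_%:R * _).
have := size_freq_box d N.+1; rewrite -sum1_size sum_freq_boxS sum1_size size_freq_box sum1_count.
rewrite /shell; move=> h; have -> : ((2 * N + 3) = (2 * N.+1 + 1))%N by lia.
by rewrite -h addKn.
Qed.

Lemma shell1 r : shell 1 r = 2%N.
Proof. by rewrite /shell !expn1; lia. Qed.

Lemma shell2 r : shell 2 r = (8 * r.+1)%N.
Proof. by rewrite /shell -!mulnn; lia. Qed.

Lemma sum_inv_square_le N : \sum_(r < N) r.+1%:R ^- 2 <= 2 - 2 / N.+1%:R :> R.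
Proof.
elim: N => [|N IHN]; first by rewrite big_ord0 divr1 subrr.
rewrite big_ord_recr /=; apply: le_trans (lerD IHN (lexx _)) _.
have -> : N.+2%:R = N.+1%:R + 1 :> R by rewrite natr1.
have : 1 <= N.+1%:R :> R by rewrite ler1n.
move: (N.+1%:R) => a a1.
have a0 : 0 < a by lra.
have b0 : 0 < a + 1 by lra.
have E : 2 - 2 / (a + 1) - (2 - 2 / a + a ^- 2) = (a - 1) / (a ^+ 2 * (a + 1)).
  by field; rewrite ?lt0r_neq0 //.
rewrite -subr_ge0 E divr_ge0 //; first lra.
by apply: mulr_ge0; [exact: sqr_ge0|exact: ltW].
Qed.

Lemma bernoulli (y : R) n : 0 <= y -> 1 + n%:R * y <= (1 + y) ^+ n.
Proof.
move=> y0; elim: n => [|n IHn]; first by rewrite mul0r addr0 expr0.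
rewrite exprS; apply: le_trans (ler_wpM2l _ IHn); last lra.
have : 0 <= n%:R * y ^+ 2 by apply: mulr_ge0 => //; exact: sqr_ge0.
by rewrite -[n.+1%:R]natr1; nra.
Qed.

End ShellSums.

(** * Fejer kernels and multipliers that preserve nonnegativity *)

Section Fejer.
Variable R : realType.

(** Not truncated: it is meant for [|n| <= N]. *)
Definition fejer_weight (N : nat) (n : int) : R := 1 - `|n|%N%:R / N.+1%:R.

Definition box_weight d (N : nat) (k : frequency d) : R := \prod_(j < d) fejer_weight N (tnth k j).

Lemma fejer_weight_bounds N (n : int) : (`|n| <= N)%N -> 0 <= fejer_weight N n <= 1.
Proof.
move=> nN; rewrite /fejer_weight subr_ge0 ler_pdivrMr // mul1r ler_nat (leq_trans nN) //=.
Qed.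

Lemma box_weight_bounds d N (k : frequency d) : (max_norm k <= N)%N -> 0 <= box_weight N k <= 1.
Proof.
move=> kN; have H j : 0 <= fejer_weight N (tnth k j) <= 1.
  by apply: fejer_weight_bounds; apply: leq_trans kN; exact: (leq_bigmax j).
apply: (big_ind (fun y : R => 0 <= y <= 1)) => [|y z /andP [y0 y1] /andP [z0 z1]|j _]; rewrite ?lexx ?ler01 //.
by rewrite mulr_ge0 // mulr_ile1.
Qed.

(** The kernel is the squared modulus of [sum_(a <= N) e(a)] divided by [N.+1]. *)
Lemma fejer_kernel_ge0 N (t : R) : exists2 r : R, 0 <= r &
  \sum_(n <- int_box N) (fejer_weight N n)%:C * expi (2 * pi * (n%:~R * t)) = r%:C.
Proof.
pose e (n : int) : R[i] := expi (2 * pi * (n%:~R * t)).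
pose g : R[i] := \sum_(a < N.+1) e a%:Z.
exists (normc g ^+ 2 / N.+1%:R); first by rewrite divr_ge0 ?sqr_ge0.
have E : (normc g ^+ 2)%:C = N.+1%:R * \sum_(n <- int_box N) (fejer_weight N n)%:C * e n.
  rewrite normc_sqrE /g conjc_sum mulr_suml.
  transitivity (\sum_(a < N.+1) \sum_(b < N.+1) e (a%:Z - b%:Z)).
    apply: eq_bigr => a _; rewrite mulr_sumr; apply: eq_bigr => b _.
    by rewrite /e -expiN -expiD; congr expi; rewrite rmorphB /=; ring.
  rewrite mulr_sumr.
  transitivity (\sum_(n <- int_box N) \sum_(a < N.+1) \sum_(b < N.+1)
      ((a%:Z - b%:Z + - n == 0) : nat)%:R * e n).
    rewrite [RHS]exchange_big /=; apply: eq_bigr => a _.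
    rewrite [RHS]exchange_big /=; apply: eq_bigr => b _.
    have abN : (`|a%:Z - b%:Z| <= N)%N by have := ltn_ord a; have := ltn_ord b; lia.
    rewrite (bigD1_seq (a%:Z - b%:Z)) ?mem_int_box ?int_box_uniq //= subrr eqxx mul1r.
    rewrite big1 ?addr0 // => n nab; rewrite subr_eq0 eq_sym (negbTE nab) mul0r //.
  rewrite big_seq [RHS]big_seq; apply: eq_bigr => n; rewrite mem_int_box => nN.
  under eq_bigr do rewrite -mulr_suml -natr_sum.
  rewrite -mulr_suml -natr_sum sum_diff_eq abszN mulrA; congr (_ * _).
  have N0 : N.+1%:R != 0 :> R by rewrite pnatr_eq0.
  rewrite /fejer_weight natrB; last exact: leq_trans nN _.
  rewrite -[N.+1%:R as X in X * _](rmorph_nat (real_complex R)) -rmorphM /= mulrBr mulr1 mulrCA divff // mulr1.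
  by rewrite rmorphB /= !rmorph_nat.
have N0 : N.+1%:R != 0 :> R[i] by rewrite pnatr_eq0.
apply: (mulfI N0); rewrite -E -(rmorph_nat (real_complex R)) -[RHS]rmorphM /= mulrC divfK //.
Qed.

Lemma fourier_mode_cons d (n : int) (k : frequency d) (t : R) (x : d.-tuple R) :
  fourier_mode (freq_cons n k) [tuple of t :: x] = expi (2 * pi * (n%:~R * t)) * fourier_mode k x.
Proof.
rewrite -[[tuple of t :: x]]/(tcons (t, x)) fourier_mode_tcons theadE; congr (_ * fourier_mode _ _).
exact: val_inj.
Qed.

Lemma fejer_box_ge0 d N (x : d.-tuple R) : exists2 r : R, 0 <= r &
  trig (symbol_poly (box_weight N) N) x = r%:C.
Proof.
elim: d x => [|d IHd] x.
  exists 1 => //; rewrite trig_symbol_poly freq_box0 big_seq1 /box_weight big_ord0 mul1r.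
  by rewrite fourier_modeE big_ord0 mulr0 expi0.
case: (tupleP x) => t y; have [r r0 E] := IHd y; have [q q0 F] := fejer_kernel_ge0 N t.
exists (q * r); first exact: mulr_ge0.
rewrite rmorphM /= -F -E !trig_symbol_poly sum_freq_box_cons mulr_suml; apply: eq_bigr => n _.
rewrite mulr_sumr; apply: eq_bigr => k _.
rewrite fourier_mode_cons /box_weight big_ord_recl rmorphM /= tnth0.
under eq_bigr do rewrite tnthS.
by rewrite -!mulrA; congr (_ * _); rewrite mulrCA.
Qed.

(** If [0 <= f <= B], then [f - B/2] has modulus at most [B/2], so its image is at least [- A B/2];
    the constant [B/2] contributes exactly [A B/2] back because the norm is attained at the zero
    frequency. *)
Lemma mult_nonneg d (a : frequency d -> R) (A : R) s : mult a A -> a (freq0 d) = A ->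
  (forall x, exists2 r : R, 0 <= r & trig s x = r%:C) ->
  forall x, 0 <= complex.Re (trig (act a s) x).
Proof.
move=> aA a0 s0 x; pose B := \sum_(t <- s) normc t.1.
pose s' := s ++ [:: ((- (B / 2))%:C, freq0 d)].
have := aA s' (B / 2) _ x.
have s'B y : normc (trig s' y) <= B / 2.
  have [r r0 E] := s0 y; have := trig_bound s y; rewrite -/B trig_cat trig_mode fourier_mode_freq0 mulr1.
  rewrite E normcC (ger0_norm r0) => rB; rewrite -rmorphD normcC ler_norml; apply/andP; split; lra.
move=> /(_ s'B) h; have := le_trans (normr_Re_le _) h.
rewrite /s' act_cat trig_cat ReD /= trig_mode fourier_mode_freq0 mulr1 a0 ReZ ler_norml => /andP [].
by move=> /=; lra.
Qed.

End Fejer.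

(** * Lower bound for the resolvent of the Fejer kernel *)

Section FejerLowerBound.
Variable R : realType.

Lemma max_norm0 d : max_norm (freq0 d) = 0%N.
Proof. by apply: big1 => j _; rewrite tnth_mktuple. Qed.

Lemma laplace_symbol0 d : laplace_symbol R (freq0 d) = 0.
Proof. by apply: big1 => j _; rewrite tnth_mktuple mulr0 expr0n. Qed.

Lemma sqr_phase (z : int) : (2 * pi * z%:~R) ^+ 2 = (2 * pi) ^+ 2 * `|z|%N%:R ^+ 2 :> R.
Proof.
by rewrite exprMn; congr (_ * _); rewrite -[LHS]real_normK ?num_real // -intr_norm -abszE.
Qed.

Lemma resolvent_symbol_ge0 d (beta : R) (k : frequency d) : 0 < beta -> 0 <= resolvent_symbol beta k.
Proof.
by move=> /ltW b0; rewrite resolvent_symbolE invr_ge0 addr_ge0 // mulr_ge0 ?laplace_symbol_ge0.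
Qed.

Lemma laplace_symbol_bounds d (k : frequency d) : (0 < d)%N ->
  (2 * pi) ^+ 2 * (max_norm k)%:R ^+ 2 <= laplace_symbol R k <=
  d%:R * ((2 * pi) ^+ 2 * (max_norm k)%:R ^+ 2).
Proof.
move=> d0.
apply/andP; split.
  have [|j jE] := @bigop.eq_bigmax 'I_d (fun j => `|tnth k j|%N); first by rewrite card_ord.
  rewrite /max_norm jE /laplace_symbol (bigD1 j) //= -sqr_phase lerDl.
  by apply: sumr_ge0 => i _; exact: sqr_ge0.
have H (j : 'I_d) : (2 * pi * (tnth k j)%:~R) ^+ 2 <= (2 * pi) ^+ 2 * (max_norm k)%:R ^+ 2 :> R.
  rewrite sqr_phase ler_wpM2l ?sqr_ge0 // lerXn2r ?nnegrE // ler_nat.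
  exact: (leq_bigmax j).
by apply: le_trans (ler_sum _ (fun j _ => H j)) _; rewrite sumr_const card_ord [leRHS]mulr_natl.
Qed.

Lemma resolvent_symbol_bounds d (beta : R) (k : frequency d) : (0 < d)%N -> 0 < beta ->
  (1 + d%:R * (beta * (2 * pi) ^+ 2) * (max_norm k)%:R ^+ 2)^-1 <= resolvent_symbol beta k <=
  (1 + beta * (2 * pi) ^+ 2 * (max_norm k)%:R ^+ 2)^-1.
Proof.
move=> d0 b0; have /andP [l1 l2] := laplace_symbol_bounds k d0.
have l0 := laplace_symbol_ge0 R k; have m0 : 0 <= (max_norm k)%:R ^+ 2 :> R by exact: sqr_ge0.
have p0 : 0 <= (2 * pi) ^+ 2 :> R by exact: sqr_ge0.
have bl : 0 <= beta * laplace_symbol R k by rewrite mulr_ge0 // ltW.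
have bp : 0 <= beta * (2 * pi) ^+ 2 by apply: mulr_ge0 => //; exact: ltW.
have bm : 0 <= beta * (2 * pi) ^+ 2 * (max_norm k)%:R ^+ 2 by apply: mulr_ge0.
have dm : 0 <= d%:R * (beta * (2 * pi) ^+ 2) * (max_norm k)%:R ^+ 2 :> R.
  by rewrite -mulrA; apply: mulr_ge0 => //.
rewrite resolvent_symbolE !lef_pV2 ?posrE ?ltr_pwDl // !lerD2l; apply/andP; split.
  rewrite -[d%:R * _ * _]mulrA -[beta * _ * _]mulrA mulrCA ler_pM2l //.
by rewrite -mulrA ler_pM2l.
Qed.

Lemma symbol_poly_Re d (a : frequency d -> R) N x :
  complex.Re (trig (symbol_poly a N) x) = \sum_(k <- freq_box d N) a k * complex.Re (fourier_mode k x).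
Proof. by rewrite trig_symbol_poly Re_sum; apply: eq_bigr => k _; rewrite ReZ. Qed.

Lemma symbol_poly_Re_lower d (a : frequency d -> R) N x :
  (forall k, (max_norm k <= N)%N -> 0 <= a k) ->
  2 * a (freq0 d) - \sum_(k <- freq_box d N) a k <= complex.Re (trig (symbol_poly a N) x).
Proof.
move=> a0; rewrite symbol_poly_Re !(bigD1_seq (freq0 d)) ?mem_freq_box ?max_norm0 ?freq_box_uniq //.
have r1 : complex.Re (fourier_mode (freq0 d) x) = 1 by rewrite fourier_mode_freq0.
rewrite r1 mulr1.
have E u v : 2 * u - (u + v) = u - v :> R by ring.
rewrite E.
rewrite lerD2l -sumrN [leLHS]big_seq_cond [leRHS]big_seq_cond; apply: ler_sum => k /andP [].
rewrite mem_freq_box => /a0 ak _.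
rewrite -mulrN1 ler_wpM2l //; have := normr_Re_le (fourier_mode k x).
by rewrite normc_fourier_mode ler_norml => /andP [].
Qed.

(** With [y = c r^2 / 2], [(1 + y)^(t+2) >= t y^3 = t c^3 r^6 / 8], and 256 makes this at least
    [32 r^3]. The factor [8 r] bounds the number of frequencies of max norm [r] for d <= 2, and the
    right-hand sides sum over [r] to at most half of the zero mode. *)
Lemma power_decay (c r : R) (t : nat) : 0 < c -> 1 <= r -> 256 <= t%:R * c ^+ 3 ->
  8 * r * (2 + c * r ^+ 2)^-1 ^+ t.+2 <= 2^-1 ^+ t.+2 * (4^-1 * r ^- 2).
Proof.
move=> c0 r1 tc; have r0 : 0 < r by lra.
pose y := c * r ^+ 2 / 2; have y0 : 0 < y by rewrite divr_gt0 // mulr_gt0 // exprn_gt0.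
have -> : 2 + c * r ^+ 2 = 2 * (1 + y) by rewrite /y; field.
have Y0 : 0 < (1 + y) ^+ t.+2 by rewrite exprn_gt0 //; lra.
rewrite invfM exprMn mulrCA ler_pM2l ?exprn_gt0 ?invr_gt0 // exprVn ler_pdivrMr //.
have Yb : t%:R * y ^+ 3 <= (1 + y) ^+ t.+2.
  have -> : (1 + y) ^+ t.+2 = (1 + y) ^+ t * (1 + y) ^+ 2 by rewrite -exprD addn2.
  have B := bernoulli t (ltW y0).
  have : t%:R * y * y ^+ 2 <= (1 + y) ^+ t * (1 + y) ^+ 2.
    have ty : 0 <= t%:R * y by apply: mulr_ge0 => //; exact: ltW.
    by apply: ler_pM => //; [exact: sqr_ge0|lra|nra].
  by rewrite [y ^+ 3]exprS mulrA.
have r6 : r ^+ 3 <= r ^+ 6 by rewrite ler_weXn2l.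
have key : 32 * r ^+ 3 <= (1 + y) ^+ t.+2.
  apply: le_trans Yb; rewrite (_ : _ * y ^+ 3 = t%:R * c ^+ 3 / 8 * r ^+ 6); last first.
    by rewrite /y; move: (t%:R) => T; field.
  apply: le_trans (_ : 32 * r ^+ 6 <= _); first by rewrite ler_pM2l.
  by rewrite ler_pM2r ?exprn_gt0 //; lra.
rewrite (_ : 4^-1 / r ^+ 2 * _ = (1 + y) ^+ t.+2 / (4 * r ^+ 2)); last first.
  by move: (_ ^+ t.+2) => Y; field; rewrite ?lt0r_neq0.
rewrite ler_pdivlMr; last by rewrite mulr_gt0 // exprn_gt0.
by rewrite (_ : 8 * r * (4 * r ^+ 2) = 32 * r ^+ 3) //; ring.
Qed.

(* Writing [L] for the symbol of [- beta Delta] and [Q = 1 / (2 + L)], the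
   resolvent [1 / (1 + L)] equals [Q + Q^2 + ... + Q^n + Q^n / (1 + L)], so it
   dominates [Q^n] on nonnegative functions; for [n] large the zero mode of
   [Q^n] outweighs all the others. *)
Lemma fejer_resolvent_lower d (beta : R) : d = 1%N \/ d = 2%N -> 0 < beta ->
  exists2 c0 : R, 0 < c0 & forall N (x : d.-tuple R),
    c0 <= complex.Re (trig (symbol_poly (fun k => resolvent_symbol beta k * box_weight R N k) N) x).
Proof.
move=> hd b0; have d0 : (0 < d)%N by case: hd => ->.
have shell_le r : (shell d r)%:R <= 8 * r.+1%:R :> R.
  by rewrite -natrM ler_nat; case: hd => ->; rewrite ?shell1 ?shell2; lia.
pose c : R := beta * (2 * pi) ^+ 2; have c0 : 0 < c by rewrite mulr_gt0 // exprn_gt0 // mulr_gt0 // pi_gt0.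
pose t := Num.bound (256 / c ^+ 3).
have tc : 256 <= t%:R * c ^+ 3.
  rewrite -ler_pdivrMr ?exprn_gt0 //; apply/ltW/archi_boundP.
  by rewrite divr_ge0 // exprn_ge0 // ltW.
pose Q (k : frequency d) : R := (2 + beta * laplace_symbol R k)^-1.
have multQ : mult Q 2^-1 by apply: mult_laplace_resolvent => //; exact: ltW.
have bl (k : frequency d) : 0 <= beta * laplace_symbol R k by rewrite mulr_ge0 ?laplace_symbol_ge0 // ltW.
pose a k : R := resolvent_symbol beta k - Q k ^+ t.+2.
(* The norms [2^-1, ..., 2^-(t+1)] and [2^-(t+2)] add up to exactly the value of [a] at the zero
   frequency, as [mult_nonneg] requires. *)
have multa : mult a (1 - 2^-1 ^+ t.+2).
  have -> : 1 - 2^-1 ^+ t.+2 = \sum_(i < t.+1) 2^-1 ^+ i.+1 + 2^-1 ^+ t.+2 * 1 :> R.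
    elim: (t.+1) => [|n IHn]; first by rewrite big_ord0; lra.
    by rewrite big_ord_recr /=; move: IHn; rewrite (exprS _ n.+1); lra.
  have m1 := @mult_sum R d _ (index_enum 'I_t.+1) xpredT (fun i k => Q k ^+ i.+1)
    (fun i => 2^-1 ^+ i.+1) (fun i _ => mult_exp i.+1 multQ).
  have m2 := multM (mult_exp t.+2 multQ) (mult_resolvent_symbol b0).
  apply: (mult_ext _ (multD m1 m2)) => k.
  rewrite /a resolvent_symbolE; have RQ : (1 + beta * laplace_symbol R k)^-1 =
      Q k + Q k * (1 + beta * laplace_symbol R k)^-1.
    rewrite /Q; move: (bl k); set z := beta * _ => z0.
    by field; rewrite ?lt0r_neq0 //=; lra.
  move: RQ; move: (_^-1) (Q k) => r q rq.
  suff H n : r = \sum_(i < n) q ^+ i.+1 + q ^+ n * r by rewrite [in RHS](H t.+2) [in RHS]big_ord_recr /=; ring.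
  elim: n => [|n IHn]; first by rewrite big_ord0 add0r expr0 mul1r.
  by rewrite big_ord_recr /= -addrA exprSr -mulrA -mulrDr -rq.
pose E : R := 2^-1 ^+ t.+2; have E0 : 0 < E by rewrite exprn_gt0.
exists (E / 2) => [|N x]; first exact: divr_gt0.
have -> : symbol_poly (fun k => resolvent_symbol beta k * box_weight R N k) N =
    act (@resolvent_symbol R d beta) (symbol_poly (box_weight R N) N).
  by rewrite /act -map_comp; apply: eq_map => k /=; rewrite rmorphM.
have -> : trig (act (resolvent_symbol beta) (symbol_poly (box_weight R N) N)) x =
    trig (act a (symbol_poly (box_weight R N) N)) x +
    trig (act (fun k => Q k ^+ t.+2) (symbol_poly (box_weight R N) N)) x.
  by rewrite -trig_actD; congr (trig (act _ _) _); apply/funext => k; rewrite /a subrK.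
rewrite ReD -[leLHS]add0r lerD //.
  apply: mult_nonneg multa _ _ x; last exact: fejer_box_ge0.
  by rewrite /a /Q resolvent_symbolE laplace_symbol0 mulr0 !addr0 invr1.
have -> : act (fun k => Q k ^+ t.+2) (symbol_poly (box_weight R N) N) =
    symbol_poly (fun k => Q k ^+ t.+2 * box_weight R N k) N.
  by rewrite /act -map_comp; apply: eq_map => k; congr (_, _); exact/esym/rmorphM.
have Q0 k : 0 <= Q k by rewrite /Q invr_ge0 addr_ge0.
apply: le_trans (symbol_poly_Re_lower _ _) => [|k /box_weight_bounds - /(_ R) /andP [w0 _]]; last first.
  by rewrite mulr_ge0 // exprn_ge0.
have cr (r : nat) : 0 <= c * r%:R ^+ 2 by apply: mulr_ge0; [exact: ltW|exact: sqr_ge0].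
pose g (r : nat) : R := (2 + c * r%:R ^+ 2)^-1 ^+ t.+2.
(* With zero mode [E] and total at most [3 E / 2], the polynomial is at least
   [2 E - 3 E / 2 = E / 2]. *)
have S : \sum_(k <- freq_box d N) Q k ^+ t.+2 * box_weight R N k <= E + E / 2.
  apply: (@le_trans _ _ (\sum_(k <- freq_box d N) g (max_norm k))).
    rewrite [leLHS]big_seq [leRHS]big_seq; apply: ler_sum => k; rewrite mem_freq_box => /box_weight_bounds - /(_ R) /andP [w0 w1].
    apply: (@le_trans _ _ (Q k ^+ t.+2)); first by rewrite ler_piMr // exprn_ge0.
    rewrite lerXn2r ?nnegrE //; first by rewrite invr_ge0 addr_ge0.
    rewrite /Q lef_pV2 ?posrE ?ltr_pwDl //.
    rewrite lerD2l /c -mulrA ler_pM2l //.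
    by have /andP [] := laplace_symbol_bounds k d0.
  have g0 : g 0%N = E by rewrite /g (_ : 0%:R ^+ 2 = 0) ?mulr0 ?addr0 // expr0n.
  rewrite sum_max_norm g0 lerD2l.
  apply: (@le_trans _ _ (\sum_(r < N) E * 4^-1 * r.+1%:R ^- 2)).
    apply: ler_sum => r _; rewrite -mulrA; apply: le_trans (power_decay c0 _ tc); last by rewrite ler1n.
    by rewrite ler_wpM2r // /g exprn_ge0 // invr_ge0 addr_ge0.
  rewrite -mulr_sumr; apply: (@le_trans _ _ (E * 4^-1 * 2)); last lra.
  rewrite ler_pM2l; last by rewrite mulr_gt0.
  by apply: le_trans (sum_inv_square_le R N) _; rewrite gerBl divr_ge0.
have -> : Q (freq0 d) ^+ t.+2 * box_weight R N (freq0 d) = E.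
  rewrite /Q laplace_symbol0 mulr0 addr0 /box_weight big1 ?mulr1 // => j _.
  by rewrite tnth_mktuple /fejer_weight mul0r subr0.
lra.
Qed.

End FejerLowerBound.

(** * Harmonic sums and dyadic scales *)

Section DyadicScales.
Variable R : realType.

Lemma harm_ge0 n : 0 <= harm R n.
Proof. by apply: sumr_ge0. Qed.

Lemma le_harm m n : (m <= n)%N -> harm R m <= harm R n.
Proof.
elim: n => [|n IHn]; first by rewrite leqn0 => /eqP ->.
rewrite leq_eqVlt => /predU1P [-> //|]; rewrite ltnS => /IHn /le_trans; apply.
by rewrite /harm big_ord_recr lerDl.
Qed.

Lemma harm_double n : harm R (2 * n) <= harm R n + 1 /\ ((0 < n)%N -> harm R n + 2^-1 <= harm R (2 * n)).
Proof.
have E : harm R (2 * n) = harm R n + \sum_(i < n) (n + i.+1)%:R^-1.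
  by rewrite mul2n -addnn /harm big_split_ord /=; under [X in _ + X = _]eq_bigr do rewrite -addnS.
rewrite E; split.
  rewrite lerD2l; apply: (@le_trans _ _ (\sum_(i < n) n.+1%:R^-1)).
    by apply: ler_sum => i _; rewrite lef_pV2 ?posrE ?ltr0n // ?ler_nat; lia.
  by rewrite sumr_const card_ord -[leLHS]mulr_natl ler_pdivrMr // mul1r ler_nat.
move=> n0; rewrite lerD2l; apply: (@le_trans _ _ (\sum_(i < n) (2 * n)%N%:R^-1)).
  rewrite sumr_const card_ord -[leRHS]mulr_natl ler_pdivlMr ?ltr0n ?muln_gt0 //.
  by rewrite natrM mulrA mulVf ?mul1r // pnatr_eq0.
by apply: ler_sum => i _; have := ltn_ord i => ?; rewrite lef_pV2 ?posrE ?ltr0n // ?ler_nat; lia.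
Qed.

Lemma harm_exp2M_le b n : harm R (2 ^ b * n) <= harm R n + b%:R.
Proof.
elim: b => [|b IHb]; first by rewrite mul1n addr0.
rewrite expnS -mulnA; have [h _] := harm_double (2 ^ b * n).
by apply: le_trans h _; rewrite -[b.+1%:R]natr1; lra.
Qed.

Lemma harm_exp2_ge b : b%:R / 2 <= harm R (2 ^ b).
Proof.
elim: b => [|b IHb]; first by rewrite mul0r harm_ge0.
have [_ h] := harm_double (2 ^ b); rewrite expnS; apply: le_trans (h _); last by rewrite expn_gt0.
by rewrite -[b.+1%:R]natr1; lra.
Qed.

Lemma cube_le_exp2 j : j%:R ^+ 3 <= 27 * 2 ^+ j :> R.
Proof.
rewrite -!natrX -natrM ler_nat.
have h := ltn_expl (j %/ 3) (isT : (1 < 2)%N).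
have h2 : (j <= 3 * (j %/ 3).+1)%N by have := divn_eq j 3; have := ltn_pmod j (isT : (0 < 3)%N); lia.
apply: (@leq_trans ((3 * 2 ^ (j %/ 3)) ^ 3)).
  by rewrite leq_exp2r //; apply: leq_trans h2 _; rewrite leq_mul2l.
by rewrite expnMn leq_mul2l /= -expnM leq_exp2l // leq_divM.
Qed.

(* [2 ^ j] is about [N ^ (1 / q)], which beats any power of [harm N ~ q j]. *)
Lemma dyadic_scale (q : nat) (D : R) : (0 < q)%N -> exists N0, forall N, (N0 <= N)%N ->
  exists j, [/\ (0 < j)%N, (2 ^ (q * j) <= N)%N, D * j%:R ^+ 2 <= 2 ^+ j & harm R N.+1 <= (3 * q * j)%N%:R].
Proof.
move=> q0; pose j0 := (Num.bound (27 * `|D|)).+1; exists ((2 ^ q) ^ j0)%N => N N0.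
have q1 : (1 < 2 ^ q)%N by rewrite -{1}(expn0 2) ltn_exp2l.
have jj := trunc_log_max q1 N0; set j := trunc_log (2 ^ q) N in jj.
have Npos : (0 < N)%N by apply: leq_trans N0; rewrite !expn_gt0.
have /andP [l u] := trunc_log_bounds q1 Npos; exists j; split.
- exact: leq_trans jj.
- by rewrite expnM.
- have jD : 27 * `|D| <= j%:R.
    apply: le_trans (_ : j0%:R <= _); last by rewrite ler_nat.
    apply: le_trans (ltW (archi_boundP _)) _; first by rewrite mulr_ge0.
    by rewrite ler_nat.
  have := cube_le_exp2 j; have : 27 * `|D| * j%:R ^+ 2 <= j%:R ^+ 3.
    by rewrite [j%:R ^+ 3]exprS ler_wpM2r // sqr_ge0.
  have : D * j%:R ^+ 2 <= `|D| * j%:R ^+ 2 by rewrite ler_wpM2r ?sqr_ge0 // ler_norm.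
  by rewrite -mulrA; lra.
have j1 : (0 < j)%N by exact: leq_trans jj.
(* As [N.+1 <= 2 ^ (q (j + 1))], the harmonic sum is at most [1 + q (j + 1) <= 3 q j]. *)
apply: le_trans (le_harm (_ : N.+1 <= 2 ^ (q * j.+1) * 1)%N) _; first by rewrite muln1 expnM.
apply: le_trans (harm_exp2M_le _ _) _; have -> : harm R 1 = 1%N%:R by rewrite /harm big_ord1 invr1.
rewrite -natrD ler_nat.
by nia.
Qed.
End DyadicScales.

(** * Variation of the Fejer error along a row of frequencies *)

Section AbelSummation.
Variable R : realType.
Variables (c : R) (N p : nat).
Hypotheses (c0 : 0 < c) (pN : (p <= N)%N).

(** The resolvent symbol in dimension 2 at a frequency with coordinates of size [i] and [p], where
    [c] stands for [beta (2 pi)^2]; a row has [p] fixed. *)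
Definition row_symbol (i : nat) : R := (1 + c * i%:R ^+ 2 + c * p%:R ^+ 2)^-1.

Definition row_error (i : nat) : R := (1 - (1 - i%:R / N.+1%:R) * (1 - p%:R / N.+1%:R)) * row_symbol i.

Lemma row_denominator_gt0 (i : nat) : 0 < 1 + c * i%:R ^+ 2 + c * p%:R ^+ 2.
Proof.
have h (n : nat) : 0 <= c * n%:R ^+ 2 by apply: mulr_ge0; [exact: ltW|exact: sqr_ge0].
by have := h i; have := h p; lra.
Qed.

(** The factor in front of the symbol is [p/(N+1) + (1 - p/(N+1)) i/(N+1)]. The first part
    multiplies a decreasing sequence; for the second, [i] times the drop of the symbol lies between
    0 and 3 times its next value. *)
Lemma row_error_diff i : (i <= N)%N ->
  `|row_error i - row_error i.+1| <=
  p%:R / N.+1%:R * (row_symbol i - row_symbol i.+1) + 3 / N.+1%:R * row_symbol i.+1.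
Proof.
move=> iN; have P0 := row_denominator_gt0 i; have P1 := row_denominator_gt0 i.+1.
have M0 : 0 < N.+1%:R :> R by rewrite ltr0n.
have v0 : 0 <= p%:R / N.+1%:R :> R by rewrite divr_ge0.
have v1 : p%:R / N.+1%:R <= 1 :> R by rewrite ler_pdivrMr // mul1r ler_nat ltnW.
pose Dm : R := i%:R * (row_symbol i - row_symbol i.+1).
have ii : i%:R <= i%:R ^+ 2 :> R by rewrite -natrX ler_nat; case: (i) => // n; rewrite -mulnn leq_pmulr.
have i0 : 0 <= i%:R :> R by [].
have cp : 0 <= c * p%:R ^+ 2 by apply: mulr_ge0; [exact: ltW|exact: sqr_ge0].
have ci : c * i%:R <= c * i%:R ^+ 2 by rewrite ler_pM2l.
have ci0 : 0 <= c * i%:R by apply: mulr_ge0 => //; exact: ltW.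
have DE : Dm = (c * i%:R * (2 * i%:R + 1) / (1 + c * i%:R ^+ 2 + c * p%:R ^+ 2)) * row_symbol i.+1.
  rewrite /Dm /row_symbol; move: P0 P1; rewrite -[i.+1%:R]natr1; move: (i%:R : R) (p%:R : R) => s t P0 P1.
  by field; rewrite !lt0r_neq0.
have m1 : 0 <= row_symbol i.+1 by rewrite invr_ge0 ltW.
have D0 : 0 <= Dm.
  by rewrite DE; apply: mulr_ge0 => //; apply: divr_ge0; [apply: mulr_ge0 => //; lra|exact: ltW].
have D3 : Dm <= 3 * row_symbol i.+1.
  rewrite DE ler_wpM2r // ler_pdivrMr //.
  have -> : c * i%:R * (2 * i%:R + 1) = 2 * (c * i%:R ^+ 2) + c * i%:R by ring.
  lra.
have -> : row_error i - row_error i.+1 = p%:R / N.+1%:R * (row_symbol i - row_symbol i.+1) +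
    (1 - p%:R / N.+1%:R) * ((Dm - row_symbol i.+1) / N.+1%:R).
  rewrite /row_error /Dm -[i.+1%:R]natr1; move: (N.+1%:R : R) M0 => M M0.
  by field; rewrite lt0r_neq0.
have dm : 0 <= row_symbol i - row_symbol i.+1.
  rewrite subr_ge0 /row_symbol lef_pV2 ?posrE // lerD2r lerD2l ler_pM2l //.
  by rewrite lerXn2r ?nnegrE // ler_nat.
apply: le_trans (ler_normD _ _) _; rewrite ger0_norm; last exact: mulr_ge0.
rewrite lerD2l normrM ger0_norm; last by rewrite subr_ge0.
apply: (@le_trans _ _ (1 * `|(Dm - row_symbol i.+1) / N.+1%:R|)); first by rewrite ler_wpM2r // gerBl.
rewrite mul1r normrM [`|_^-1|]gtr0_norm ?invr_gt0 // mulrAC ler_pM2r ?invr_gt0 //.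
by rewrite ler_norml; apply/andP; split; lra.
Qed.

(** The drops telescope, and [2 i p <= i^2 + p^2] bounds the symbol by [1 / (c i p)], so a row costs
    [harm / p]. The row [p = 0] uses [i^2 >= i] instead and has weight 1. The boundary term at
    [N.+1], where the Fejer weight vanishes, is the full symbol, at most [1 / (c (N+1)^2)]. *)
Lemma row_error_variation :
  `|row_error N.+1| + \sum_(i < N.+1) `|row_error i - row_error i.+1| <=
  (N.+1%:R^-1 + 4 * (if p == 0 then 1 else p%:R^-1) * harm R N.+1) / (c * N.+1%:R).
Proof.
have M0 : 0 < N.+1%:R :> R by rewrite ltr0n.
set t : R := if _ then _ else _.
have t0 : 0 < t by rewrite /t; case: eqVneq => // p0; rewrite invr_gt0 ltr0n lt0n.
have sq (n : nat) : 0 <= c * n%:R ^+ 2 by apply: mulr_ge0; [exact: ltW|exact: sqr_ge0].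
have m_le (i : nat) : row_symbol i.+1 <= t / c * i.+1%:R^-1.
  have i0 : 0 < i.+1%:R :> R by rewrite ltr0n.
  have -> : t / c * i.+1%:R^-1 = (c * i.+1%:R / t)^-1.
    by rewrite !invfM invrK; ring.
  rewrite /row_symbol lef_pV2 ?posrE ?row_denominator_gt0 //; last by rewrite divr_gt0 // mulr_gt0.
  rewrite /t; case: eqVneq => [->|p0].
    have : c * i.+1%:R <= c * i.+1%:R ^+ 2 by rewrite ler_pM2l // expr2 ler_peMl // ler1n.
    by rewrite divr1; have := sq 0%N; lra.
  rewrite invrK -mulrA; have : 0 <= c * (i.+1%:R - p%:R) ^+ 2 by apply: mulr_ge0; [exact: ltW|exact: sqr_ge0].
  have cip : 0 <= c * (i.+1%:R * p%:R) by apply: mulr_ge0; [exact: ltW|apply: mulr_ge0].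
  have -> : c * (i.+1%:R - p%:R) ^+ 2 = c * i.+1%:R ^+ 2 + c * p%:R ^+ 2 - 2 * (c * (i.+1%:R * p%:R)).
    by move: (i.+1%:R : R) (p%:R : R) => u w; ring.
  by lra.
have s1 : \sum_(i < N.+1) row_symbol i.+1 <= t / c * harm R N.+1.
  by rewrite /harm mulr_sumr; apply: ler_sum => i _.
have p_le : p%:R * row_symbol 0 <= t / c.
  rewrite /t; case: eqVneq => [->|p0]; first by rewrite mul0r divr_ge0 // ltW.
  have pp : 0 < p%:R :> R by rewrite ltr0n lt0n.
  rewrite /row_symbol -invfM ler_pdivrMr ?row_denominator_gt0 // ler_pdivlMl ?mulr_gt0 //.
  by have := sq 0%N; rewrite mulrAC [_ * c]mulrC -expr2; lra.
have last_le : row_symbol N.+1 <= (c * N.+1%:R ^+ 2)^-1.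
  rewrite /row_symbol lef_pV2 ?posrE ?row_denominator_gt0 ?mulr_gt0 ?exprn_gt0 //.
  by have := sq p; lra.
have lastE : `|row_error N.+1| = row_symbol N.+1.
  by rewrite /row_error divff ?lt0r_neq0 // subrr mul0r subr0 mul1r ger0_norm // invr_ge0 ltW ?row_denominator_gt0.
have H1 : 1 <= harm R N.+1 by rewrite -[1]invr1 /harm big_ord_recl lerDl sumr_ge0.
apply: (@le_trans _ _ ((c * N.+1%:R ^+ 2)^-1 + (p%:R / N.+1%:R * (row_symbol 0 - row_symbol N.+1) +
    3 / N.+1%:R * (t / c * harm R N.+1)))).
  rewrite lastE lerD // -(sum_ord_telescope row_symbol).
  apply: (@le_trans _ _ (\sum_(i < N.+1) (p%:R / N.+1%:R * (row_symbol i - row_symbol i.+1) +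
      3 / N.+1%:R * row_symbol i.+1))).
    by apply: ler_sum => i _; apply: row_error_diff; rewrite -ltnS.
  by rewrite big_split /= -!mulr_sumr lerD2l ler_wpM2l // divr_ge0.
apply: (@le_trans _ _ ((c * N.+1%:R ^+ 2)^-1 + (N.+1%:R^-1 * (t / c) + 3 / N.+1%:R * (t / c * harm R N.+1)))).
  rewrite lerD2l lerD2r mulrAC mulrC ler_pM2l ?invr_gt0 //; apply: le_trans p_le.
  by rewrite ler_wpM2l // gerBl invr_ge0 ltW ?row_denominator_gt0.
have -> : (N.+1%:R^-1 + 4 * t * harm R N.+1) / (c * N.+1%:R) =
  (c * N.+1%:R ^+ 2)^-1 + (N.+1%:R^-1 * (t / c) * harm R N.+1 + 3 / N.+1%:R * (t / c * harm R N.+1)).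
  move: (N.+1%:R : R) M0 (harm R N.+1) (t) => M M0 H s; field; by rewrite !lt0r_neq0.
by rewrite lerD2l lerD2r ler_peMr // mulr_ge0 ?invr_ge0 ?(ltW M0) // divr_ge0 // ltW.
Qed.

End AbelSummation.

(** * Replacing Fejer weights by the sharp cut-off *)

Section KernelPositivity.
Variable R : realType.

Definition fejer_error d (beta : R) N (k : frequency d) : R :=
  (1 - box_weight R N k) * resolvent_symbol beta k.

Lemma low_kernel_Re d (beta : R) N (x : d.-tuple R) : complex.Re (low_kernel beta N x) =
  \sum_(k <- freq_box d N) resolvent_symbol beta k * complex.Re (fourier_mode k x).
Proof. by rewrite low_kernelE symbol_poly_Re. Qed.

Lemma low_kernel_gt0 d (beta : R) N (x : d.-tuple R) :
  0 < complex.Re (low_kernel beta N x) -> 0 < low_kernel beta N x.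
Proof.
rewrite low_kernelE symbol_poly_real; last exact: resolvent_symbol_opp.
by move=> /= r0; rewrite ltcE /= eqxx.
Qed.

Lemma low_kernel_Re_ge d (beta c0 : R) N (x : d.-tuple R) :
  c0 <= complex.Re (trig (symbol_poly (fun k => resolvent_symbol beta k * box_weight R N k) N) x) ->
  c0 - `|complex.Re (trig (symbol_poly (fejer_error beta N) N) x)| <= complex.Re (low_kernel beta N x).
Proof.
have -> : complex.Re (low_kernel beta N x) =
    complex.Re (trig (symbol_poly (fun k => resolvent_symbol beta k * box_weight R N k) N) x) +
    complex.Re (trig (symbol_poly (fejer_error beta N) N) x).
  rewrite low_kernel_Re !symbol_poly_Re -big_split; apply: eq_bigr => k _ /=.
  by rewrite /fejer_error; ring.
move=> h; have := lerNnormlW (lexx `|complex.Re (trig (symbol_poly (fejer_error beta N) N) x)|).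
lra.
Qed.

Lemma sum_coef_le d (a : frequency d -> R) (g : nat -> R) N x :
  (forall k, (max_norm k <= N)%N -> `|a k| <= g (max_norm k)) ->
  `|complex.Re (trig (symbol_poly a N) x)| <= g 0%N + \sum_(r < N) (shell d r)%:R * g r.+1.
Proof.
move=> ag; rewrite -sum_max_norm symbol_poly_Re; apply: le_trans (ler_norm_sum _ _ _) _.
rewrite [leLHS]big_seq [leRHS]big_seq; apply: ler_sum => k; rewrite mem_freq_box => /ag.
apply: le_trans; rewrite normrM ler_piMr // (le_trans (normr_Re_le _)) //.
by rewrite normc_fourier_mode.
Qed.

Section Constants.
Variables beta c : R.
Hypothesis beta0 : 0 < beta.
Hypothesis cE : c = beta * (2 * pi) ^+ 2.

Lemma symbol_scale_gt0 : 0 < c.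
Proof. by rewrite cE mulr_gt0 // exprn_gt0 // mulr_gt0 // pi_gt0. Qed.
Let c0 := symbol_scale_gt0.

(** Absolute values suffice here: at size [r] the Fejer defect [r / N.+1] times the symbol, at most
    [1 / (c r^2)], leaves [1 / r], for two frequencies. *)
Lemma fejer_error_dim1 N (x : 1.-tuple R) :
  `|complex.Re (trig (symbol_poly (fejer_error beta N) N) x)| <= 2 * harm R N / (c * N.+1%:R).
Proof.
have M0 : 0 < N.+1%:R :> R by rewrite ltr0n.
have cr (r : nat) : 0 <= c * r%:R ^+ 2 by apply: mulr_ge0; [exact: ltW|exact: sqr_ge0].
apply: le_trans (_ : _ <= 0 + \sum_(r < N) (shell 1 r)%:R * ((c * N.+1%:R)^-1 * r.+1%:R^-1)) _; last first.
  rewrite add0r /harm [X in _ <= X / _]mulr_sumr mulr_suml; apply: ler_sum => r _.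
  rewrite shell1; move: ((c * N.+1%:R)^-1) (r.+1%:R^-1 : R) => u v.
  by rewrite le_eqVlt; apply/orP; left; apply/eqP; ring.
pose g (r : nat) : R := if r is r'.+1 then (c * N.+1%:R)^-1 * r'.+1%:R^-1 else 0.
apply: (@sum_coef_le 1 (fejer_error beta N) g N x) => k kN.
have wk : 1 - box_weight R N k = (max_norm k)%:R / N.+1%:R.
  by rewrite /box_weight /max_norm !big_ord1 /fejer_weight opprB addrC subrK.
have /andP [_ mk] := resolvent_symbol_bounds k (isT : (0 < 1)%N) beta0.
have m0 := resolvent_symbol_ge0 k beta0.
rewrite /fejer_error wk; move: mk; rewrite -cE; case: (max_norm k) => [|r] mk; first by rewrite !mul0r normr0.
have r0 : 0 < r.+1%:R :> R by rewrite ltr0n.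
rewrite ger0_norm /g; last by rewrite mulr_ge0 // divr_ge0.
have mk' : resolvent_symbol beta k <= (c * r.+1%:R ^+ 2)^-1.
  apply: le_trans mk _; rewrite lef_pV2 ?posrE ?ltr_pwDl ?mulr_gt0 ?exprn_gt0 //.
  by rewrite lerDr.
apply: (@le_trans _ _ (r.+1%:R / N.+1%:R * (c * r.+1%:R ^+ 2)^-1)).
  by rewrite ler_wpM2l // divr_ge0.
rewrite le_eqVlt; apply/orP; left; apply/eqP; move: (N.+1%:R : R) (r.+1%:R : R) M0 r0 => M u M0 u0.
by field; rewrite !lt0r_neq0.
Qed.

(** The modes [i] and [-i] together, so that the partial sums are Dirichlet kernels. *)
Definition dirichlet_coef (t : R) (i : nat) : R := if i is 0%N then 1 else 2 * cos (2 * pi * (i%:R * t)).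

Lemma dirichlet_sum (t : R) n :
  sin (pi * t) * \sum_(i < n.+1) dirichlet_coef t i = sin ((2 * n%:R + 1) * (pi * t)).
Proof.
elim: n => [|n IHn]; first by rewrite big_ord1 mulr1 mulr0 add0r mul1r.
rewrite big_ord_recr mulrDr IHn /=.
have -> : 2 * pi * (n.+1%:R * t) = (2 * n%:R + 2) * (pi * t) by rewrite -[n.+1%:R]natr1; ring.
have -> : (2 * n%:R + 1) * (pi * t) = (2 * n%:R + 2) * (pi * t) - pi * t by ring.
have -> : (2 * n.+1%:R + 1) * (pi * t) = (2 * n%:R + 2) * (pi * t) + pi * t by rewrite -[n.+1%:R]natr1; ring.
by rewrite sinB sinD; ring.
Qed.

Lemma dirichlet_sum_le (t : R) n : sin (pi * t) != 0 ->
  `|\sum_(i < n) dirichlet_coef t i| <= `|sin (pi * t)|^-1.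
Proof.
move=> s0; case: n => [|n]; first by rewrite big_ord0 normr0 invr_ge0.
rewrite -[leRHS]mul1r ler_pdivlMr ?normr_gt0 // mulrC -normrM dirichlet_sum.
by rewrite ler_norml sin_geN1 sin_le1.
Qed.

Lemma fejer_error_cons N (n : int) (k : frequency 1) :
  fejer_error beta N (freq_cons n k) = row_error c N (max_norm k) `|n|%N.
Proof.
rewrite /fejer_error /row_error /row_symbol /box_weight big_ord_recl big_ord1 tnthS tnth0.
rewrite /fejer_weight resolvent_symbolE /laplace_symbol big_ord_recl big_ord1 tnthS tnth0.
rewrite /max_norm big_ord1; congr ((1 - (1 - _) * (1 - _)) * _^-1).
by rewrite !sqr_phase cE; ring.
Qed.

Lemma row_sum N (a : nat -> R) (t : R) :
  \sum_(n <- int_box N) (a `|n|%N)%:C * expi (2 * pi * (n%:~R * t)) =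
  (\sum_(i < N.+1) a i * dirichlet_coef t i)%:C.
Proof.
rewrite sum_int_box big_ord_recl -addrA -big_split /= [in RHS]big_ord_recl rmorphD rmorph_sum /=.
congr (_ + _); first by rewrite mul0r mulr0 expi0 !mulr1.
apply: eq_bigr => i _; have -> : bump 0 i = i.+1 by rewrite /bump leq0n.
have -> : 2 * pi * ((- i.+1%:Z)%:~R * t) = - (2 * pi * (i.+1%:R * t)) by rewrite rmorphN /= mulNr mulrN.
by rewrite -mulrDr expiDN [RHS]rmorphM.
Qed.

(** Summation by parts in the first frequency, with Dirichlet kernels bounded by [1 / |sin (pi t)|],
    costs the variation of each row; the rows, weighted by [1 / p], give the second harmonic sum.
    The constant is [2 + 4 + 8]. *)
Lemma fejer_error_dim2 N (t : R) (y : 1.-tuple R) : sin (pi * t) != 0 ->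
  `|complex.Re (trig (symbol_poly (fejer_error beta N) N) [tuple of t :: y])| <=
  14 * harm R N.+1 ^+ 2 / (c * N.+1%:R * `|sin (pi * t)|).
Proof.
move=> s0; apply: le_trans (normr_Re_le _) _.
have M0 : 0 < N.+1%:R :> R by rewrite ltr0n.
have M1 : 1 <= N.+1%:R :> R by rewrite ler1n.
pose H := harm R N.+1; have H1 : 1 <= H by rewrite -[1]invr1 /H /harm big_ord_recl lerDl sumr_ge0.
pose row (k : frequency 1) : R := \sum_(i < N.+1) row_error c N (max_norm k) i * dirichlet_coef t i.
have -> : trig (symbol_poly (fejer_error beta N) N) [tuple of t :: y] =
    \sum_(k <- freq_box 1 N) (row k)%:C * fourier_mode k y.
  rewrite trig_symbol_poly sum_freq_box_cons exchange_big /=; apply: eq_bigr => k _.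
  rewrite /row -(row_sum N (row_error c N (max_norm k))) mulr_suml; apply: eq_bigr => n _.
  by rewrite fourier_mode_cons fejer_error_cons mulrA.
apply: le_trans (normc_sum _ _) _.
pose V (p : nat) : R := (N.+1%:R^-1 + 4 * (if p == 0 then 1 else p%:R^-1) * H) / (c * N.+1%:R).
apply: (@le_trans _ _ (\sum_(k <- freq_box 1 N) V (max_norm k) * `|sin (pi * t)|^-1)).
  rewrite [leLHS]big_seq [leRHS]big_seq; apply: ler_sum => k; rewrite mem_freq_box => kN.
  rewrite Normc.normcM normc_fourier_mode mulr1 normcC.
  apply: le_trans (sum_by_parts_le (row_error c N (max_norm k)) N.+1 (fun n => dirichlet_sum_le n s0)) _.
  by rewrite ler_wpM2r ?invr_ge0 //; exact: row_error_variation.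
rewrite -mulr_suml sum_max_norm invfM mulrA ler_wpM2r ?invr_ge0 //.
have HN : harm R N <= H by exact: le_harm.
have -> : V 0%N + \sum_(r < N) (shell 1 r)%:R * V r.+1 =
    ((N%:R * 2 + 1) / N.+1%:R + 4 * H + 8 * H * harm R N) / (c * N.+1%:R).
  have E r : (shell 1 r)%:R * V r.+1 = (2 / N.+1%:R + 8 * H * r.+1%:R^-1) / (c * N.+1%:R).
    by rewrite shell1 /V /= mulrA; congr (_ / _); ring.
  under eq_bigr do rewrite E.
  rewrite -mulr_suml big_split /= sumr_const card_ord -mulr_sumr -/(harm R N) /V /= -mulrDl.
  by congr (_ / _); rewrite -mulr_natr; ring.
rewrite ler_pM2r ?invr_gt0 ?mulr_gt0 //.
have h1 : (N%:R * 2 + 1) / N.+1%:R <= 2 :> R by rewrite ler_pdivrMr // -natr1; lra.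
have H0 : 0 <= H by exact: le_trans H1.
have h2 : H <= H ^+ 2 by rewrite expr2 ler_peMl.
have h3 : H * harm R N <= H ^+ 2 by rewrite expr2 ler_wpM2l.
have fin (u h w : R) : u <= 2 -> 1 <= h -> h <= h ^+ 2 -> h * w <= h ^+ 2 ->
  u + 4 * h + 8 * h * w <= 14 * h ^+ 2 by move=> *; lra.
exact: fin.
Qed.

End Constants.
End KernelPositivity.

(** * Positivity near and away from the lattice points *)

Section PositivityNearOrigin.
Variable R : realType.

Lemma norm_sin_int_le (n : int) (y : R) : `|sin (n%:~R * y)| <= `|n|%N%:R * `|sin y|.
Proof.
case: n => n.
  have -> : (Posz n)%:~R * y = y *+ n by rewrite -pmulrn mulr_natl.
  exact: norm_sin_mulrn_le.
have -> : (Negz n)%:~R * y = - (y *+ n.+1) by rewrite NegzE rmorphN /= mulNr -pmulrn mulr_natl.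
rewrite sinN normrN; exact: norm_sin_mulrn_le.
Qed.

(** The real part is [cos (2 phi) = 1 - 2 sin^2 phi], with [phi] equal to pi times the product of
    [k] and [x], and the addition formula gives [|sin phi| <= 1/2]. Working with [|sin (pi x_j)|]
    treats all lattice points alike. *)
Lemma Re_fourier_mode_ge (k : frequency 2) (x : 2.-tuple R) (M : nat) : (max_norm k <= M)%N ->
  M%:R * (`|sin (pi * tnth x ord0)| + `|sin (pi * tnth x (lift ord0 ord0))|) <= 2^-1 ->
  2^-1 <= complex.Re (fourier_mode k x).
Proof.
move=> kM small; have kj j : (`|tnth k j| <= M)%N by apply: leq_trans kM; exact: (leq_bigmax j).
rewrite /= big_ord_recl big_ord1.
move: small (kj ord0) (kj (lift ord0 ord0)).
move: (tnth x ord0) (tnth x (lift ord0 ord0)) (tnth k ord0) (tnth k (lift ord0 ord0)) => u v m n small mM nM.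
have -> : 2 * pi * (m%:~R * u + n%:~R * v) = (m%:~R * (pi * u) + n%:~R * (pi * v)) +
    (m%:~R * (pi * u) + n%:~R * (pi * v)) by ring.
have hm : `|sin (m%:~R * (pi * u))| <= M%:R * `|sin (pi * u)|.
  by apply: le_trans (norm_sin_int_le _ _) _; rewrite ler_wpM2r // ler_nat.
have hn : `|sin (n%:~R * (pi * v))| <= M%:R * `|sin (pi * v)|.
  by apply: le_trans (norm_sin_int_le _ _) _; rewrite ler_wpM2r // ler_nat.
move: (m%:~R * (pi * u)) (n%:~R * (pi * v)) hm hn => a b hm hn.
have cos1 (y : R) : `|cos y| <= 1 by rewrite ler_norml cos_geN1 cos_le1.
have s : `|sin (a + b)| <= 2^-1.
  apply: le_trans small; rewrite mulrDr sinD; apply: le_trans (ler_normD _ _) _; rewrite !normrM.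
  apply: lerD.
    by apply: le_trans hm; rewrite ler_piMr.
  by apply: le_trans hn; rewrite ler_piMl.
have s2 : sin (a + b) ^+ 2 <= 4^-1.
  rewrite -real_normK ?num_real // (_ : 4^-1 = 2^-1 ^+ 2 :> R); last by rewrite exprVn -natrX.
  by rewrite lerXn2r ?nnegrE.
by have := cos2Dsin2 (a + b); rewrite [cos (a + b + (a + b))]cosD -!expr2; lra.
Qed.

(* Frequencies up to [M] contribute at least half of their symbol, those beyond
   [M] at worst the opposite of theirs; [8 r] frequencies have max norm [r]. *)
Lemma low_kernel_near (beta c : R) N M (x : 2.-tuple R) : 0 < beta -> c = beta * (2 * pi) ^+ 2 ->
  (M <= N)%N ->
  M%:R * (`|sin (pi * tnth x ord0)| + `|sin (pi * tnth x (lift ord0 ord0))|) <= 2^-1 ->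
  8 / c * (harm R N - harm R M) <= 4 / (1 + 2 * c) * harm R M ->
  0 < complex.Re (low_kernel beta N x).
Proof.
move=> b0 cE MN small hH; have c0 := symbol_scale_gt0 b0 cE.
have cr (r : nat) : 0 <= c * r%:R ^+ 2 by apply: mulr_ge0; [exact: ltW|exact: sqr_ge0].
pose g (r : nat) : R := if (r <= M)%N then (1 + 2 * c * r%:R ^+ 2)^-1 / 2 else - (1 + c * r%:R ^+ 2)^-1.
apply: (@lt_le_trans _ _ (\sum_(k <- freq_box 2 N) g (max_norm k))); last first.
  rewrite low_kernel_Re [leLHS]big_seq [leRHS]big_seq; apply: ler_sum => k _.
  have /andP [] := resolvent_symbol_bounds k (isT : (0 < 2)%N) b0; rewrite -cE => lo hi.
  have m0 := resolvent_symbol_ge0 k b0.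
  rewrite /g; case: leqP => kM.
    have e := Re_fourier_mode_ge kM small.
    apply: (@le_trans _ _ (resolvent_symbol beta k * 2^-1)); last exact: ler_wpM2l.
    by rewrite ler_pM2r.
  apply: (@le_trans _ _ (- resolvent_symbol beta k)); first by rewrite lerN2.
  rewrite -mulrN1 ler_wpM2l //; have := normr_Re_le (fourier_mode k x).
  by rewrite normc_fourier_mode ler_norml => /andP [].
rewrite sum_max_norm; set A := 4 / (1 + 2 * c) in hH; set B := 8 / c in hH.
have g0 : 0 < g 0%N.
  by rewrite /g leq0n divr_gt0 // invr_gt0 ltr_pwDl // -mulrA mulr_ge0.
have S : A * harm R M - B * (harm R N - harm R M) <= \sum_(r < N) (shell 2 r)%:R * g r.+1.
  apply: (@le_trans _ _ (\sum_(r < N) ((A + B) * (if (r < M)%N then r.+1%:R^-1 else 0) - B * r.+1%:R^-1))).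
    rewrite sumrB -!mulr_sumr -big_mkcond -(big_ord_widen N (fun r => r.+1%:R^-1 : R) MN) -/(harm R N) -/(harm R M).
    by rewrite le_eqVlt; apply/orP; left; apply/eqP; ring.
  apply: ler_sum => r _; rewrite shell2 natrM /g.
  have r1 : 1 <= r.+1%:R :> R by rewrite ler1n.
  have := cr r.+1; move: (r.+1%:R : R) r1 => u u1 cu; have u0 : 0 < u by lra.
  case: ifP => _.
    have -> : (A + B) / u - B / u = A / u by rewrite -mulrBl addrK.
    have P0 : 0 < 1 + 2 * c * u ^+ 2 by rewrite -mulrA; lra.
    have C0 : 0 < 1 + 2 * c by lra.
    rewrite (_ : 8 * u * _ = 4 * u / (1 + 2 * c * u ^+ 2)); last first.
      by field; rewrite lt0r_neq0.
    rewrite /A -mulrA -invfM ler_pdivlMr // mulrAC ler_pdivrMr ?mulr_gt0 // -!mulrA ler_pM2l //.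
    have uu : 1 <= u ^+ 2 by rewrite expr_ge1 //; lra.
    rewrite (_ : u * ((1 + 2 * c) * u) = (1 + 2 * c) * u ^+ 2); last by ring.
    by nra.
  rewrite mulr0 sub0r mulrN lerN2 /B -mulrA -[leLHS]mulrA ler_pM2l // -invfM.
  have P0 : 0 < 1 + c * u ^+ 2 by lra.
  rewrite ler_pdivrMr // ler_pdivlMl ?mulr_gt0 //.
  rewrite (_ : c * u * u = c * u ^+ 2); last by ring.
  lra.
by move: g0 S hH; move: (\sum_(r < N) _) (g 0%N) => s w; lra.
Qed.

Definition tuple_rev (T : Type) d (z : d.-tuple T) : d.-tuple T := [tuple tnth z (rev_ord i) | i < d].

Lemma tuple_revK T d : involutive (@tuple_rev T d).
Proof. by move=> z; apply: eq_from_tnth => i; rewrite !tnth_mktuple rev_ordK. Qed.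

Lemma max_norm_rev d (k : frequency d) : max_norm (tuple_rev k : frequency d) = max_norm k.
Proof.
rewrite /max_norm [RHS](reindex_inj rev_ord_inj) /=.
by apply: eq_bigr => i _; rewrite tnth_mktuple.
Qed.

(** Exchanging the coordinates lets the case of a large [|sin (pi x_j)|] be treated for the first
    coordinate alone. *)
Lemma low_kernel_rev d (beta : R) N (x : d.-tuple R) :
  low_kernel beta N (tuple_rev x) = low_kernel beta N x.
Proof.
have P : perm_eq [seq (tuple_rev k : frequency d) | k <- freq_box d N] (freq_box d N).
  apply: uniq_perm; rewrite ?freq_box_uniq ?map_inj_uniq ?freq_box_uniq //.
    exact: inv_inj (@tuple_revK int d).
  move=> k; rewrite mem_freq_box -max_norm_rev -mem_freq_box.
  apply/mapP/idP => [[h hb ->]|kb]; first by rewrite tuple_revK.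
  by exists (tuple_rev k : frequency d); rewrite ?tuple_revK.
rewrite !low_kernelE !trig_symbol_poly -(perm_big _ P) big_map; apply: eq_bigr => k _.
congr (_%:C * _).
  rewrite !resolvent_symbolE /laplace_symbol [in RHS](reindex_inj rev_ord_inj) /=.
  by congr (1 + _ * _)^-1; apply: eq_bigr => i _; rewrite tnth_mktuple.
rewrite !fourier_modeE [in RHS](reindex_inj rev_ord_inj) /=; congr (expi (_ * _)).
by apply: eq_bigr => i _; rewrite !tnth_mktuple.
Qed.

Lemma low_kernel_positive1 (beta : R) : 0 < beta -> exists N0, forall N, (N0 <= N)%N ->
  forall x : 1.-tuple R, 0 < low_kernel beta N x.
Proof.
move=> b0; have [c1 c1_gt0 lower] := @fejer_resolvent_lower R 1 beta (or_introl erefl) b0.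
have [c cE] : exists c, c = beta * (2 * pi) ^+ 2 by exists (beta * (2 * pi) ^+ 2).
have c0 := symbol_scale_gt0 b0 cE.
(* [6 = 2 * 3]: the error is at most [2 harm N / (c N.+1)], and [harm N <= 3 j] at this scale. *)
have [N0 scale] := @dyadic_scale R 1 (6 / (c * c1)) isT.
exists N0 => N /scale [j [j0 jN Dj Hj]] x; apply: low_kernel_gt0.
apply: lt_le_trans (low_kernel_Re_ge (lower N x)).
rewrite subr_gt0; apply: le_lt_trans (fejer_error_dim1 b0 cE N x) _.
have M0 : 0 < N.+1%:R :> R by rewrite ltr0n.
have cc : 0 < c * c1 by rewrite mulr_gt0.
rewrite ltr_pdivrMr ?mulr_gt0 //.
have h1 : 2 ^+ j < N.+1%:R :> R by rewrite -natrX ltr_nat ltnS; rewrite mul1n in jN.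
have h2 : harm R N <= 3 * j%:R by apply: le_trans (le_harm R (leqnSn N)) _; rewrite muln1 natrM in Hj.
have h3 : j%:R <= j%:R ^+ 2 :> R by rewrite -natrX ler_nat -mulnn leq_pmulr.
have h4 : 6 * j%:R ^+ 2 <= c * c1 * 2 ^+ j.
  by move: Dj; rewrite mulrAC ler_pdivrMr // [X in _ <= X]mulrC.
have h5 : c * c1 * 2 ^+ j < c * c1 * N.+1%:R by rewrite ltr_pM2l.
rewrite (_ : c1 * _ = c * c1 * N.+1%:R); last by rewrite mulrCA mulrA.
by lra.
Qed.

(** Where some [|sin (pi x_j)|] exceeds [theta], the Fejer error is below [c1]. Elsewhere
    [low_kernel_near] applies with [M] about [N / 2 ^ j]: then [harm N - harm M <= 2 j], whereas
    [harm M >= b j / 2], and [b] can be taken large. *)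
Lemma low_kernel_positive2 (beta : R) : 0 < beta -> exists N0, forall N, (N0 <= N)%N ->
  forall x : 2.-tuple R, 0 < low_kernel beta N x.
Proof.
move=> b0; have [c1 c1_gt0 lower] := @fejer_resolvent_lower R 2 beta (or_intror erefl) b0.
have [c cE] : exists c, c = beta * (2 * pi) ^+ 2 by exists (beta * (2 * pi) ^+ 2).
have c0 := symbol_scale_gt0 b0 cE; have cc : 0 < c * c1 by rewrite mulr_gt0.
have [A [A0 AE]] : exists A, 0 < A /\ A = 4 / (1 + 2 * c) by exists (4 / (1 + 2 * c)); rewrite divr_gt0 //; lra.
have [B [B0 BE]] : exists B, 0 < B /\ B = 8 / c by exists (8 / c); rewrite divr_gt0.
(* [4 B <= b A] is what [B * 2 j <= A * b j / 2] requires. *)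
pose b := Num.bound (4 * B / A).
have bA : 4 * B <= b%:R * A.
  by rewrite -ler_pdivrMr //; apply/ltW/archi_boundP; rewrite divr_ge0 ?mulr_ge0 // ltW.
(* The exponent [b.+1] leaves [M >= 2 ^ (b j)] after division of [N] by [2 ^ j]. The constant is
   [504 = 2 * 28 * 9], from [2 theta M <= 1/2] and [harm^2 <= 9 (b + 1)^2 j^2]. *)
have [N0 scale] := @dyadic_scale R b.+1 (504 * b.+1%:R ^+ 2 / (c * c1)) isT.
exists N0 => N /scale [j [j0 jN Dj Hj]] x; apply: low_kernel_gt0.
have M0 : 0 < N.+1%:R :> R by rewrite ltr0n.
have cM : 0 < c * N.+1%:R * c1 by rewrite !mulr_gt0.
(* The value of [|sin (pi t)|] at which the bound of [fejer_error_dim2] equals [c1]. *)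
pose theta : R := 14 * harm R N.+1 ^+ 2 / (c * N.+1%:R * c1).
have theta0 : 0 <= theta.
  by apply: divr_ge0; [apply: mulr_ge0 => //; exact: sqr_ge0|exact: ltW].
have far (z : 2.-tuple R) : theta < `|sin (pi * tnth z ord0)| -> 0 < complex.Re (low_kernel beta N z).
  move=> tz; have z0 : 0 < `|sin (pi * tnth z ord0)| by exact: le_lt_trans tz.
  apply: lt_le_trans (low_kernel_Re_ge (lower N z)); rewrite subr_gt0.
  have s0 : sin (pi * thead z) != 0 by rewrite -normr_gt0.
  have := fejer_error_dim2 b0 cE N [tuple of behead z] s0; rewrite -tuple_eta => h.
  apply: le_lt_trans h _; rewrite ltr_pdivrMr ?mulr_gt0 //.
  move: tz; rewrite /theta ltr_pdivrMr // => tz; apply: lt_le_trans tz _.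
  rewrite -[thead z]/(tnth z ord0) le_eqVlt; apply/orP; left; apply/eqP.
  by move: (`|_| : R) (N.+1%:R : R) => s u; ring.
have [|sx0] := ltP theta `|sin (pi * tnth x ord0)|; first exact: far.
have [|sx1] := ltP theta `|sin (pi * tnth x (lift ord0 ord0))|.
  move=> h; rewrite -low_kernel_rev; apply: far; rewrite tnth_mktuple.
  by rewrite (_ : rev_ord ord0 = lift ord0 ord0) //; exact: val_inj.
pose M := (N %/ 2 ^ j)%N.
have p2 : (0 < 2 ^ j)%N by rewrite expn_gt0.
have Mlow : (2 ^ (b * j) <= M)%N.
  by rewrite /M leq_divRL // -expnD addnC -mulSn.
have Mpos : (0 < M)%N by apply: leq_trans Mlow; rewrite expn_gt0.
have MN : (M * 2 ^ j <= N)%N by exact: leq_divM.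
have NM : (N <= 2 ^ j.+1 * M)%N.
  rewrite [leqLHS](divn_eq N (2 ^ j)) -/M expnS -mulnA mul2n -addnn [(2 ^ j * M)%N]mulnC leq_add2l.
  by apply: leq_trans (ltnW (ltn_pmod N p2)) _; rewrite leq_pmull.
apply: (@low_kernel_near beta c N M x b0 cE); first exact: leq_div.
  apply: (@le_trans _ _ (M%:R * (theta + theta))); first by rewrite ler_wpM2l // lerD.
  have -> : M%:R * (theta + theta) = 28 * harm R N.+1 ^+ 2 * M%:R / (c * N.+1%:R * c1).
    by rewrite /theta; move: (c * _ * c1)^-1 (harm R N.+1) (M%:R : R) => u h w; ring.
  rewrite ler_pdivrMr //.
  have h1 : harm R N.+1 ^+ 2 <= 9 * b.+1%:R ^+ 2 * j%:R ^+ 2.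
    apply: (@le_trans _ _ ((3 * b.+1 * j)%N%:R ^+ 2)); first by rewrite lerXn2r ?nnegrE ?harm_ge0.
    by rewrite !natrM !exprMn -[in leLHS]natrX.
  have h2 : 504 * b.+1%:R ^+ 2 * j%:R ^+ 2 <= c * c1 * 2 ^+ j.
    by move: Dj; rewrite mulrAC ler_pdivrMr // [X in _ <= X]mulrC.
  have h3 : 2 ^+ j * M%:R <= N.+1%:R :> R by rewrite -natrX -natrM ler_nat mulnC ltnW.
  have h4 : harm R N.+1 ^+ 2 * M%:R <= 9 * b.+1%:R ^+ 2 * j%:R ^+ 2 * M%:R by rewrite ler_wpM2r.
  have h5 : 504 * b.+1%:R ^+ 2 * j%:R ^+ 2 * M%:R <= c * c1 * 2 ^+ j * M%:R by rewrite ler_wpM2r.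
  have h6 : c * c1 * (2 ^+ j * M%:R) <= c * c1 * N.+1%:R by rewrite ler_pM2l.
  rewrite (_ : c * N.+1%:R * c1 = c * c1 * N.+1%:R); last by rewrite mulrAC.
  rewrite -!mulrA in h4 h5 h6 *; lra.
rewrite -AE -BE.
have h1 : harm R N - harm R M <= 2 * j%:R.
  have := le_harm R NM; have := harm_exp2M_le R j.+1 M; rewrite -[j.+1%:R]natr1.
  have : 1 <= j%:R :> R by rewrite ler1n.
  lra.
have h2 : (b * j)%N%:R / 2 <= harm R M by apply: le_trans (harm_exp2_ge R _) (le_harm R Mlow).
apply: (@le_trans _ _ (B * (2 * j%:R))); first by rewrite ler_pM2l.
apply: (@le_trans _ _ (A * ((b * j)%N%:R / 2))); last by rewrite ler_pM2l.
rewrite natrM; have : 4 * B * j%:R <= b%:R * A * j%:R by rewrite ler_wpM2r.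
lra.
Qed.

Lemma low_kernel_positive d (beta : R) : d = 1%N \/ d = 2%N -> 0 < beta ->
  exists N0, forall N, (N0 <= N)%N -> forall x : d.-tuple R, 0 < low_kernel beta N x.
Proof.
by case=> -> b0; [exact: low_kernel_positive1|exact: low_kernel_positive2].
Qed.

End PositivityNearOrigin.

(* Kernel bounds and maximum principles *)
Local Close Scope complex_scope.

Theorem theorem1p2 (R : realType) (d : nat) (hd : (1 <= d)%N) :
  (exists c1 c2 : R, [/\ 0 < c1, 0 < c2 &
    forall (N : nat) (beta : R), (2 <= N)%N -> 0 < beta ->
      (exists K : d.-tuple R -> R[i], is_high_kernel beta N K) /\
      (forall K : d.-tuple R -> R[i], is_high_kernel beta N K ->
        ((c1 / (1 + beta * N%:R ^+ 2) * ln (N%:R + 2) ^+ d)%:E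
           <= Lp_norm 1 K)%E /\
        (Lp_norm 1 K
           <= (c2 / (1 + beta * N%:R ^+ 2) * ln (N%:R + 2) ^+ d)%:E)%E)])
  /\
  (exists c3 : R, 0 < c3 /\
    forall (N : nat) (beta : R), (2 <= N)%N -> 0 < beta ->
    forall f : d.-tuple R -> R[i], in_Linfty f ->
      (Lp_norm +oo (low_operator beta N f)
         <= (1 + c3 / (1 + beta * N%:R ^+ 2) * ln (N%:R + 2) ^+ d)%:E
            * Lp_norm +oo f)%E)
  /\
  (d = 1%N \/ d = 2%N ->
    forall beta : R, 0 < beta ->
    exists N0 : nat, forall N : nat, (2 <= N)%N -> (N0 <= N)%N ->
      [/\ forall x : d.-tuple R, (forall j, 0 <= tnth x j < 1) ->
            0 < low_kernel beta N x,
          Lp_norm 1 (low_kernel (d := d) beta N) = 1%E &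
          forall f : d.-tuple R -> R[i], in_Linfty f ->
            (Lp_norm +oo (low_operator beta N f) <= Lp_norm +oo f)%E]).
Proof.
split; last split.
- exists (high_lower_constant R d), (high_upper_constant R d).
  split; [exact: high_lower_constant_gt0|exact: high_upper_constant_gt0|move=> N beta N2 b0].
  have N0 : (0 < N)%N by exact: leq_trans N2.
  split; first exact: high_kernel_exists.
  by move=> K hK; split; [exact: high_kernel_L1_lower|exact: high_kernel_L1_upper].
- exists (high_upper_constant R d); split; first exact: high_upper_constant_gt0.
  move=> N beta N2 b0 f; apply: low_operator_effective => //; exact: leq_trans N2.
move=> d12 beta b0; have [N0 pos] := low_kernel_positive d12 b0.
exists N0 => N _ N0N; have [mass mult_one] := low_kernel_positive_mass b0 (fun x _ => pos N N0N x).
split=> // [x _|f If]; first exact: pos.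
by have := low_operator_Linfty mult_one If; rewrite mul1e.
Qed.
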